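(* Let $X$ be a smooth projective geometrically irreducible curve over $\mathbb{F}_q$ of genus $g_X$ with function field $F$, and let $m_X=\max\{2g_X-2,0\}$. Let $\mathcal{V}_0$ be the complex vector space of all functions $f:\mathrm{PGL}_2(F)\backslash\mathrm{PGL}_2(\mathbb{A})/K\to\mathbb{C}$ such that $$\int_{N(F)\backslash N(\mathbb{A})}\Phi(f)(n)\,dn=0\qquad\text{for all }\Phi\in\mathcal{H}_K.$$ Then the dimension of $\mathcal{V}_0$ is finite and bounded by $$\dim\mathcal{V}_0\le\#\{[\mathcal{M}]\in\mathbb{P}\mathrm{Bun}_2X\mid\delta(\mathcal{M})\le m_X\}.$$
   Context: $\mathbb{A}$ is the adele ring of $F$, $\mathcal{O}_{\mathbb{A}}=\prod_x\mathcal{O}_x$ its maximal compact subring, $G=\mathrm{PGL}_2$, $K=G(\mathcal{O}_{\mathbb{A}})$, and $N\subset G$ is the subgroup of upper triangular unipotent matrices. $dn$ is a (non-zero) Haar measure on $N(F)\backslash N(\mathbb{A})$. The Haar measure on $G(\mathbb{A})$ is normalized by $\mathrm{vol}\,K=1$. $\mathcal{H}_K$ is the algebra of compactly supported, locally constant, bi-$K$-invariant functions $\Phi:G(\mathbb{A})\to\mathbb{C}$ under convolution, acting by $\Phi(f)(g)=\int_{G(\mathbb{A})}\Phi(h)f(gh)\,dh$. $\mathbb{P}\mathrm{Bun}_2X$ is the set of isomorphism classes of rank $2$ vector bundles on $X$ modulo tensoring with line bundles. For a rank $2$ bundle $\mathcal{M}$, $\delta(\mathcal{M})=\sup(2\deg\mathcal{L}-\deg\mathcal{M})$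 over all line subbundles $\mathcal{L}\to\mathcal{M}$ (injective morphisms from a line bundle with locally free cokernel); it only depends on the class $[\mathcal{M}]\in\mathbb{P}\mathrm{Bun}_2X$. *)

(* Defs.v *)
From HB Require Import structures.
From mathcomp Require Import all_boot all_order all_algebra.
From mathcomp Require Import complex.
From mathcomp Require Import all_classical all_reals all_analysis.

Set Implicit Arguments.
Unset Strict Implicit.
Unset Printing Implicit Defensive.

Import Order.TTheory GRing.Theory Num.Theory.

Local Open Scope classical_set_scope.
Local Open Scope ring_scope.

(** A smooth projective geometrically irreducible curve over a finite field k
    is given by its function field F, the closed points being the discrete
    valuation rings of F containing k (Hartshorne I.6); it is smooth because its
    local rings are regular and k is perfect.  The nonempty open
    sets are the cofinite ones, and the sections of the structure sheaf over U
    are the f in F that lie in the local ring of every point of U. *)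

Definition almost_all (T : Type) (P : T -> Prop) := finite_set (~` [set x | P x]).

(* [is_dim sc W U d]: the quotient W / U of subspaces of the L-module V,
   viewed as a K-module along sc : K -> L, is free with a basis of d elements. *)
Definition is_dim (K L : nzRingType) (sc : K -> L) (V : lmodType L)
    (W U : set V) (d : nat) :=
  exists e : 'I_d -> V, (forall i, W (e i)) /\
    forall w, W w -> exists! c : {ffun 'I_d -> K},
      U (w - \sum_i sc (c i) *: e i).

(* Normalized discrete valuation; the value at 0, which should be infinite, is
   set to 0 and never used: order comparisons go through [vge]. *)
Definition is_dval (E : fieldType) (v : E -> int) :=
  [/\ v 0 = 0,
      forall a b, a != 0 -> b != 0 -> v (a * b) = v a + v b,
      forall a b, a != 0 -> b != 0 -> a + b != 0 ->
        Num.min (v a) (v b) <= v (a + b)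
    & exists2 a, a != 0 & v a = 1].

Definition vge (E : fieldType) (v : E -> int) (n : int) (a : E) : bool :=
  (a == 0) || (n <= v a).

Definition mxint (E : fieldType) (v : E -> int) m n (A : 'M[E]_(m, n)) :=
  forall i j, vge v 0 (A i j).

Definition GLint (E : fieldType) (v : E -> int) n (A : 'M[E]_n) :=
  [/\ A \in unitmx, mxint v A & v (\det A) = 0].

Record curve (k : finFieldType) := Curve {
  ff : fieldType;
  cst : {rmorphism k -> ff};
  (* ff is a finite extension of a rational function field k(t) *)
  ff_gen : exists t : ff,
    (forall p : {poly k}, (map_poly cst p).[t] = 0 -> p = 0) /\
    (exists (d : nat) (e : 'I_d -> ff), forall f, exists (q : {poly k})
       (p : 'I_d -> {poly k}), q != 0 /\
       (map_poly cst q).[t] * f = \sum_i (map_poly cst (p i)).[t] * e i);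
  (* geometric irreducibility: the tensor product over k of ff with any finite
     extension k[T]/(p) of k is a field *)
  ff_geom : forall p : {poly k},
    irreducible_poly p -> irreducible_poly (map_poly cst p) }.

Section Curve.
Context (k : finFieldType) (X : curve k).
Local Notation F := (ff X).

(* Closed points of X. *)
Record place := Place {
  ord :> F -> int;
  ord_dval : is_dval ord;
  ord_cst : forall c : k, c != 0 -> ord (cst X c) = 0 }.

HB.instance Definition _ := gen_eqMixin place.
HB.instance Definition _ := gen_choiceMixin place.

(* Degree over k of the residue field. *)
Definition degp (x : place) : nat :=
  xget 0%N [set d | is_dim (cst X) (V := F^o) [set f | vge x 0 f]
                                             [set f | vge x 1 f] d].

(* dim_k H^1(X, O_X), computed by the flasque resolution
   0 -> O_X -> F -> F / O_X -> 0: global sections of the last sheaf are families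
   (r_x) in F, integral at almost all x, modulo families of integral ones. *)
Definition genus : nat :=
  xget 0%N [set g | is_dim (cst X) (V := place -> F^o)
    [set r | almost_all (fun x : place => vge x 0 (r x))]
    [set r | exists f : F, forall x : place, vge x 0 (r x - f)] g].

Definition m_X : int := Num.max (2 * genus%:Z - 2) 0.

(** A vector bundle of rank n is given by its stalks, inside its generic fibre
    F^n (row vectors).  Morphisms are the linear maps of generic fibres that
    respect the stalks. *)

Definition lattice n (x : place) (b : 'M[F]_n) : set 'rV[F]_n :=
  [set c *m b | c in [set c : 'rV[F]_n | mxint x c]].

Record bundle (n : nat) := Bundle {
  stalk : place -> set 'rV[F]_n;
  loc_free : forall x, exists (U : set place) (b : 'M[F]_n),
    [/\ U x, almost_all U, b \in unitmx
      & forall y, U y -> stalk y = lattice y b] }.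

(* Order at x of the determinant of a local frame. *)
Definition ord_det n (M : bundle n) (x : place) : int :=
  xget 0 [set m | exists b : 'M[F]_n,
    [/\ b \in unitmx, stalk M x = lattice x b & m = x (\det b)]].

(* Degree of the determinant line bundle; O(D) has stalks t_x^(-D_x) O_x. *)
Definition deg n (M : bundle n) : int :=
  - \sum_(x \in [set: place]) (degp x)%:Z * ord_det M x.

Definition iso n (M M' : bundle n) := exists2 phi : 'M[F]_n, phi \in unitmx &
  forall x, stalk M' x = [set m *m phi | m in stalk M x].

(* Sums of products are products, the stalks of L being free of rank 1. *)
Definition tensor_stalk n (L : bundle 1) (M : bundle n) x : set 'rV[F]_n :=
  [set w | exists l m, [/\ stalk L x l, stalk M x m & w = l 0 0 *: m]].

Lemma tensor_loc_free n (L : bundle 1) (M : bundle n) x :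
  exists (U : set place) (b : 'M[F]_n),
    [/\ U x, almost_all U, b \in unitmx
      & forall y, U y -> tensor_stalk L M y = lattice y b].
Proof.
have [U [a [Ux Uf ua Ua]]] := loc_free L x.
have [V [b [Vx Vf ub Vb]]] := loc_free M x.
have vge0M y (f g : F) : vge (ord y) 0 f -> vge (ord y) 0 g ->
    vge (ord y) 0 (f * g).
  rewrite /vge mulf_eq0; case: (eqVneq f 0) => //= f0.
  case: (eqVneq g 0) => //= g0; have [_ vM _ _] := ord_dval y.
  by rewrite vM //; exact: addr_ge0.
have vge01 y : vge (ord y) 0 1.
  have [_ vM _ _] := ord_dval y; rewrite /vge oner_eq0 /=.
  have := vM 1 1 (oner_neq0 _) (oner_neq0 _).
  by rewrite mulr1 => /esym/eqP; rewrite -subr_eq0 addrK => /eqP ->.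
have a0 : a 0 0 != 0 by move: ua; rewrite unitmxE det_mx11 unitfE.
have mul11 (c d : 'M[F]_1) : (c *m d) 0 0 = c 0 0 * d 0 0.
  by rewrite mxE big_ord1.
exists (U `&` V), (a 0 0 *: b); split => //.
- have -> : almost_all (U `&` V) = finite_set (~` U `|` ~` V).
    by rewrite -setCI.
  by rewrite finite_setU; split.
- by rewrite unitmxZ // unitfE.
- move=> y [Uy Vy]; apply/seteqP; split => w /=.
    move=> [l [m]]; rewrite (Ua y Uy) (Vb y Vy) => -[[c cy <-] [d dy <-] ->].
    exists (c 0 0 *: d).
      by move=> i j; rewrite mxE; apply: vge0M; [exact: cy | exact: dy].
    by rewrite mul11 -scalemxAl -scalemxAr scalerA mulrC.
  move=> [c cy <-]; exists (1%:M *m a), (c *m b).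
  rewrite (Ua y Uy) (Vb y Vy); split.
  - exists 1%:M => // i j; rewrite mxE !ord1 /=; exact: vge01.
  - by exists c.
  - by rewrite mul1mx -scalemxAr.
Qed.

Definition tensor n (L : bundle 1) (M : bundle n) : bundle n :=
  Bundle (tensor_loc_free L M).

(* The class of M in PBun_2 X: its equivalence class for isomorphism up to
   tensoring with a line bundle. *)
Definition pclass (M : bundle 2) : set (bundle 2) :=
  [set M' | exists L : bundle 1, iso (tensor L M) M'].

(* An injective morphism phi : L -> M whose cokernel is locally free, i.e. has
   free stalks, necessarily of rank 1. *)
Definition line_subbundle (L : bundle 1) (M : bundle 2) (phi : 'M[F]_(1, 2)) :=
  [/\ forall x s, stalk L x s -> stalk M x (s *m phi),
      injective (fun s : 'rV[F]_1 => s *m phi)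
    & forall x, exists2 e, stalk M x e &
        forall m, stalk M x m -> exists! c : F,
          vge x 0 c /\ [set s *m phi | s in stalk L x] (m - c *: e)].

Definition delta (R : realType) (M : bundle 2) : \bar R :=
  ereal_sup [set ((2 * deg L - deg M)%:~R : R)%:E |
              L in [set L | exists phi, line_subbundle L M phi]].

(* Completion of F at x, characterized up to unique isomorphism. *)
Record completion (x : place) := Completion {
  cfield :> fieldType;
  cval : cfield -> int;
  cemb : {rmorphism F -> cfield};
  cval_dval : is_dval cval;
  cval_emb : forall f, cval (cemb f) = x f;
  cval_dense : forall (a : cfield) (n : int), exists f, vge cval n (a - cemb f);
  cval_complete : forall u : nat -> cfield,
    (forall n : int, exists N, forall i j,
       (N <= i)%N -> (N <= j)%N -> vge cval n (u i - u j)) ->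
    exists l, forall n : int, exists N, forall i,
      (N <= i)%N -> vge cval n (u i - l) }.

Section Adeles.
Context (Fh : forall x : place, completion x).
Local Notation v x := (@cval x (Fh x)).

Lemma vgeM x m n (a b : Fh x) :
  vge (v x) m a -> vge (v x) n b -> vge (v x) (m + n) (a * b).
Proof.
rewrite /vge mulf_eq0; case: (eqVneq a 0) => //= a0.
case: (eqVneq b 0) => //= b0; have [_ vM _ _] := cval_dval (Fh x).
by rewrite vM //; exact: lerD.
Qed.

Lemma vgeD x n (a b : Fh x) :
  vge (v x) n a -> vge (v x) n b -> vge (v x) n (a + b).
Proof.
rewrite /vge; case: (eqVneq a 0) => [->|a0] /=; first by rewrite add0r.
case: (eqVneq b 0) => [->|b0] /=; first by rewrite addr0 (negPf a0).
case: (eqVneq (a + b) 0) => //= ab0 na nb.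
have [_ _ vD _] := cval_dval (Fh x).
by apply: le_trans (vD _ _ a0 b0 ab0); rewrite le_min na nb.
Qed.

Lemma vge0 x n : vge (v x) n 0.
Proof. by rewrite /vge eqxx. Qed.

Lemma cval1 x : v x 1 = 0.
Proof.
have [_ vM _ _] := cval_dval (Fh x).
have := vM 1 1 (oner_neq0 _) (oner_neq0 _).
by rewrite mulr1 => /esym/eqP; rewrite -subr_eq0 addrK => /eqP.
Qed.

Lemma almost_allI (P Q : place -> Prop) :
  almost_all P -> almost_all Q -> almost_all (fun x => P x /\ Q x).
Proof.
move=> fP fQ.
have -> : almost_all (fun x => P x /\ Q x) =
    finite_set (~` [set x | P x] `|` ~` [set x | Q x]) by rewrite -setCI.
by rewrite finite_setU; split.
Qed.

Lemma almost_allW (P Q : place -> Prop) :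
  (forall x, P x -> Q x) -> almost_all P -> almost_all Q.
Proof. by move=> PQ; apply: sub_finite_set => x /= nQ /PQ. Qed.

Lemma almost_allT (P : place -> Prop) : (forall x, P x) -> almost_all P.
Proof.
move=> h; apply: (@sub_finite_set _ _ set0); last exact: finite_set0.
by move=> x /=; apply.
Qed.

(* The adele ring A, as the restricted product of the F_x. *)
Record adele := Adele {
  aval :> forall x, Fh x;
  aval_int : almost_all (fun x => vge (v x) 0 (aval x)) }.

HB.instance Definition _ := gen_eqMixin adele.
HB.instance Definition _ := gen_choiceMixin adele.

Lemma adele0_int : almost_all (fun x => vge (v x) 0 (0 : Fh x)).
Proof. by apply: almost_allT => x; exact: vge0. Qed.

HB.instance Definition _ := isPointed.Build adele (Adele adele0_int).

Lemma adeleD_int (a b : adele) : almost_all (fun x => vge (v x) 0 (a x + b x)).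
Proof.
by apply: almost_allW (almost_allI (aval_int a) (aval_int b)) => x [? ?];
   exact: vgeD.
Qed.

Definition adeleD (a b : adele) := Adele (adeleD_int a b).

(* GL_2(A), as the restricted product of the GL_2(F_x) with respect to the
   GL_2(O_x). *)
Record GL2A := GL2 {
  gval :> forall x, 'M[Fh x]_2;
  gval_unit : forall x, gval x \in unitmx;
  gval_int : almost_all (fun x => GLint (v x) (gval x)) }.

HB.instance Definition _ := gen_eqMixin GL2A.
HB.instance Definition _ := gen_choiceMixin GL2A.

Lemma GLint1 x : GLint (v x) (1%:M : 'M[Fh x]_2).
Proof.
split; rewrite ?unitmx1 ?det1 ?cval1 // => i j; rewrite mxE.
by case: (i == j); rewrite /vge ?eqxx // cval1 lexx orbT.
Qed.

Definition GL2A1 := @GL2 (fun x => 1%:M) (fun x => unitmx1 _ _)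
  (almost_allT GLint1).

HB.instance Definition _ := isPointed.Build GL2A GL2A1.

Lemma GLintM x (g h : 'M[Fh x]_2) :
  GLint (v x) g -> GLint (v x) h -> GLint (v x) (g *m h).
Proof.
move=> [ug ig dg] [uh ih dh]; split.
- by rewrite unitmx_mul ug.
- move=> i j; rewrite mxE; apply: (big_ind (fun a => vge (v x) 0 a)).
  + exact: vge0.
  + by move=> *; exact: vgeD.
  + by move=> l _; rewrite -[0]addr0; apply: vgeM; [exact: ig | exact: ih].
- have [_ vM _ _] := cval_dval (Fh x).
  by rewrite det_mulmx vM ?dg ?dh ?addr0 // -unitfE -unitmxE.
Qed.

Lemma GL2A_mul_unit (g h : GL2A) x : g x *m h x \in unitmx.
Proof. by rewrite unitmx_mul !gval_unit. Qed.

Lemma GL2A_mul_int (g h : GL2A) : almost_all (fun x => GLint (v x) (g x *m h x)).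
Proof.
by apply: almost_allW (almost_allI (gval_int g) (gval_int h)) => x [? ?];
   exact: GLintM.
Qed.

Definition GL2A_mul (g h : GL2A) := GL2 (GL2A_mul_unit g h) (GL2A_mul_int g h).

(** A basic neighbourhood of an adele a is a + prod_x t_x^(n_x) O_x
    with n_x = 0 for almost all x; GL_2(A) carries the topology induced by
    g |-> (g, g^-1) from M_2(A) x M_2(A). *)

Definition near_adele (n : place -> int) (a b : adele) :=
  forall x, vge (v x) (n x) (b x - a x).

Definition near_GL2A (n : place -> int) (g h : GL2A) :=
  forall x i j, vge (v x) (n x) ((h x - g x) i j) /\
                vge (v x) (n x) ((invmx (h x) - invmx (g x)) i j).

Definition open_for (T : Type) (nr : (place -> int) -> T -> T -> Prop)
    (U : set T) :=
  forall a, U a -> exists2 n : place -> int,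
    almost_all (fun x => n x = 0) & forall b, nr n a b -> U b.

Lemma vge_le x (m n : int) (a : Fh x) : m <= n -> vge (v x) n a -> vge (v x) m a.
Proof.
by rewrite /vge; case: (a == 0) => //= mn; exact: le_trans.
Qed.

Section OpenFor.
Context (T : Type) (nr : (place -> int) -> T -> T -> Prop).
Hypothesis nr_le : forall m n : place -> int, (forall x, m x <= n x) ->
  forall a b, nr n a b -> nr m a b.

Lemma open_forT : open_for nr setT.
Proof. by move=> a _; exists (fun=> 0) => //; exact: almost_allT. Qed.

Lemma open_forI : setI_closed (open_for nr).
Proof.
move=> U V oU oV a [Ua Va]; have [m m0 mU] := oU a Ua.
have [n n0 nV] := oV a Va; exists (fun x => Num.max (m x) (n x)).
  by apply: almost_allW (almost_allI m0 n0) => x [-> ->]; exact: maxxx.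
move=> b ab; split.
  by apply/mU/(nr_le _ ab) => x; rewrite le_max lexx.
by apply/nV/(nr_le _ ab) => x; rewrite le_max lexx orbT.
Qed.

Lemma open_forU (I : Type) (f : I -> set T) :
  (forall i, open_for nr (f i)) -> open_for nr (\bigcup_i f i).
Proof.
move=> of_ a [i _ fia]; have [n n0 nf] := of_ i a fia.
by exists n => // b /nf fib; exists i.
Qed.
End OpenFor.

Lemma near_adele_le (m n : place -> int) : (forall x, m x <= n x) ->
  forall a b, near_adele n a b -> near_adele m a b.
Proof. by move=> mn a b ab x; exact: vge_le (mn x) (ab x). Qed.

Lemma near_GL2A_le (m n : place -> int) : (forall x, m x <= n x) ->
  forall a b, near_GL2A n a b -> near_GL2A m a b.
Proof.
move=> mn a b ab x i j; have [h1 h2] := ab x i j.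
by split; [exact: vge_le (mn x) h1 | exact: vge_le (mn x) h2].
Qed.

HB.instance Definition _ := isOpenTopological.Build adele
  (open_forT near_adele) (open_forI near_adele_le) (@open_forU _ near_adele).

HB.instance Definition _ := isOpenTopological.Build GL2A
  (open_forT near_GL2A) (open_forI near_GL2A_le) (@open_forU _ near_GL2A).

Definition idele (z : forall x, Fh x) :=
  (forall x, z x != 0) /\ almost_all (fun x => v x (z x) = 0).

Definition centre_rel (g h : GL2A) : bool :=
  `[< exists2 z, idele z & forall x, h x = z x *: g x >].

Lemma centre_rel_refl : reflexive centre_rel.
Proof.
move=> g; apply/asboolP; exists (fun x => 1); last by move=> x; rewrite scale1r.
by split=> [x|]; [exact: oner_neq0 | apply: almost_allT => x; exact: cval1].
Qed.

Lemma idele_inv z : idele z -> idele (fun x => (z x)^-1).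
Proof.
move=> [z0 zu]; have zV0 x : (z x)^-1 != 0 by apply: invr_neq0; exact: z0.
split=> //; apply: almost_allW zu => x zx.
have [_ vM _ _] := cval_dval (Fh x).
by have := vM _ _ (z0 x) (zV0 x); rewrite divff // cval1 zx add0r => <-.
Qed.

Lemma idele_mul y z : idele y -> idele z -> idele (fun x => y x * z x).
Proof.
move=> [y0 yu] [z0 zu]; split=> [x|]; first by apply: mulf_neq0; [exact: y0 | exact: z0].
apply: almost_allW (almost_allI yu zu) => x [yx zx].
have [_ vM _ _] := cval_dval (Fh x).
by rewrite (vM _ _ (y0 x) (z0 x)) yx zx addr0.
Qed.

Lemma centre_rel_sym : symmetric centre_rel.
Proof.
suff imp g h : centre_rel g h -> centre_rel h g by move=> g h; apply/idP/idP; exact: imp.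
move=> /asboolP[z iz hg]; apply/asboolP; exists (fun x => (z x)^-1).
  exact: idele_inv.
by move=> x; rewrite hg scalerA mulVf ?scale1r //; exact: iz.1 x.
Qed.

Lemma centre_rel_trans : transitive centre_rel.
Proof.
move=> h g l /asboolP[y iy hg] /asboolP[z iz lh]; apply/asboolP.
exists (fun x => z x * y x); first exact: idele_mul.
by move=> x; rewrite lh hg scalerA.
Qed.

Canonical centre_equiv :=
  EquivRel centre_rel centre_rel_refl centre_rel_sym centre_rel_trans.

(* PGL_2(A) = GL_2(A) / A^*: by Hilbert 90 for the F_x and the O_x, every point
   of PGL_2 over A lifts to GL_2(A). *)
Definition GA := quotient_topology {eq_quot centre_equiv}%qT.

Local Open Scope quotient_scope.

HB.instance Definition _ := Topological.on GA.
HB.instance Definition _ := Quotient.on GA.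
HB.instance Definition _ := isPointed.Build GA (\pi_GA GL2A1).

Definition mulG (a b : GA) : GA := \pi_GA (GL2A_mul (repr a) (repr b)).

(* G(F), embedded diagonally; the matrix gam is invertible because g is. *)
Definition GF : set GA := [set \pi_GA g | g in [set g : GL2A |
  exists gam : 'M[F]_2, forall x, g x = map_mx (cemb (Fh x)) gam]].

(* K = G(O_A). *)
Definition GK : set GA :=
  [set \pi_GA g | g in [set g : GL2A | forall x, GLint (v x) (g x)]].

(* N is parametrized by a |-> ((1, a), (0, 1)), so that N(F)\N(A) is A / F. *)

Definition unip x (a : Fh x) : 'M[Fh x]_2 := 1%:M + a *: delta_mx 0 1.

Lemma unip_det x (a : Fh x) : \det (unip a) = 1.
Proof.
by rewrite (expand_det_col _ 0) big_ord_recl big_ord1 /cofactor !det_mx11 !mxE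
   /= !(mulr0, mulr1, addr0, mul0r, add0r, expr0).
Qed.

Lemma unip_unit (a : adele) x : unip (a x) \in unitmx.
Proof. by rewrite unitmxE unip_det unitr1. Qed.

Lemma unip_int (a : adele) : almost_all (fun x => GLint (v x) (unip (a x))).
Proof.
apply: almost_allW (aval_int a) => x ax; split.
- exact: unip_unit.
- move=> i j; rewrite !mxE; apply: vgeD.
    by case: (i == j); rewrite /vge ?eqxx // cval1 lexx orbT.
  by case: (_ && _); rewrite ?mulr1 ?mulr0 ?vge0.
- by rewrite unip_det cval1.
Qed.

Definition nA (a : adele) : GA := \pi_GA (GL2 (unip_unit a) (unip_int a)).

Definition NF_rel (a b : adele) : bool :=
  `[< exists f : F, forall x, b x = cemb (Fh x) f + a x >].

Lemma NF_rel_refl : reflexive NF_rel.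
Proof. by move=> a; apply/asboolP; exists 0 => x; rewrite rmorph0 add0r. Qed.

Lemma NF_rel_sym : symmetric NF_rel.
Proof.
suff imp a b : NF_rel a b -> NF_rel b a by move=> a b; apply/idP/idP; exact: imp.
move=> /asboolP[f ab]; apply/asboolP; exists (- f) => x.
by rewrite ab rmorphN addKr.
Qed.

Lemma NF_rel_trans : transitive NF_rel.
Proof.
move=> b a c /asboolP[f ab] /asboolP[g bc]; apply/asboolP; exists (g + f) => x.
by rewrite bc ab rmorphD addrA.
Qed.

Canonical NF_equiv := EquivRel NF_rel NF_rel_refl NF_rel_sym NF_rel_trans.

Definition NFA := quotient_topology {eq_quot NF_equiv}%qT.

HB.instance Definition _ := Topological.on NFA.
HB.instance Definition _ := Quotient.on NFA.
HB.instance Definition _ := isPointed.Build NFA (\pi_NFA point).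

Definition addN (a b : NFA) : NFA := \pi_NFA (adeleD (repr a) (repr b)).

End Adeles.
End Curve.

Arguments GF {k X} Fh _.
Arguments GK {k X} Fh _.

Notation borel T := (g_sigma_algebraType (@open T)).

(* Left Haar measure on the group (T, mul).  The groups considered here are
   second countable and locally compact, so that regularity is automatic. *)
Definition is_haar (R : realType) (T : ptopologicalType) (mul : T -> T -> T)
    (mu : {measure set (borel T) -> \bar R}) :=
  [/\ forall (g : T) (B : set (borel T)), measurable B ->
        mu [set mul g b | b in B] = mu B,
      forall C : set T, compact C -> measurable (C : set (borel T)) ->
        (mu C < +oo)%E
    & forall U : set T, open U -> U !=set0 -> (0 < mu U)%E].

Definition Cintegral (R : realType) d (T : measurableType d)
    (mu : {measure set T -> \bar R}) (f : T -> R[i]) : R[i] :=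
  Complex (Rintegral mu setT (fun t => complex.Re (f t)))
          (Rintegral mu setT (fun t => complex.Im (f t))).

Section Automorphic.
Context (R : realType) (k : finFieldType) (X : curve k).
Context (Fh : forall x : place X, completion x).
Local Notation GA := (GA Fh).
Local Notation NFA := (NFA Fh).
Context (mu : {measure set (borel GA) -> \bar R}).
Context (nu : {measure set (borel NFA) -> \bar R}).

Definition hecke (Phi : GA -> R[i]) :=
  [/\ forall g u, GK Fh u -> Phi (mulG u g) = Phi g /\ Phi (mulG g u) = Phi g,
      forall g : GA, \forall h \near g, Phi h = Phi g
    & compact (closure [set g | Phi g != 0])].

Definition hecke_act (Phi f : GA -> R[i]) (g : GA) : R[i] :=
  Cintegral mu (fun h => Phi h * f (mulG g h)).

(* Functions on G(F)\G(A)/K. *)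
Definition automorphic (f : GA -> R[i]) := forall gam g u,
  GF Fh gam -> GK Fh u -> f (mulG (mulG gam g) u) = f g.

Definition V0 : set (GA -> R[i]^o) := [set f | automorphic f /\
  forall Phi, hecke Phi ->
    Cintegral nu (fun n : NFA => hecke_act Phi f (nA (repr n))) = 0].

End Automorphic.

(* Main.v *)
(** Write a class of PBun_2 as a double coset of some [g] in GL_2(A), and measure it by the
    instability 2 deg L - deg M of its line subbundles. For an effective divisor E let Phi_E be
    the indicator function of the image in PGL_2(A) of the integral matrices whose determinant
    has divisor E, and let [t] be the class of O(E) + O. Suppose deg E > m_X. By Riemann-Roch
    every [n h], with [n] in N(A) and [h] in the support of Phi_E, lies either in the class of
    [t] or in a class with delta < deg E. Hence, if [f] in V_0 vanishes on all classes with
    delta < deg E, the integral of the constant term of Phi_E(f) is f(t) times a strictly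
    positive number, so f(t) = 0. As every class with delta > m_X is such a [t], an induction
    on delta shows that [f] is determined by its values on the finitely many classes with
    delta <= m_X. Riemann-Roch is proved by Weil's method of repartitions, with cardinalities
    of finite quotients in place of dimensions. *)

Require Import Defs.
From mathcomp Require Import all_boot all_order all_algebra.
From mathcomp Require Import complex zify ring.
From mathcomp Require Import all_classical all_reals all_analysis measurable_realfun.

Set Implicit Arguments.
Unset Strict Implicit.
Unset Printing Implicit Defensive.

Import Order.TTheory GRing.Theory Num.Theory numFieldNormedType.Exports.

Local Open Scope classical_set_scope.
Local Open Scope card_scope.
Local Open Scope ring_scope.

(** * Indices of subgroups and dimensions over the constant field *)

Section Index.
Context (V : zmodType).
Implicit Types (U W Z F : set V).

(** The curve is given only by its function field, so the places, their finiteness and Riemann-Roch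
    all rest on one counting principle: for z != 0, a subgroup A of F stable under z has A / zA of
    size bounded in terms of z alone, because F has finite rank over k(t). The maximum in m_X has
    two sources: deg E > 2 g - 2 kills the H^1 containing the extension classes, and deg E > 0, an
    extra condition only in genus 0, lets an effective divisor be found in the divisor class. Strict
    positivity comes from a comparison: the constant term of Phi_E(f) is f(t) times that of the
    indicator function of the class of t, and the latter is at least the measure of one fixed coset
    hK at every point of N(F)\N(A). All integrands are locally constant with compact support, so
    convergence reduces to the compactness of the support of Phi_E and of N(F)\N(A). The dimension
    is bounded through linear independence: a family in V_0 longer than the list of classes with
    small delta has a combination vanishing on the whole list. *)

Definition subgroup U := U 0 /\ forall a b, U a -> U b -> U (a - b).

Lemma subgroup0 U : subgroup U -> U 0. Proof. by case. Qed.

Lemma subgroupB U a b : subgroup U -> U a -> U b -> U (a - b).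
Proof. by move=> [_ h]; exact: h. Qed.

Lemma subgroupN U a : subgroup U -> U a -> U (- a).
Proof. by move=> sU Ua; rewrite -sub0r; apply: subgroupB => //; case: sU. Qed.

Lemma subgroupD U a b : subgroup U -> U a -> U b -> U (a + b).
Proof. by move=> sU Ua Ub; rewrite -[b]opprK; apply: subgroupB => //; exact: subgroupN. Qed.

Lemma subgroupC U a b : subgroup U -> U (a - b) -> U (b - a).
Proof. by move=> sU /(subgroupN sU); rewrite opprB. Qed.

Lemma subgroupT U a b c : subgroup U -> U (a - b) -> U (b - c) -> U (a - c).
Proof. by move=> sU h1 h2; have := subgroupD sU h1 h2; rewrite addrA subrK. Qed.

Definition incong (I : Type) (e : I -> V) U := forall i j, U (e i - e j) -> i = j.

(** A relation rather than a function: it asserts at once that the index is finite and what it is.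
    Over the finite field k such indices stand in for dimensions. *)
Definition has_index W U N := exists e : 'I_N -> V,
  [/\ forall i, W (e i), incong e U & forall w, W w -> exists i, U (w - e i)].

Lemma idx_card (I : finType) (e : I -> V) W U : (forall i, W (e i)) ->
  incong e U -> (forall w, W w -> exists i, U (w - e i)) -> has_index W U #|I|.
Proof.
move=> We ie ce; exists (fun i => e (enum_val i)); split=> [i|i j /ie /enum_val_inj //|w /ce[i Ui]].
  exact: We.
by exists (enum_rank i); rewrite enum_rankK.
Qed.

Lemma idx_ge (I : finType) (e : I -> V) W U N : subgroup U -> has_index W U N ->
  (forall i, W (e i)) -> incong e U -> (#|I| <= N)%N.
Proof.
move=> sU [f [Wf _ cf]] We ie.
have /choice[g gP] : forall i, exists j, U (e i - f j) by move=> i; exact: cf.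
have ginj : injective g.
  move=> i j gij; apply: ie; apply: subgroupT (gP i) _ => //.
  by rewrite gij; exact: subgroupC.
by have := leq_card g ginj; rewrite card_ord.
Qed.

Lemma idx_uniq W U N M : subgroup U -> has_index W U N -> has_index W U M -> N = M.
Proof.
move=> sU iN iM; apply/eqP; rewrite eqn_leq.
case: (iN) => f [Wf fi _]; case: (iM) => g [Wg gi _].
have := idx_ge sU iM Wf fi; have := idx_ge sU iN Wg gi.
by rewrite !card_ord => -> ->.
Qed.

(** A maximal incongruent family is a system of representatives: an element congruent to none of its
    members could be appended. *)
Lemma idx_bounded W U B : subgroup U ->
  (forall N (e : 'I_N -> V), (forall i, W (e i)) -> incong e U -> (N <= B)%N) ->
  exists2 N, (N <= B)%N & has_index W U N.
Proof.
move=> sU hB.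
pose P N := `[< exists e : 'I_N -> V, (forall i, W (e i)) /\ incong e U >].
have exP : exists N, P N.
  by exists 0%N; apply/asboolP; exists (fun=> 0); split; case.
have ubP N : P N -> (N <= B)%N by move=> /asboolP[e [We ei]]; exact: hB We ei.
case: (ex_maxnP exP ubP) => N PN maxN; exists N; first exact: ubP.
move/asboolP: PN => [e [We ie]]; exists e; split => // w Ww.
apply: contrapT => nw.
pose e' (i : 'I_N.+1) := if unlift ord_max i is Some j then e j else w.
suff : P N.+1 by move/maxN; rewrite ltnn.
apply/asboolP; exists e'; split.
  by move=> i; rewrite /e'; case: unliftP.
move=> i j; rewrite /e'; case: unliftP => [i' ->|->]; case: unliftP => [j' ->|->] //.
- by move/ie ->.
- by move=> h; case: nw; exists i'; exact: subgroupC.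
- by move=> h; case: nw; exists j'.
Qed.

Lemma idx_sub W U Z M : subgroup U -> has_index Z U M -> W `<=` Z -> exists2 N, (N <= M)%N & has_index W U N.
Proof.
move=> sU iM WZ; apply: idx_bounded => // N e We ei.
by rewrite -[N]card_ord; apply: (idx_ge sU iM _ ei) => i; apply: WZ.
Qed.

Lemma idx_quo W U Z M : subgroup U -> subgroup W -> has_index Z U M -> U `<=` W ->
  exists2 N, (N <= M)%N & has_index Z W N.
Proof.
move=> sU sW iM UW; apply: idx_bounded => // N e We ei.
by rewrite -[N]card_ord; apply: (idx_ge sU iM We) => i j /UW /ei.
Qed.

Lemma idx_tower Z W U N M : subgroup Z -> subgroup W -> U `<=` W -> W `<=` Z ->
  has_index Z W N -> has_index W U M -> has_index Z U (N * M)%N.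
Proof.
move=> sZ sW UW WZ [e [Ze ie ce]] [f [Wf jf cf]].
rewrite -[N]card_ord -[M]card_ord -card_prod.
apply: (idx_card (e := fun ij => e ij.1 + f ij.2)).
- by move=> [i j] /=; apply: subgroupD => //; exact: WZ.
- move=> [i j] [i' j'] /= h.
  have ii' : i = i'.
    apply: ie; have := UW _ h => /(subgroupB sW)/(_ (subgroupB sW (Wf j) (Wf j'))).
    by rewrite opprD addrACA addrK.
  by move: h; rewrite ii' opprD addrACA subrr add0r => /jf ->.
- move=> z /ce[i Wi]; have [j Uj] := cf _ Wi.
  by exists (i, j) => /=; rewrite opprD addrA.
Qed.

Definition addset W U : set V := [set z | exists w u, [/\ W w, U u & z = w + u]].

Lemma addset_subgroup W U : subgroup W -> subgroup U -> subgroup (addset W U).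
Proof.
move=> sW sU; split; first by exists 0, 0; rewrite addr0; split=> //; exact: subgroup0.
move=> _ _ [w [u [Ww Uu ->]]] [w' [u' [Ww' Uu' ->]]].
by exists (w - w'), (u - u'); rewrite opprD addrACA; split=> //; exact: subgroupB.
Qed.

Lemma subsetI_subgroup W U : subgroup W -> subgroup U -> subgroup (W `&` U).
Proof. by move=> [W0 WB] [U0 UB]; split=> // a b [? ?] [? ?]; split; auto. Qed.

Lemma addset_subl W U : subgroup U -> W `<=` addset W U.
Proof. by move=> sU w Ww; exists w, 0; rewrite addr0; split=> //; exact: subgroup0. Qed.

Lemma addset_subr W U : subgroup W -> U `<=` addset W U.
Proof. by move=> sW u Uu; exists 0, u; rewrite add0r; split=> //; exact: subgroup0. Qed.

Lemma addset_mono W W' U U' : W `<=` W' -> U `<=` U' -> addset W U `<=` addset W' U'.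
Proof. by move=> WW UU _ [w [u [Ww Uu ->]]]; exists w, u; split; auto. Qed.

(** The exact sequence 0 -> (F cap A')/(F cap A) -> A'/A -> (F + A')/(F + A) -> 0, read off from the
    intermediate group (F cap A') + A. With F the global functions and A, A' boxes of adeles it ties
    the change of H^0 to that of H^1. *)
Lemma idx_modular A A' F N : subgroup A -> subgroup A' -> subgroup F -> A `<=` A' ->
  has_index A' A N -> exists a b, [/\ has_index (addset F A') (addset F A) a,
    has_index (F `&` A') (F `&` A) b & N = (a * b)%N].
Proof.
move=> sA sA' sF AA' iN; pose B := addset (F `&` A') A.
have sFA' := subsetI_subgroup sF sA'.
have sB : subgroup B by exact: addset_subgroup.
have AB : A `<=` B by exact: addset_subr.
have BA' : B `<=` A'.
  by move=> _ [w [u [[_ Ww] /AA' Uu ->]]]; exact: subgroupD.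
have [b _ ib] := idx_sub sA iN BA'.
have [a _ ia] := idx_quo sA sB iN AB.
exists a, b; split; last first.
- exact: (idx_uniq sA iN (idx_tower sA' sB AB BA' ia ib)).
- case: ib => e [Be ie ce].
  have /choice[f fP] : forall i, exists f, (F `&` A') f /\ A (e i - f).
    move=> i; have [w [u [FAw Au eiE]]] := Be i; exists w; split=> //.
    by rewrite eiE addrAC subrr add0r.
  exists f; split.
  + by move=> i; have [] := fP i.
  + move=> i j [_ Aij]; apply: ie.
    apply: (subgroupT sA (fP i).2); apply: (subgroupT sA Aij).
    by apply: subgroupC => //; exact: (fP j).2.
  + move=> w FAw; have [i Ai] := ce w (addset_subl sA FAw).
    exists i; split; first exact: subgroupB FAw.1 (fP i).1.1.
    by apply: subgroupT Ai (fP i).2.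
- case: ia => e [Ae ie ce]; exists e; split.
  + by move=> i; exact: addset_subr.
  + move=> i j [f [u [Ff Au eq]]]; apply: ie; exists f, u; split=> //.
    split=> //; have -> : f = (e i - e j) - u by rewrite eq addrK.
    by apply: subgroupB => //; [exact: subgroupB | exact: AA'].
  + move=> _ [f [u [Ff Au ->]]]; have [i [f' [v [[Ff' _] Av eq]]]] := ce _ Au.
    exists i; exists (f + f'), v; split=> //; first exact: subgroupD.
    by rewrite -addrA eq addrA.
Qed.

Lemma idx1 W U : has_index W U 1 -> subgroup U -> subgroup W -> U `<=` W -> W = U.
Proof.
move=> [e [We ie ce]] sU sW UW; apply/seteqP; split => // w Ww.
have [i Ui] := ce w Ww; have [j Uj] := ce 0 (subgroup0 sW).
move: Ui Uj; rewrite !ord1 sub0r => h1 /(subgroupN sU); rewrite opprK => h2.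
by have := subgroupD sU h1 h2; rewrite subrK.
Qed.

End Index.

Lemma idx_inj (V V' : zmodType) (h : V -> V') (h' : V' -> V) (W U : set V) (W' U' : set V') N :
  {morph h : a b / a - b} -> {morph h' : a b / a - b} ->
  (forall a, W a -> W' (h a)) -> (forall a, U a -> U' (h a)) ->
  (forall a, W' a -> W (h' a)) -> (forall a, U' a -> U (h' a)) ->
  cancel h h' -> cancel h' h -> has_index W U N -> has_index W' U' N.
Proof.
move=> hB h'B WW UU WW' UU' hK h'K [e [We ie ce]]; exists (h \o e); split.
- by move=> i; exact: WW.
- by move=> i j /= /UU'; rewrite h'B !hK => /ie.
- move=> w /WW' /ce[i Ui]; exists i; rewrite /= -[w]h'K -hB; exact: UU.
Qed.

Section Dim.
Context (K : fieldType) (L : nzRingType) (sc : {rmorphism K -> L}) (V : lmodType L).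
Implicit Types (U W : set V).

Definition ksubspace U := subgroup U /\ forall c a, U a -> U (sc c *: a).

Lemma subspace_sum U (I : Type) (r : seq I) (P : pred I) (f : I -> V) : ksubspace U -> (forall i, P i -> U (f i)) ->
  U (\sum_(i <- r | P i) f i).
Proof.
move=> [sU _] Uf; apply: (big_ind U) => //; first exact: subgroup0.
by move=> *; exact: subgroupD.
Qed.

Definition indep_mod U d (e : 'I_d -> V) :=
  forall c : 'I_d -> K, U (\sum_i sc (c i) *: e i) -> forall i, c i = 0.

(** A maximal family independent modulo U is a basis of the quotient. Besides dimensions over k,
    this yields the dimension of [V0] over the complex numbers from a bound on its independent
    families. *)
Lemma is_dim_bounded W U B : ksubspace U ->
  (forall d (e : 'I_d -> V), (forall i, W (e i)) -> indep_mod U e -> (d <= B)%N) ->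
  exists2 d, (d <= B)%N & is_dim sc W U d.
Proof.
move=> [sU sZ] hB.
pose P N := `[< exists e : 'I_N -> V, (forall i, W (e i)) /\ indep_mod U e >].
have exP : exists N, P N.
  by exists 0%N; apply/asboolP; exists (fun=> 0); split; [case | move=> c _ []].
have ubP N : P N -> (N <= B)%N by move=> /asboolP[e [We ei]]; exact: hB We ei.
case: (ex_maxnP exP ubP) => N PN maxN; exists N; first exact: ubP.
move/asboolP: PN => [e [We ie]]; exists e; split => // w Ww.
have [c Uc] : exists c : 'I_N -> K, U (w - \sum_i sc (c i) *: e i).
  apply: contrapT => nw.
  pose e' (i : 'I_N.+1) := oapp e w (unlift ord0 i).
  suff : P N.+1 by move/maxN; rewrite ltnn.
  apply/asboolP; exists e'; split.
    by move=> i; rewrite /e'; case: (unliftP ord0 i) => [j _|_]; [exact: We | exact: Ww].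
  move=> c; rewrite big_ord_recl /e' unlift_none /=.
  under eq_bigr do rewrite liftK /=.
  move=> h; have c0 : c ord0 = 0.
    apply: contrapT => /eqP c0; case: nw.
    exists (fun i => - (c ord0)^-1 * c (lift ord0 i)).
    have := sZ (c ord0)^-1 _ h; rewrite scalerDr scalerA -rmorphM mulVf //.
    rewrite rmorph1 scale1r; congr (U (_ + _)).
    rewrite scaler_sumr -sumrN; apply: eq_bigr => i _.
    by rewrite scalerA -rmorphM mulNr rmorphN scaleNr opprK.
  move: h; rewrite c0 rmorph0 scale0r add0r => /ie h i.
  by case: (unliftP ord0 i) => [j ->|->].
have sumE (c1 c2 : 'I_N -> K) : \sum_i sc (c1 i) *: e i - \sum_i sc (c2 i) *: e i =
    \sum_i sc (c1 i - c2 i) *: e i.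
  by rewrite -sumrB; apply: eq_bigr => i _; rewrite rmorphB scalerBl.
exists [ffun i => c i]; split.
  by move: Uc; congr (U (_ - _)); apply: eq_bigr => i _; rewrite ffunE.
move=> c' Uc'; apply/ffunP => i; rewrite ffunE; apply/eqP.
rewrite -subr_eq0; apply/eqP.
apply: (ie (fun i => c i - c' i)); rewrite -sumE.
apply: (subgroupT sU (b := w)) => //; exact: subgroupC.
Qed.
End Dim.

Section DimFinite.
Context (K : finFieldType) (L : nzRingType) (sc : {rmorphism K -> L}) (V : lmodType L).
Implicit Types (U W : set V).

Lemma is_dim_idx W U d : ksubspace sc U -> ksubspace sc W -> is_dim sc W U d ->
  has_index W U (#|K| ^ d).
Proof.
move=> sU sW [e [We he]]; rewrite -[d in (_ ^ d)%N]card_ord -card_ffun.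
have Wc (c : {ffun 'I_d -> K}) : W (\sum_i sc (c i) *: e i).
  by apply: (@subspace_sum _ _ sc _ W _ _ _ _ sW) => i _; apply: sW.2.
apply: (idx_card (e := fun c : {ffun 'I_d -> K} => \sum_i sc (c i) *: e i)) => //.
  move=> c c' h; have [c0 [_ hu]] := he _ (Wc c).
  by rewrite -(hu c') // -(hu c) // subrr; exact: subgroup0 sU.1.
by move=> w /he[c [Uc _]]; exists c.
Qed.

(** An independent family of length d has q^d incongruent combinations, q the size of K, and d <
    q^d; so N bounds the length of such families. *)
Lemma idx_is_dim W U N : ksubspace sc U -> ksubspace sc W -> has_index W U N ->
  exists2 d, is_dim sc W U d & N = (#|K| ^ d)%N.
Proof.
move=> sU sW iN.
have [|d _ hd] := @is_dim_bounded _ _ sc _ W U N sU; last first.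
  by exists d => //; exact: (idx_uniq sU.1 iN (is_dim_idx sU sW hd)).
move=> d e We ie; apply: ltnW; apply: (leq_trans (ltn_expl d (card_finNzRing_gt1 K))).
rewrite -[d in (_ ^ d)%N]card_ord -card_ffun.
apply: (idx_ge (e := fun c : {ffun 'I_d -> K} => \sum_i sc (c i) *: e i) sU.1 iN).
  by move=> c; apply: (@subspace_sum _ _ sc _ W _ _ _ _ sW) => i _; apply: sW.2.
move=> c c'; rewrite -sumrB; under eq_bigr do rewrite -scalerBl -rmorphB.
by move/(ie (fun i => c i - c' i)) => h; apply/ffunP => i; apply/eqP; rewrite -subr_eq0 h.
Qed.

End DimFinite.

(** * Valuations and weak approximation *)

Section Valuation.
Context (E : fieldType) (v : E -> int) (dv : is_dval v).
Implicit Types (a b : E) (m n : int).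

Lemma dval0 : v 0 = 0. Proof. by case: dv. Qed.

Lemma dvalM a b : a != 0 -> b != 0 -> v (a * b) = v a + v b.
Proof. by case: dv => _ h _ _; exact: h. Qed.

Lemma dvalD a b : a != 0 -> b != 0 -> a + b != 0 ->
  v a <= v (a + b) \/ v b <= v (a + b).
Proof.
move=> a0 b0 ab0; case: dv => _ _ h _.
by apply/orP; rewrite -ge_min; exact: h.
Qed.

Lemma dval1 : v 1 = 0.
Proof.
have := dvalM (oner_neq0 E) (oner_neq0 E).
by rewrite mulr1 => /esym/eqP; rewrite -subr_eq0 addrK => /eqP.
Qed.

Lemma dvalV a : v a^-1 = - v a.
Proof.
have [->|a0] := eqVneq a 0; first by rewrite invr0 dval0 oppr0.
apply/eqP; rewrite -addr_eq0 -dvalM ?invr_eq0 // mulVf //.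
by rewrite dval1.
Qed.

Lemma dvalN a : v (- a) = v a.
Proof.
have [->|a0] := eqVneq a 0; first by rewrite oppr0.
have N10 : (-1 : E) != 0 by rewrite oppr_eq0 oner_eq0.
rewrite -mulN1r dvalM //; suff -> : v (-1) = 0 by rewrite add0r.
have := dvalM N10 N10; rewrite mulrNN mulr1 dval1; lia.
Qed.

Lemma dvalX a i : a != 0 -> v (a ^+ i) = i%:Z * v a.
Proof.
move=> a0; elim: i => [|i IH]; first by rewrite expr0 dval1 mul0r.
by rewrite exprS dvalM ?expf_neq0 // IH; lia.
Qed.

Lemma dvalXz a m : a != 0 -> v (a ^ m) = m * v a.
Proof.
move=> a0; case: m => i; first by rewrite -exprnP dvalX.
by rewrite NegzE -exprnN dvalV dvalX //; lia.
Qed.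

Lemma dval_div a b : a != 0 -> b != 0 -> v (a / b) = v a - v b.
Proof. by move=> a0 b0; rewrite dvalM ?invr_eq0 // dvalV. Qed.

Lemma vgeE n a : a != 0 -> vge v n a = (n <= v a).
Proof. by rewrite /vge => /negPf ->. Qed.

Lemma vge_0 n : vge v n 0. Proof. by rewrite /vge eqxx. Qed.

Lemma vge_1 : vge v 0 1. Proof. by rewrite vgeE ?oner_eq0 // dval1. Qed.

Lemma vge_trans m n a : m <= n -> vge v n a -> vge v m a.
Proof. by rewrite /vge; case: (a == 0) => //= mn; exact: le_trans. Qed.

Lemma vge_mul m n a b : vge v m a -> vge v n b -> vge v (m + n) (a * b).
Proof.
rewrite /vge mulf_eq0; case: (eqVneq a 0) => //= a0.
case: (eqVneq b 0) => //= b0; rewrite dvalM //; exact: lerD.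
Qed.

Lemma vge_mul0 m a b : vge v 0 a -> vge v m b -> vge v m (a * b).
Proof. by move=> h1 h2; have := vge_mul h1 h2; rewrite add0r. Qed.

Lemma vge_add n a b : vge v n a -> vge v n b -> vge v n (a + b).
Proof.
rewrite /vge; case: (eqVneq a 0) => [->|a0] /=; first by rewrite add0r.
case: (eqVneq b 0) => [->|b0] /=; first by rewrite addr0 (negPf a0).
case: (eqVneq (a + b) 0) => //= ab0 na nb.
by have [] := dvalD a0 b0 ab0; lia.
Qed.

Lemma vge_opp n a : vge v n (- a) = vge v n a.
Proof. by rewrite /vge oppr_eq0 dvalN. Qed.

Lemma vge_sub n a b : vge v n a -> vge v n b -> vge v n (a - b).
Proof. by move=> na nb; apply: vge_add => //; rewrite vge_opp. Qed.

Lemma vge_subC n a b : vge v n (a - b) = vge v n (b - a).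
Proof. by rewrite -vge_opp opprB. Qed.

Lemma vge_split n a b c : vge v n (a - b) -> vge v n (b - c) -> vge v n (a - c).
Proof. by move=> h1 h2; have := vge_add h1 h2; rewrite addrA subrK. Qed.

Lemma vge_sum n (I : Type) (r : seq I) (P : pred I) (f : I -> E) :
  (forall i, P i -> vge v n (f i)) -> vge v n (\sum_(i <- r | P i) f i).
Proof.
move=> h; apply: (big_ind (fun a => vge v n a)) => //; first exact: vge_0.
by move=> *; exact: vge_add.
Qed.

Lemma vge_exp i a : vge v 0 a -> vge v 0 (a ^+ i).
Proof.
move=> a0; elim: i => [|i IH]; first by rewrite expr0 vge_1.
by rewrite exprS -[0]addr0; apply: vge_mul.
Qed.

Lemma vge_mull n a b : a != 0 -> vge v n (a * b) = vge v (n - v a) b.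
Proof.
move=> a0; rewrite /vge mulf_eq0 (negPf a0) /=; case: eqVneq => //= b0.
by rewrite dvalM //; lia.
Qed.

Lemma dval_domin a b : a != 0 -> vge v (v a + 1) b -> a + b != 0 /\ v (a + b) = v a.
Proof.
move=> a0; have [->|b0] := eqVneq b 0; first by rewrite addr0.
rewrite vgeE // => vab.
have ab0 : a + b != 0.
  apply: contraTneq vab => /eqP; rewrite addr_eq0 => /eqP ->.
  by rewrite dvalN; lia.
split=> //; have Nb0 : - b != 0 by rewrite oppr_eq0.
have := dvalD ab0 Nb0; rewrite addrK dvalN => /(_ a0).
by have := dvalD a0 b0 ab0; lia.
Qed.

Lemma vge_dval_eq a b : a != 0 -> vge v (v a + 1) (b - a) -> b != 0 /\ v b = v a.
Proof. by move=> a0 /(dval_domin a0); rewrite addrC subrK. Qed.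

Lemma dval_surj n : exists2 a, a != 0 & v a = n.
Proof.
have [_ _ _ [p p0 vp]] := dv; exists (p ^ n); first exact: expfz_neq0.
by rewrite dvalXz // vp mulr1.
Qed.

Lemma vge_subgroup n : subgroup [set a | vge v n a].
Proof. by split=> [|a b]; [exact: vge_0 | exact: vge_sub]. Qed.
End Valuation.

Section WeakApproximation.
Context (k : finFieldType) (X : curve k).
Local Notation F := (ff X).
Implicit Types (x y : place X) (f : F).

Lemma place_eq x y : (forall f, x f = y f) -> x = y.
Proof.
case: x => v dv cv; case: y => w dw cw /= vw.
have {}vw : v = w by apply/funext.
subst w; congr Place; exact: Prop_irrelevance.
Qed.

(** If the valuation ring of x lay in that of y, units at x would be units at y, so y would be a
    multiple c x. Then c is nonnegative, and c = 1 because y takes the value 1. *)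
Lemma place_neq x y : x != y -> exists2 f, vge x 0 f & ~~ vge y 0 f.
Proof.
move=> xy; apply: contrapT => nf.
have h f : vge x 0 f -> vge y 0 f.
  by move=> xf; apply/negPn/negP => yf; apply: nf; exists f.
case/eqP: xy; apply: place_eq.
have dx := ord_dval x; have dy := ord_dval y.
have unit f : f != 0 -> x f = 0 -> y f = 0.
  move=> f0 xf0; have := h f; have := h f^-1.
  rewrite !vgeE ?invr_eq0 // !dvalV // xf0 oppr0 lexx => /(_ isT) h1 /(_ isT) h2.
  by lia.
have [p p0 xp] := dval_surj dx 1; pose c := y p.
have yE f : f != 0 -> y f = x f * c.
  move=> f0; have u0 : f / p ^ (x f) != 0.
    by rewrite mulf_neq0 ?invr_eq0 ?expfz_neq0.
  have := unit _ u0; rewrite !dval_div ?expfz_neq0 // !dvalXz // xp.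
  by rewrite mulr1 subrr => /(_ erefl) /eqP; rewrite subr_eq0 => /eqP.
have [r r0 yr] := dval_surj dy 1.
have cge0 : 0 <= c by have := h p; rewrite !vgeE // xp; exact.
have c1 : c = 1 by have := yE r r0; rewrite yr; have [] := ltP 0 (x r); nia.
move=> f; have [->|f0] := eqVneq f 0; first by rewrite !dval0.
by rewrite (yE f f0) c1 mulr1.
Qed.

Lemma place_separate x y : x != y -> exists f, [/\ f != 0, 0 < x f & y f < 0].
Proof.
move=> xy; have [f xf yf] := place_neq xy.
have [g yg xg] : exists2 g, vge y 0 g & ~~ vge x 0 g by apply: place_neq; rewrite eq_sym.
have f0 : f != 0 by apply: contraNneq yf => ->; exact: vge_0.
have g0 : g != 0 by apply: contraNneq xg => ->; exact: vge_0.
have dx := ord_dval x; have dy := ord_dval y.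
exists (f / g); rewrite !dval_div //.
move: xf yf yg xg; rewrite !vgeE // => xf yf yg xg; split; [|lia|lia].
by rewrite mulf_neq0 ?invr_eq0.
Qed.

Lemma place_separate_seq x (s : seq (place X)) : x \notin s ->
  exists f, [/\ f != 0, 0 < x f & forall y, y \in s -> y f < 0].
Proof.
elim: s => [_|y s IH].
  by have [p p0 xp] := dval_surj (ord_dval x) 1; exists p; split; rewrite ?xp.
rewrite inE negb_or => /andP[xy xs].
have [u [u0 xu us]] := IH xs; have [w [w0 xw yw]] := place_separate xy.
have [yu|yu] := ltP (y u) 0.
  by exists u; split=> // z; rewrite inE => /orP[/eqP -> //|/us].
(* N exceeds the absolute order of u at every place of s, so [w ^+ N] dominates u wherever w has a
   pole and u dominates at the other places of s; no cancellation can occur. *)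
pose N := (\sum_(z <- s) `|z u|%N).+1.
have Nz z : z \in s -> (`|z u| < N)%N.
  by move=> zs; rewrite /N (big_rem z) //= ltnS leq_addr.
have wN0 : w ^+ N != 0 by rewrite expf_neq0.
have dom (z : place X) : z u < 0 -> (`|z u| < N)%N ->
    u + w ^+ N != 0 /\ z (u + w ^+ N) < 0.
  move=> zu Nu; have dz := ord_dval z.
  have vw : z (w ^+ N) = N%:Z * z w by rewrite dvalX.
  have [zw|zw] := leP 0 (z w).
  - have [|n0 ->] := dval_domin dz (b := w ^+ N) u0; last by split.
    rewrite vgeE // vw; nia.
  - have [|n0] := dval_domin dz (b := u) wN0; last first.
      by rewrite [_ + u]addrC => ->; rewrite addrC n0 vw; split=> //; nia.
    rewrite vgeE // vw; nia.
have doy : u + w ^+ N != 0 /\ y (u + w ^+ N) < 0.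
  have dy := ord_dval y; have vw : y (w ^+ N) = N%:Z * y w by rewrite dvalX.
  have [|n0] := dval_domin dy (b := u) wN0.
    by rewrite vgeE // vw; nia.
  by rewrite [_ + u]addrC => ->; rewrite addrC n0 vw; split=> //; nia.
exists (u + w ^+ N); split; first by case: doy.
- have : vge x 1 (u + w ^+ N).
    apply: vge_add; [exact: ord_dval | by rewrite vgeE |].
    by rewrite vgeE // dvalX; [nia | exact: ord_dval | ].
  by rewrite vgeE //; case: doy.
- move=> z; rewrite inE => /orP[/eqP -> |zs]; first by case: doy.
  by case: (dom z (us z zs) (Nz z zs)).
Qed.

Lemma weak_approx1 x (s : seq (place X)) (n : place X -> int) : x \notin s ->
  exists2 f, vge x (n x) (f - 1) & forall y, y \in s -> vge y (n y) f.
Proof.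
move=> xs; have [u [u0 xu us]] := place_separate_seq xs.
pose N := (`|n x| + \sum_(z <- s) `|n z|).+1%N.
have Nz z : z \in s -> (`|n z| < N)%N.
  move=> zs; rewrite /N ltnS; apply: leq_trans (leq_addl _ _).
  by rewrite (big_rem z) //= leq_addr.
have uN0 : u ^+ N != 0 by rewrite expf_neq0.
have dx := ord_dval x.
have [w0 xw] : 1 + u ^+ N != 0 /\ x (1 + u ^+ N) = x 1.
  by apply: dval_domin => //; rewrite ?oner_neq0 // vgeE // dvalX // dval1 //; nia.
(* As u vanishes at x and has poles on s, this is close to 1 at x and close to 0 on s. *)
exists (1 + u ^+ N)^-1.
  have -> : (1 + u ^+ N)^-1 - 1 = - (u ^+ N * (1 + u ^+ N)^-1) by field.
  rewrite vge_opp // vgeE ?mulf_neq0 ?invr_eq0 // dval_div // xw dval1 // dvalX //.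
  rewrite /N; nia.
move=> y ys; have dy := ord_dval y; have yu := us y ys; have := Nz y ys => nN.
rewrite vgeE ?invr_eq0 // dvalV // addrC.
have [_ ->] : u ^+ N + 1 != 0 /\ y (u ^+ N + 1) = y (u ^+ N).
  by apply: dval_domin => //; rewrite vgeE ?oner_neq0 // dval1 // dvalX //; nia.
rewrite dvalX //; nia.
Qed.

(** Interpolation by near-idempotents [e x], each taken with its precision shifted by the order of
    [r x], so that the product meets the required one. *)
Lemma weak_approx (s : seq (place X)) (r : place X -> F) (n : place X -> int) : uniq s ->
  exists f, forall x, x \in s -> vge x (n x) (f - r x).
Proof.
move=> us.
have /choice[e eP] : forall x, exists e, x \in s ->
    vge x (n x - x (r x)) (e - 1) /\
    forall y, y \in rem x s -> vge y (n y - y (r x)) e.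
  move=> x; have [xs|_] := boolP (x \in s); last by exists 0.
  have xrs : x \notin rem x s by rewrite mem_rem_uniqF.
  have [f h1 h2] := weak_approx1 (fun y => n y - y (r x)) xrs.
  by exists f => _; split.
exists (\sum_(z <- s) r z * e z) => x xs.
have dx := ord_dval x.
have mulh z m : vge x (n x - x (r z)) m -> vge x (n x) (r z * m).
  have [->|r0] := eqVneq (r z) 0; first by rewrite mul0r vge_0.
  by rewrite vge_mull.
rewrite (big_rem x) //= addrAC; apply: vge_add => //.
  rewrite -[X in _ - X]mulr1 -mulrBr; apply: mulh; exact: (eP x xs).1.
rewrite big_seq; apply: vge_sum => // z zs; apply: mulh.
have zs' : z \in s by exact: mem_rem zs.
apply: (eP z zs').2; rewrite mem_rem_uniq // inE xs andbT.
by apply: contraTneq zs => ->; rewrite mem_rem_uniqF.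
Qed.
End WeakApproximation.

(** * Growth of powers over the rational function field *)

Lemma exp_le_exp (M B K : nat) : (0 < B)%N ->
  (forall m, M ^ m <= B ^ m * K)%N -> (M <= B)%N.
Proof.
move=> B0 h; rewrite leqNgt; apply/negP => BM.
have bern m : (B ^ m * (B + m) <= B.+1 ^ m * B)%N.
  elim: m => [|m IH]; first by rewrite !expn0 addn0.
  have h1 : (B * (B + m.+1) <= (B + m) * B.+1)%N.
    by rewrite mulnDl mulnDr mulnS mulnS; lia.
  rewrite !expnS.
  apply: (@leq_trans (B ^ m * ((B + m) * B.+1))); last by nia.
  by rewrite -mulnA mulnCA leq_mul2l h1 orbT.
(* By Bernoulli (B + 1)^m / B^m is at least 1 + m / B, which exceeds K at this m. *)
pose m := (K * B)%N; have Bm0 : (0 < B ^ m)%N by rewrite expn_gt0 B0.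
have K0 : (0 < K)%N by have := h 0%N; rewrite !expn0 mul1n.
have h1 : (B.+1 ^ m <= M ^ m)%N by rewrite leq_exp2r // muln_gt0 K0.
have := bern m; have := h m => h2 h3.
have : (B ^ m * (B + m) <= B ^ m * (K * B))%N.
  apply: (leq_trans h3); rewrite mulnA leq_mul2r; apply/orP; right.
  exact: leq_trans h1 h2.
by rewrite leq_pmul2l // /m -[leqRHS]add0n leq_add2r leqNgt B0.
Qed.

Section Growth.
Context (k : finFieldType) (X : curve k).
Local Notation F := (ff X).
Local Notation q := #|k|.
Context (t : F).
Hypothesis t_transc : forall p : {poly k}, (map_poly (Defs.cst X) p).[t] = 0 -> p = 0.
Context (n : nat) (e : 'I_n -> F).

Definition pev (p : {poly k}) : F := (map_poly (Defs.cst X) p).[t].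

Lemma pevM p r : pev (p * r) = pev p * pev r.
Proof. by rewrite /pev rmorphM hornerM. Qed.

Lemma pevD p r : pev (p + r) = pev p + pev r.
Proof. by rewrite /pev rmorphD hornerD. Qed.

Lemma pevB p r : pev (p - r) = pev p - pev r.
Proof. by rewrite /pev rmorphB hornerD hornerN. Qed.

Lemma pev0 : pev 0 = 0.
Proof. by rewrite /pev rmorph0 horner0. Qed.

Lemma pev1 : pev 1 = 1.
Proof. by rewrite /pev rmorph1 hornerC. Qed.

Lemma pevX : pev 'X = t.
Proof. by rewrite /pev map_polyX hornerX. Qed.

Lemma pevXn i : pev 'X^i = t ^+ i.
Proof. by rewrite /pev map_polyXn hornerXn. Qed.

Lemma pev_exp p i : pev (p ^+ i) = pev p ^+ i.
Proof. by elim: i => [|i IH]; rewrite ?expr0 ?pev1 // !exprS pevM IH. Qed.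

Lemma pev_eq0 p : (pev p == 0) = (p == 0).
Proof. by apply/eqP/eqP => [/t_transc //|->]; exact: pev0. Qed.

Lemma t_neq0 : t != 0.
Proof. by rewrite -pevX pev_eq0 polyX_eq0. Qed.

Definition spans := forall f, exists (r : {poly k}) (p : 'I_n -> {poly k}),
  r != 0 /\ pev r * f = \sum_i pev (p i) * e i.

Definition Pset m : set F := [set f | exists c : 'I_n -> {poly k},
  (forall j, (size (c j) <= m)%N) /\ f = \sum_j pev (c j) * e j].

Lemma Pset_card m (I : finType) (a : I -> F) : injective a -> (forall i, Pset m (a i)) ->
  (#|I| <= q ^ (n * m))%N.
Proof.
move=> ai /choice[c cP]; rewrite -card_mx.
pose g i : 'M[k]_(n, m) := \matrix_(j, r) (c i j)`_r.
apply: (leq_card g) => i i' gii; apply: ai; rewrite (cP i).2 (cP i').2.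
apply: eq_bigr => j _; congr (pev _ * _); apply/polyP => r.
have [rm|mr] := ltnP r m.
  by have := congr1 (fun A : 'M[k]_(n, m) => A j (Ordinal rm)) gii; rewrite !mxE.
by rewrite !nth_default //; apply: leq_trans mr; [exact: (cP i').1 | exact: (cP i).1].
Qed.

Lemma Pset_mono m m' f : (m <= m')%N -> Pset m f -> Pset m' f.
Proof. by move=> mm [c [cm ->]]; exists c; split=> // j; apply: leq_trans mm. Qed.

Lemma PsetD m f g : Pset m f -> Pset m g -> Pset m (f + g).
Proof.
move=> [c [cm ->]] [c' [cm' ->]]; exists (fun j => c j + c' j); split.
  by move=> j; rewrite (leq_trans (size_polyD _ _)) // geq_max cm cm'.
by rewrite -big_split; apply: eq_bigr => j _; rewrite pevD mulrDl.
Qed.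

Lemma Pset0 m : Pset m 0.
Proof.
exists (fun=> 0); split; first by move=> j; rewrite size_poly0.
by rewrite big1 // => j _; rewrite pev0 mul0r.
Qed.

Lemma Pset_sum m (I : Type) (r : seq I) (P : pred I) (f : I -> F) : (forall i, P i -> Pset m (f i)) ->
  Pset m (\sum_(i <- r | P i) f i).
Proof. by move=> h; apply: (big_ind (Pset m)) => //; [exact: Pset0 | exact: PsetD]. Qed.

Lemma PsetM d m (p : {poly k}) f : (size p <= d.+1)%N -> Pset m f -> Pset (m + d) (pev p * f).
Proof.
move=> pd [c [cm ->]]; exists (fun j => p * c j); split.
  move=> j; apply: leq_trans (size_polyMleq _ _) _.
  by have := cm j; move: pd; case: (size p) => [|s] /=; lia.
by rewrite mulr_sumr; apply: eq_bigr => j _; rewrite pevM mulrA.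
Qed.

Lemma common_denom (I : finType) (a : I -> F) : spans ->
  exists (r : {poly k}) C, r != 0 /\ forall i, Pset C (pev r * a i).
Proof.
move=> sp; have /choice[r /choice[p rp]] : forall i, exists (r : {poly k}) (p : 'I_n -> {poly k}),
  r != 0 /\ pev r * a i = \sum_j pev (p j) * e j by move=> i; exact: sp.
pose b i j := (\prod_(i' | i' != i) r i') * p i j.
exists (\prod_i r i), (\sum_i \sum_j size (b i j))%N; split.
  by apply/prodf_neq0 => i _; case: (rp i).
move=> i; exists (b i); split.
  by move=> j; rewrite (bigD1 i) //= (bigD1 j) //= -addnA leq_addr.
rewrite (bigD1 i) //= pevM mulrAC (rp i).2 mulrC mulr_sumr; apply: eq_bigr => j _.
by rewrite mulrA -pevM.
Qed.

(* [z] acts like an algebraic function of degree [d] over k(t): multiplication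
   by [z^r] costs a common denominator, and the degree in [t] grows by at most [d] per power. *)
Definition good z d := forall m, exists2 u, u != 0 & forall r, (r < m)%N ->
  forall C f, Pset C f -> Pset (C + d * m) (u * z ^+ r * f).

(* The sums of [z^r a_(i_r)], r < m, are pairwise distinct and lie in a space
   with q^(n (C + d m)) elements; compare the two growth rates in m. *)
Lemma growth z d (A : set F) (I : finType) (a : I -> F) : spans -> z != 0 -> good z d ->
  subgroup A -> (forall f, A f -> A (z * f)) -> (forall i, A (a i)) ->
  incong a [set z * b | b in A] -> (#|I| <= q ^ (n * d))%N.
Proof.
move=> sp z0 gz sA zA Aa ai.
have [Q [C [Q0 PC]]] := common_denom a sp.
apply: (@exp_le_exp _ _ (q ^ (n * C))); first by rewrite expn_gt0 (ltnW (card_finNzRing_gt1 _)).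
move=> m; have [u u0 uP] := gz m.
have -> : (((q ^ (n * d)) ^ m) * q ^ (n * C) = q ^ (n * (C + d * m)))%N.
  by rewrite -expnM -expnD; congr (_ ^ _)%N; ring.
pose S := foldr (fun i f => a i + z * f) 0.
have AS l : A (S l).
  elim: l => [|i l IH] /=; first exact: subgroup0.
  by apply: subgroupD => //; exact: zA.
have Si l l' : size l = size l' -> S l = S l' -> l = l'.
  elim: l l' => [|i l IH] [|j l'] //= [ll] eq.
  have ij : i = j.
    apply: ai; exists (S l' - S l); first exact: subgroupB.
    by rewrite mulrBr -[a i](addrK (z * S l)) eq; ring.
  by move: eq; rewrite ij => /addrI /(mulfI z0) /(IH _ ll) ->.
have PS l r : (r + size l <= m)%N -> Pset (C + d * m) (u * z ^+ r * (pev Q * S l)).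
  elim: l r => [|i l IH] r /=; first by rewrite !mulr0 => _; exact: Pset0.
  move=> h; rewrite 2!mulrDr; apply: PsetD.
    by apply: uP => //; lia.
  have -> : u * z ^+ r * (pev Q * (z * S l)) = u * z ^+ r.+1 * (pev Q * S l).
    by rewrite exprS; ring.
  by apply: IH; lia.
rewrite -card_tuple.
apply: (@Pset_card _ _ (fun l : m.-tuple I => u * z ^+ 0 * (pev Q * S l))).
  move=> l l'; rewrite expr0 mulr1 => /(mulfI u0) /mulfI h; apply: val_inj; apply: Si.
    by rewrite !size_tuple.
  by apply: h; rewrite pev_eq0.
by move=> l; apply: PS; rewrite size_tuple.
Qed.

Lemma good_poly (p : {poly k}) d : (size p <= d.+1)%N -> good (pev p) d.
Proof.
move=> pd m; exists 1; first exact: oner_neq0.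
move=> r rm C f Cf; rewrite mul1r -pev_exp; apply: PsetM => //.
apply: leq_trans (size_poly_exp_leq _ _) _; rewrite ltnS.
by rewrite leq_mul // ?(ltnW rm) //; case: (size p) pd.
Qed.

Lemma good_inv : good t^-1 1.
Proof.
move=> m; exists (t ^+ m); first by rewrite expf_neq0 // t_neq0.
move=> r rm C f Cf; rewrite exprVn -expfB // -pevXn; apply: PsetM => //.
by rewrite size_polyXn ltnS mul1n leq_subr.
Qed.

(** Q clears the denominators of the products [z^-1 * e j], so multiplying by Q z^-1 raises degrees
    by a bounded amount. With u = Q^m z^-m one has u z^r = Q^r (Q z^-1)^(m - r), a product of m such
    factors. *)
Lemma good_any z : spans -> z != 0 -> exists d, good z d.
Proof.
move=> sp z0.
have [Q [D0 [Q0 PD0]]] := common_denom (fun j => z^-1 * e j) sp.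
pose D := (D0 + size Q)%N; exists D => m.
have mulQ i C f : Pset C f -> Pset (C + D * i) (pev Q ^+ i * f).
  move=> Cf; rewrite -pev_exp; apply: PsetM => //.
  apply: leq_trans (size_poly_exp_leq _ _) _; rewrite ltnS leq_mul // /D; lia.
have mulQz i C f : Pset C f -> Pset (C + D * i) ((pev Q * z^-1) ^+ i * f).
  elim: i C f => [|i IH] C f Cf; first by rewrite expr0 mul1r muln0 addn0.
  rewrite exprS -mulrA; have [c [cs ->]] := IH C f Cf.
  rewrite mulr_sumr; apply: Pset_sum => j _.
  rewrite mulrCA -mulrA; have := PD0 j => Pj.
  rewrite mulnS [(D + _)%N]addnC addnA.
  have := PsetM (d := (C + D * i)%N) (leqW (cs j)) Pj.
  by apply: Pset_mono; rewrite /D; lia.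
exists (pev Q ^+ m * z^-1 ^+ m).
  by rewrite mulf_neq0 // expf_neq0 ?invr_eq0 // pev_eq0.
move=> r rm C f Cf.
have -> : pev Q ^+ m * z^-1 ^+ m * z ^+ r * f =
   pev Q ^+ r * ((pev Q * z^-1) ^+ (m - r) * f).
  rewrite -{1 2}(subnK (ltnW rm)) !exprD exprMn !exprVn.
  by field; rewrite !expf_neq0.
have := mulQ r _ _ (mulQz (m - r)%N C f Cf).
by rewrite -addnA -mulnDr subnK // ltnW.
Qed.

Lemma poly_relation N (a : 'I_N -> F) : spans -> (n < N)%N ->
  exists2 c : 'I_N -> {poly k}, exists i, c i != 0 & \sum_i pev (c i) * a i = 0.
Proof.
move=> sp nN; have [Q [C [Q0 PC]]] := common_denom a sp.
(* As N > n, this m makes the number q^(N m) of coefficient matrices exceed the q^(n (C + m)) values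
   that their combinations can take. *)
pose m := (n * C).+1.
pose g (A : 'M[k]_(N, m)) := \sum_i pev (rVpoly (row i A)) * (pev Q * a i).
have Pg A : Pset (C + m) (g A).
  by apply: Pset_sum => i _; apply: PsetM => //; rewrite leqW // size_poly.
have [A [B [AB gAB]]] : exists A B, A != B /\ g A = g B.
  apply: contrapT => nex.
  have gi : injective g.
    by move=> A B gAB; apply/eqP/negPn/negP => AB; apply: nex; exists A, B.
  have := Pset_card gi Pg; rewrite card_mx leq_exp2l ?card_finNzRing_gt1 //.
  by rewrite /m; nia.
exists (fun i => rVpoly (row i A) - rVpoly (row i B)).
  apply: contrapT => nex; case/eqP: AB; apply/row_matrixP => i.
  apply: (can_inj (@rVpolyK _ _)); apply/eqP; rewrite -subr_eq0; apply/negPn/negP => h.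
  by apply: nex; exists i.
have Q0' : pev Q != 0 by rewrite pev_eq0.
apply: (mulfI Q0'); rewrite mulr0.
transitivity (g A - g B); last by rewrite gAB subrr.
rewrite mulr_sumr -sumrB; apply: eq_bigr => i _.
by rewrite pevB; ring.
Qed.

Lemma vge_cst (x : place X) c : vge x 0 (Defs.cst X c).
Proof.
have [->|c0] := eqVneq c 0; first by rewrite rmorph0 vge_0.
by rewrite vgeE ?fmorph_eq0 // ord_cst.
Qed.

Lemma pev_int (x : place X) p : vge x 0 t -> vge x 0 (pev p).
Proof.
have dx := ord_dval x; move=> xt.
rewrite /pev horner_coef; apply: vge_sum => // j _; rewrite coef_map.
by apply: vge_mul0 => //; [exact: vge_cst | exact: vge_exp].
Qed.

(** The witness is the leading coefficient of an algebraic equation of f over k[t]: where it is a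
    unit and t is integral, a pole of f would make the leading term the unique one of lowest
    order. *)
Lemma pole_denom f : spans -> exists2 p, p != 0 & forall x : place X, vge x 0 t ->
  x (pev p) = 0 -> vge x 0 f.
Proof.
move=> sp; have [c [i ci] csum] := poly_relation (fun i : 'I_n.+1 => f ^+ i) sp (ltnSn n).
case: (@arg_maxnP _ i (fun i => c i != 0) val ci) => i0 ci0 maxi0.
exists (c i0) => // x xt xp; apply/negPn/negP => xf; have dx := ord_dval x.
have f0 : f != 0 by apply: contraNneq xf => ->; exact: vge_0.
move: xf; rewrite vgeE // -ltNge => xf.
have p0 : pev (c i0) != 0 by rewrite pev_eq0.
have : vge x (i0%:Z * x f + 1) (pev (c i0) * f ^+ i0).
  move/eqP: csum; rewrite (bigD1 i0) //= addr_eq0 => /eqP ->; rewrite vge_opp //.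
  apply: vge_sum => // j ji.
  have [->|cj] := eqVneq (c j) 0; first by rewrite pev0 mul0r vge_0.
  apply: vge_mul0 => //; first exact: pev_int.
  rewrite vgeE ?expf_neq0 // dvalX //.
  have ji0 : (j < i0)%N by rewrite ltn_neqAle ji; exact: maxi0.
  nia.
rewrite vgeE ?mulf_neq0 ?expf_neq0 // dvalM ?expf_neq0 // xp dvalX //; lia.
Qed.

(** Otherwise every nonzero polynomial in t is a unit at x, and by [pole_denom] the whole field is
    integral at x, against the existence of an element of order -1. *)
Lemma place_poly (x : place X) : spans -> vge x 0 t -> exists2 p, p != 0 & 0 < x (pev p).
Proof.
move=> sp xt; have dx := ord_dval x; apply: contrapT => np.
have h p : p != 0 -> x (pev p) = 0.
  move=> p0; have := pev_int p xt; rewrite vgeE ?pev_eq0 // => ge0.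
  by apply/eqP; rewrite eq_le ge0 andbT leNgt; apply/negP => gt0; apply: np; exists p.
have [f f0 xf] := dval_surj dx (-1); have [p p0 /(_ x xt (h p p0))] := pole_denom f sp.
by rewrite vgeE // xf.
Qed.

End Growth.

(** * Places and divisors *)

Section Places.
Context (k : finFieldType) (X : curve k).
Local Notation F := (ff X).
Local Notation q := #|k|.
Implicit Types (x y : place X) (f : F) (D : place X -> int).

(** A spanning family of minimal length is independent, since a relation with [p i != 0] would
    eliminate [e i]. *)
Lemma ff_generator : exists (t : F) n (e : 'I_n -> F),
  [/\ forall p : {poly k}, (map_poly (Defs.cst X) p).[t] = 0 -> p = 0,
      spans t e &
      forall p : 'I_n -> {poly k}, \sum_i pev t (p i) * e i = 0 -> forall i, p i = 0].
Proof.
have [t [tt [d0 [e0 sp0]]]] := ff_gen X.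
pose P n := `[< exists e : 'I_n -> F, spans t e >].
have exP : exists n, P n by exists d0; apply/asboolP; exists e0.
case: (ex_minnP exP) => n /asboolP[e sp] minn.
exists t, n, e; split=> // p psum i; apply/eqP/negPn/negP => hp0.
case: n => [|n] in e sp minn p psum i hp0 *; first by case: i {hp0}.
suff : P n by move/minn; rewrite ltnn.
apply/asboolP; exists (fun j => e (lift i j)) => f.
have [r [c [r0 cr]]] := sp f.
exists (p i * r), (fun j => p i * c (lift i j) - c i * p (lift i j)); split.
  by rewrite mulf_neq0.
have psumE : pev t (p i) * e i = - \sum_j pev t (p (lift i j)) * e (lift i j).
  by move/eqP: psum; rewrite (bigD1_ord i) //= addr_eq0 => /eqP.
rewrite pevM -mulrA cr (bigD1_ord i) //= mulrDr [_ * (pev t (c i) * _)]mulrCA psumE.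
rewrite mulrN mulr_sumr [_ * \sum_j _]mulr_sumr addrC -sumrB; apply: eq_bigr => j _.
by rewrite pevB !pevM mulrBl !mulrA.
Qed.

(** The bound serves every subgroup stable under z: a valuation ring, for residue fields; a
    semilocal ring, for the zeros of z; and the maximal subring from which a place is yet to be
    constructed. *)
Lemma growth_bound z : z != 0 -> exists B, forall (A : set F) (I : finType) (a : I -> F),
  subgroup A -> (forall f, A f -> A (z * f)) -> (forall i, A (a i)) ->
  incong a [set z * b | b in A] -> (#|I| <= B)%N.
Proof.
move=> z0; have [t [n [e [tt sp _]]]] := ff_generator.
have [d gd] := good_any tt sp z0.
by exists (q ^ (n * d))%N => A I a sA zA Aa ai; apply: (growth tt sp z0 gd sA zA Aa ai).
Qed.

Lemma uniformizer x : exists2 z, z != 0 & x z = 1.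
Proof. exact: dval_surj (ord_dval x) 1. Qed.

Lemma scaled_vge x z n : z != 0 -> [set z * b | b in [set f | vge x n f]] = [set f | vge x (n + x z) f].
Proof.
move=> z0; have dx := ord_dval x; apply/seteqP; split => [_ [b xb <-]|f xf] /=.
  by rewrite vge_mull // addrK.
by exists (z^-1 * f); rewrite ?mulVKf //= vge_mull ?invr_eq0 // dvalV // opprK.
Qed.

Lemma vge_subspace x n : ksubspace (Defs.cst X) (V := F^o) [set f | vge x n f].
Proof.
split; first exact: vge_subgroup (ord_dval x) n.
move=> c a /= xa; have dx := ord_dval x; apply: vge_mul0 => //; exact: vge_cst.
Qed.

(** Finiteness of the residue field, from the growth bound for a uniformizer. It also shows that the
    [xget] in [degp] does not return its default. *)
Lemma idx_residue x : is_dim (Defs.cst X) (V := F^o) [set f | vge x 0 f] [set f | vge x 1 f] (degp x)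
  /\ has_index (V := F) [set f | vge x 0 f] [set f | vge x 1 f] (q ^ degp x).
Proof.
have dx := ord_dval x; have [z z0 xz] := uniformizer x; have [B hB] := growth_bound z0.
have s0 := vge_subspace x 0; have s1 := vge_subspace x 1.
have [N _ iN] : exists2 N, (N <= B)%N & has_index (V := F) [set f | vge x 0 f] [set f | vge x 1 f] N.
  apply: idx_bounded => [|N e xe ei]; first exact: vge_subgroup.
  rewrite -[N]card_ord; apply: (hB [set f | vge x 0 f] _ e) => //.
  - exact: vge_subgroup.
  - by move=> f xf; apply: vge_mul0 => //=; rewrite vgeE // xz.
  - by rewrite scaled_vge // xz add0r.
have [d hd Nd] := idx_is_dim (V := F^o) s1 s0 iN.
have hdeg : is_dim (Defs.cst X) (V := F^o) [set f | vge x 0 f] [set f | vge x 1 f] (degp x).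
  by rewrite /degp; case: xgetP => [d' -> //|nd]; have := nd d hd.
by split=> //; exact: (is_dim_idx s1 s0 hdeg).
Qed.

Lemma degp_gt0 x : (0 < degp x)%N.
Proof.
rewrite lt0n; apply/eqP => d0; have [_] := idx_residue x.
rewrite d0 expn0 => /idx1 h; have dx := ord_dval x.
have : [set f | vge x 0 f] (1 : F) by exact: vge_1.
rewrite h; [|exact: vge_subgroup|exact: vge_subgroup|].
  by rewrite /= vgeE ?oner_neq0 // dval1.
by move=> f /=; exact: vge_trans.
Qed.

(* The adelic counterpart of O(-D), not of O(D). *)
Definition box D : set (place X -> F^o) := [set r | forall x, vge x (D x) (r x)].

Lemma box_subspace D : ksubspace (Defs.cst X) (box D).
Proof.
split; last first.
  by move=> c r Dr x; apply: vge_mul0 => //; [exact: ord_dval | exact: vge_cst].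
split=> [x|r r' Dr Dr' x]; first exact: vge_0.
by apply: vge_sub => //; exact: ord_dval.
Qed.

Lemma box_subgroup D : subgroup (box D). Proof. exact: (box_subspace D).1. Qed.

Lemma box_mono D D' : (forall x, D x <= D' x) -> box D' `<=` box D.
Proof. by move=> DD r Dr x; apply: vge_trans (Dr x). Qed.

Lemma idx_box1 D y : has_index (box D) (box (fun x => D x + (y == x)%:Z)) (q ^ degp y).
Proof.
have dy := ord_dval y; have [_ [e [oe ei ec]]] := idx_residue y.
have [z z0 yz] := dval_surj dy (D y).
pose E i : place X -> F^o := fun x => if y == x then z * e i else 0.
exists E; split.
- move=> i x; rewrite /E; case: eqVneq => [<-|_]; last exact: vge_0.
  by rewrite vge_mull // yz subrr; exact: oe.
- move=> i j /(_ y); rewrite /E /= !fctE /= eqxx -mulrBr vge_mull // yz [D y + _]addrC addrK => h.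
  exact: ei.
- move=> r Dr; have [|i yi] := ec (z^-1 * r y).
    by rewrite /= vge_mull ?invr_eq0 // dvalV // yz opprK add0r; exact: Dr.
  exists i => x; rewrite !fctE /E; case: eqVneq => [<-|_]; last first.
    by change (vge x (D x + 0) (r x - 0)); rewrite subr0 addr0; exact: Dr.
  have -> : r y - z * e i = z * (z^-1 * r y - e i) by rewrite mulrBr mulVKf.
  by rewrite vge_mull // yz [D y + _]addrC addrK.
Qed.

Lemma idx_box D (s : seq (place X)) :
  has_index (box D) (box (fun x => D x + (count_mem x s)%:Z)) (q ^ \sum_(x <- s) degp x).
Proof.
elim: s => [|y s IH].
  rewrite big_nil expn0 -(card_ord 1).
  apply: (idx_card (e := fun=> 0)) => [i|i j _|w Dw]; last 1 first.
  - by exists ord0; rewrite subr0 => x; rewrite addr0; exact: Dw.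
  - exact: subgroup0 (box_subgroup _).
  - by rewrite !ord1.
rewrite big_cons addnC expnD.
have -> : (fun x => D x + (count_mem x (y :: s))%:Z) =
   (fun x => (D x + (count_mem x s)%:Z) + (y == x)%:Z).
  by apply/funext => x /=; rewrite PoszD addrA addrAC.
apply: idx_tower IH (idx_box1 _ y); try exact: box_subgroup.
  by apply: box_mono => x; rewrite lerDl.
by apply: box_mono => x; rewrite lerDl.
Qed.

Definition mseq (u : seq (place X)) (m : place X -> nat) := flatten [seq nseq (m x) x | x <- u].

Lemma count_mseq u m x : uniq u -> count_mem x (mseq u m) = if x \in u then m x else 0%N.
Proof.
elim: u => //= y u IH /andP[yu uu]; rewrite /mseq /= count_cat count_nseq -/(mseq u m).
rewrite IH // in_cons /= [y == x]eq_sym; case: (eqVneq x y) => [->|_] /=; last by rewrite mul0n add0n.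
by rewrite (negPf yu) mul1n addn0.
Qed.

Lemma deg_mseq u m : \sum_(x <- mseq u m) degp x = (\sum_(x <- u) m x * degp x)%N.
Proof.
elim: u => [|y u IH]; first by rewrite !big_nil.
by rewrite /mseq /= big_cat big_cons -/(mseq u m) IH big_nseq iter_addn addn0 mulnC.
Qed.

(** A is the ring of functions integral on s, so that zA consists of the functions of order at least
    [x z] at each x of s. Weak approximation lifts into A all residue classes of integral adeles
    modulo the zeros of z on s. *)
Lemma zeros_incong z (s : seq (place X)) : z != 0 -> uniq s -> (forall x, x \in s -> 0 < x z) ->
  exists (A : set F) (a : 'I_(q ^ \sum_(x <- s) (`|x z| * degp x))%N -> F),
  [/\ subgroup A, forall f, A f -> A (z * f), forall i, A (a i) &
      incong a [set z * b | b in A]].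
Proof.
move=> z0 us zs; pose m x := `|x z|%N.
have := idx_box (fun=> 0) (mseq s m); rewrite deg_mseq => -[e [be ei _]].
have /choice[a aP] : forall i, exists f, forall x, x \in s -> vge x (x z) (f - e i x).
  by move=> i; have [f fP] := weak_approx (e i) (fun x => x z) us; exists f.
pose A : set F := [set f | forall x, x \in s -> vge x 0 f].
exists A, a; split.
- split=> [x _|f g fA gA x xs]; first exact: vge_0.
  by apply: vge_sub; [exact: ord_dval | exact: fA | exact: gA].
- move=> f Af x xs; apply: vge_mul0; [exact: ord_dval | | exact: Af].
  by rewrite vgeE // ltW // zs.
- move=> i x xs; rewrite -[a i](subrK (e i x)); apply: vge_add; first exact: ord_dval.
    by apply: vge_trans (aP i x xs); rewrite ltW // zs.
  exact: be.
- move=> i j [b Ab eq]; apply: ei => x; have dx := ord_dval x.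
  rewrite add0r count_mseq //; case: ifPn => xs.
    have -> : (m x)%:Z = x z by rewrite /m; have := zs x xs; lia.
    have h1 := aP i x xs; have h2 := aP j x xs.
    rewrite !fctE; apply: (vge_split dx (b := a i)); first by rewrite vge_subC.
    apply: (vge_split dx _ h2); rewrite -eq vge_mull // subrr; exact: Ab.
  by rewrite !fctE; apply: vge_sub => //; exact: be.
Qed.

Lemma zeros_finite z : z != 0 -> finite_set [set x : place X | 0 < x z].
Proof.
move=> z0; have [B hB] := growth_bound z0.
apply: contrapT => /(infinite_set_fset B.+1)[S Sz].
pose s := finmap.enum_fset S => sB.
have zs x : x \in s -> 0 < x z by move=> xs; apply: Sz.
have [A [a [sA zA Aa ai]]] := zeros_incong z0 (finmap.fset_uniq S) zs.
have := hB A _ a sA zA Aa ai; rewrite card_ord leqNgt => /negP; apply.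
apply: leq_trans (ltn_expl _ (card_finNzRing_gt1 k)).
apply: leq_trans (leqW sB) _; rewrite ltnS.
rewrite -sum1_size.
rewrite big_seq [leqRHS]big_seq; apply: leq_sum => x xs.
by rewrite muln_gt0 degp_gt0 andbT; have := zs x xs; lia.
Qed.

Lemma ord_finite f : almost_all (fun x : place X => x f = 0).
Proof.
have [->|f0] := eqVneq f 0; first by apply: almost_allT => x; exact: dval0 (ord_dval x).
have : finite_set ([set x : place X | 0 < x f] `|` [set x : place X | 0 < x f^-1]).
  by rewrite finite_setU; split; apply: zeros_finite; rewrite ?invr_eq0.
apply: sub_finite_set => x /= /eqP xf; rewrite dvalV //; last exact: ord_dval.
by rewrite oppr_gt0; case: (ltgtP (x f) 0) xf; auto.
Qed.

(** When e is a basis of F over k(t), the case z = t^-1, d = 1 bounds the degree of the poles of t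
    by [F : k(t)]. *)
Lemma zeros_degree (t : F) n (e : 'I_n -> F) z d (s : seq (place X)) :
  (forall p : {poly k}, (map_poly (Defs.cst X) p).[t] = 0 -> p = 0) -> spans t e ->
  z != 0 -> good t e z d -> uniq s -> (forall x, x \in s -> 0 < x z) ->
  (\sum_(x <- s) `|x z| * degp x <= n * d)%N.
Proof.
move=> tt sp z0 gd us zs; have [A [a [sA zA Aa ai]]] := zeros_incong z0 us zs.
have := growth tt sp z0 gd sA zA Aa ai; rewrite card_ord leq_exp2l //.
exact: card_finNzRing_gt1.
Qed.

Definition fsupp D := almost_all (fun x => D x = 0).

Definition dg D : int := \sum_(x \in [set: place X]) (degp x)%:Z * D x.

Lemma fsupp0 : fsupp (fun=> 0).
Proof. exact: almost_allT. Qed.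

Lemma fsupp_seq D : fsupp D -> exists2 s : seq (place X), uniq s & forall x, x \notin s -> D x = 0.
Proof.
move=> /finite_seqP[s sE]; exists (undup s); first exact: undup_uniq.
move=> x; rewrite mem_undup => /negP xs; apply: contrapT => Dx; apply: xs.
have : (~` [set x | D x = 0]) x by [].
by rewrite sE.
Qed.

Lemma fsupp_seq2 D D' : fsupp D -> fsupp D' -> exists s : seq (place X),
  [/\ uniq s, forall x, x \notin s -> D x = 0 & forall x, x \notin s -> D' x = 0].
Proof.
move=> /fsupp_seq[s us Ds] /fsupp_seq[s' us' Ds'].
exists (undup (s ++ s')); split; first exact: undup_uniq.
  by move=> x; rewrite mem_undup mem_cat negb_or => /andP[/Ds].
by move=> x; rewrite mem_undup mem_cat negb_or => /andP[_ /Ds'].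
Qed.

Lemma dgE (s : seq (place X)) D : uniq s -> (forall x, x \notin s -> D x = 0) ->
  dg D = \sum_(x <- s) (degp x)%:Z * D x.
Proof.
move=> us sD; rewrite /dg (@fsbigE _ _ _ _ _ s) //; last by move=> x _ /sD ->; rewrite mulr0.
by apply: eq_bigl => x; rewrite in_setT.
Qed.

Lemma fsupp_op2 (op : int -> int -> int) D D' : op 0 0 = 0 -> fsupp D -> fsupp D' -> fsupp (fun x => op (D x) (D' x)).
Proof. by move=> op0 fD fD'; apply: almost_allW (almost_allI fD fD') => x [-> ->]. Qed.

Lemma fsupp_op (op : int -> int) D : op 0 = 0 -> fsupp D -> fsupp (fun x => op (D x)).
Proof. by move=> op0 fD; apply: almost_allW fD => x ->. Qed.

Lemma dgD D D' : fsupp D -> fsupp D' -> dg (fun x => D x + D' x) = dg D + dg D'.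
Proof.
move=> fD fD'; have [s [us Ds Ds']] := fsupp_seq2 fD fD'.
rewrite (dgE us Ds) (dgE us Ds') (dgE us); last by move=> x xs; rewrite Ds // Ds'.
by rewrite -big_split; apply: eq_bigr => x _; rewrite mulrDr.
Qed.

Lemma dgZ c D : fsupp D -> dg (fun x => c * D x) = c * dg D.
Proof.
move=> /fsupp_seq[s us Ds]; rewrite (dgE us Ds) (dgE us); last by move=> x xs; rewrite Ds ?mulr0.
by rewrite mulr_sumr; apply: eq_bigr => x _; rewrite mulrCA.
Qed.

Lemma dgN D : fsupp D -> dg (fun x => - D x) = - dg D.
Proof.
move=> fD; rewrite -mulN1r -dgZ //; congr dg; apply/funext => x; by rewrite mulN1r.
Qed.

Lemma dgB D D' : fsupp D -> fsupp D' -> dg (fun x => D x - D' x) = dg D - dg D'.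
Proof.
by move=> fD fD'; rewrite dgD ?dgN //; apply: (fsupp_op (op := -%R)); rewrite ?oppr0.
Qed.

Lemma le_dg D D' : fsupp D -> fsupp D' -> (forall x, D x <= D' x) -> dg D <= dg D'.
Proof.
move=> fD fD' DD; have [s [us Ds Ds']] := fsupp_seq2 fD fD'.
by rewrite (dgE us Ds) (dgE us Ds'); apply: ler_sum => x _; rewrite ler_wpM2l.
Qed.

Lemma dg0 : dg (fun=> 0) = 0.
Proof. by rewrite (dgE (s := [::])) // big_nil. Qed.

Lemma ge_dg_eq D D' : fsupp D -> fsupp D' -> (forall x, D x <= D' x) -> dg D' <= dg D -> D = D'.
Proof.
move=> fD fD' DD; have [s [us Ds Ds']] := fsupp_seq2 fD fD'.
rewrite (dgE us Ds) (dgE us Ds') => h; apply/funext => x.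
have [xs|xs] := boolP (x \in s); last by rewrite Ds // Ds'.
apply/eqP; rewrite eq_le DD /= leNgt; apply/negP => lt.
move: h; rewrite !(big_rem x xs) /= leNgt => /negP; apply; apply: ltr_leD.
  by rewrite ltr_pM2l // ltz_nat degp_gt0.
by apply: ler_sum => y _; rewrite ler_wpM2l.
Qed.

Lemma idx_box_le D D' : fsupp D -> fsupp D' -> (forall x, D x <= D' x) ->
  exists2 s, has_index (box D) (box D') (q ^ s) & s%:Z = dg D' - dg D.
Proof.
move=> fD fD' DD; have [s [us Ds Ds']] := fsupp_seq2 fD fD'.
pose m x := `|D' x - D x|%N; have := idx_box D (mseq s m); rewrite deg_mseq.
have -> : (fun x => D x + (count_mem x (mseq s m))%:Z) = D'.
  apply/funext => x; rewrite count_mseq //; case: ifPn => [_|xs]; last by rewrite Ds // Ds'.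
  by rewrite /m; have := DD x; lia.
move=> h; eexists; first exact: h.
rewrite (dgE us Ds) (dgE us Ds') -sumrB (big_morph Posz PoszD (erefl _)); apply: eq_bigr => x _.
by rewrite PoszM /m -mulrBr; have := DD x; nia.
Qed.

End Places.

(** * Existence of poles *)

Lemma exprVB (E : fieldType) (a : E) i n : a != 0 -> (i <= n)%N ->
  a^-1 ^+ (n - i) = a ^+ i * a^-1 ^+ n.
Proof.
by move=> a0 h; rewrite -{2}(subnKC h) exprD mulrA -exprMn mulfV // expr1n mul1r.
Qed.

Section Poles.
Context (k : finFieldType) (X : curve k).
Local Notation F := (ff X).

Definition kalg (B : set F) := [/\ forall c, B (Defs.cst X c),
  forall a b, B a -> B b -> B (a - b) & forall a b, B a -> B b -> B (a * b)].

Section Kalg.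
Context (B : set F) (kB : kalg B).

Lemma kalg0 : B 0. Proof. by case: kB => h _ _; rewrite -(rmorph0 (Defs.cst X)). Qed.
Lemma kalg1 : B 1. Proof. by case: kB => h _ _; rewrite -(rmorph1 (Defs.cst X)). Qed.
Lemma kalgB a b : B a -> B b -> B (a - b). Proof. by case: kB => _ h _; exact: h. Qed.
Lemma kalgM a b : B a -> B b -> B (a * b). Proof. by case: kB => _ _ h; exact: h. Qed.
Lemma kalgN a : B a -> B (- a). Proof. by move=> Ba; rewrite -sub0r; apply: kalgB => //; exact: kalg0. Qed.
Lemma kalgD a b : B a -> B b -> B (a + b).
Proof. by move=> Ba Bb; rewrite -[b]opprK; apply: kalgB => //; exact: kalgN. Qed.
Lemma kalgX a i : B a -> B (a ^+ i).
Proof. by move=> Ba; elim: i => [|i IH]; rewrite ?expr0 ?exprS; [exact: kalg1|exact: kalgM]. Qed.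
Lemma kalg_sum (I : Type) (r : seq I) (P : pred I) (f : I -> F) : (forall i, P i -> B (f i)) ->
  B (\sum_(i <- r | P i) f i).
Proof. by move=> h; apply: (big_ind B) => //; [exact: kalg0 | exact: kalgD]. Qed.
Lemma kalg_subgroup : subgroup B.
Proof. by split; [exact: kalg0 | exact: kalgB]. Qed.

Definition adjoin w : set F := [set s | exists2 p : {poly F}, (forall i, B p`_i) & s = p.[w]].

Lemma adjoin_kalg w : kalg (adjoin w).
Proof.
split=> [c|_ _ [p pB ->] [r rB ->]|_ _ [p pB ->] [r rB ->]].
- exists (Defs.cst X c)%:P; last by rewrite hornerC.
  by move=> i; rewrite coefC; case: ifP => _; [case: kB => h _ _ | exact: kalg0].
- by exists (p - r); [move=> i; rewrite coefB; exact: kalgB | rewrite hornerD hornerN].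
- exists (p * r); last by rewrite hornerM.
  by move=> i; rewrite coefM; apply: kalg_sum => j _; exact: kalgM.
Qed.

Lemma sub_adjoin w : B `<=` adjoin w.
Proof.
move=> b Bb; exists b%:P; last by rewrite hornerC.
by move=> i; rewrite coefC; case: ifP => _ //; exact: kalg0.
Qed.

Lemma mem_adjoin w : adjoin w w.
Proof.
exists 'X; last by rewrite hornerX.
by move=> i; rewrite coefX; case: eqP => _; [exact: kalg1 | exact: kalg0].
Qed.
End Kalg.

(* Such a maximal ring avoiding [f] is a valuation ring. *)
Lemma maximal_kalg f (B0 : set F) : kalg B0 -> ~ B0 f -> exists V, [/\ kalg V, B0 `<=` V, ~ V f &
  forall w, ~ V w -> adjoin V w f].
Proof.
move=> kB0 B0f; pose P (B : set F) := B = set0 \/ [/\ kalg B, B0 `<=` B & ~ B f].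
have [|V [PV maxV]] := @Zorn_bigcup F P.
  move=> C CP totC.
  have [[B1 CB1 B1n]|nB] := pselect (exists2 B1, C B1 & B1 !=set0); last first.
    left; rewrite -subset0 => a [B CB Ba].
    by apply: nB; exists B => //; exists a.
  right; have good1 : [/\ kalg B1, B0 `<=` B1 & ~ B1 f].
    by have [b0|//] := CP _ CB1; move: B1n; rewrite b0 => -[].
  have get2 a b : (\bigcup_(Y in C) Y) a -> (\bigcup_(Y in C) Y) b ->
      exists B, [/\ C B, kalg B, B a & B b].
    move=> [Ba CBa Baa] [Bb CBb Bbb].
    have kBa : kalg Ba by have [b0|[]//] := CP _ CBa; move: Baa; rewrite b0.
    have kBb : kalg Bb by have [b0|[]//] := CP _ CBb; move: Bbb; rewrite b0.
    by have [h|h] := totC _ _ CBa CBb; [exists Bb | exists Ba]; split=> //; exact: h.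
  split.
  - split=> [c|a b Ca Cb|a b Ca Cb].
    + by exists B1 => //; case: good1 => -[h _ _] _ _; exact: h.
    + by have [B [CB kB Ba Bb]] := get2 _ _ Ca Cb; exists B => //; exact: kalgB.
    + by have [B [CB kB Ba Bb]] := get2 _ _ Ca Cb; exists B => //; exact: kalgM.
  - by move=> a B0a; exists B1 => //; case: good1 => _ h _; exact: h.
  - move=> [B CB Bf]; have [b0|[]//] := CP _ CB; by move: Bf; rewrite b0.
have B0n : B0 !=set0 by exists 1; exact: kalg1.
have [V0|[kV BV Vf]] := PV.
  case: (maxV B0); last by right; split.
  rewrite V0; split; first exact: sub0set.
  by case: B0n => b B0b h; have := h b B0b.
exists V; split=> // w Vw; apply: contrapT => nf.
apply: (maxV (adjoin V w)); last first.
  right; split=> //; first exact: adjoin_kalg.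
  by move=> b /BV; exact: sub_adjoin.
split; first exact: sub_adjoin.
by move=> /(_ w (mem_adjoin kV w)).
Qed.

Section Maximal.
Context (f : F) (V : set F) (kV : kalg V) (Vf : ~ V f) (Vz : V f^-1).
Hypothesis maxV : forall w, ~ V w -> adjoin V w f.

Let f0 : f != 0. Proof. by apply: contra_notN Vf => /eqP ->; exact: kalg0. Qed.

(** f^-1 lies in the Jacobson radical of V. If u = 1 - f^-1 b were not invertible in V, then f would
    be a polynomial in u^-1 over V. As u is congruent to 1 modulo f^-1 V, both u^N f - f and, for N
    large, u^N f lie in V, hence so does f. *)
Lemma maximal_unit b : V b -> 1 - f^-1 * b != 0 /\ V (1 - f^-1 * b)^-1.
Proof.
move=> Vb; set u := 1 - f^-1 * b.
have u0 : u != 0.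
  apply: contra_notN Vf => /eqP /(congr1 (fun a => f * a)).
  by rewrite mulr0 /u mulrBr mulr1 mulVKf // => /eqP; rewrite subr_eq0 => /eqP ->.
split=> //; apply: contrapT => /maxV [p pV fE].
have Vu : V u by apply: kalgB => //; [exact: kalg1 | exact: kalgM].
have h1 N : V (u ^+ N * f - f).
  elim: N => [|N IH]; first by rewrite expr0 mul1r subrr; exact: kalg0.
  have -> : u ^+ N.+1 * f - f = (u ^+ N * f - f) - b * u ^+ N.
    by rewrite exprS {1}/u; field.
  by apply: kalgB => //; apply: kalgM => //; exact: kalgX.
apply: Vf; pose N := size p.
have h2 : V (u ^+ N * f).
  rewrite fE horner_coef mulr_sumr; apply: kalg_sum => // i _.
  have iN : (i <= N)%N by exact: ltnW.
  have -> : u ^+ N * (p`_i * u^-1 ^+ i) = p`_i * u ^+ (N - i).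
    by rewrite -{1}(subnK iN) exprD mulrCA exprVn mulfK ?expf_neq0.
  by apply: kalgM => //; exact: kalgX.
have := kalgB kV h2 (h1 N); by rewrite opprB addrCA subrr addr0.
Qed.

Let E y n := exists p : {poly F}, [/\ forall i, V p`_i, (size p <= n.+1)%N & f^-1 * p.[y] = 1].

(** The shortening step of Chevalley's extension theorem. [E y n] says that f^-1 generates the unit
    ideal of V[y], by an expression of degree at most n. In the relation for y^-1 the constant term
    is moved to the other side and makes up the unit u; the relation then expresses the top power of
    y through lower ones. *)
Lemma maximal_step y n m : y != 0 -> (m <= n.+1)%N -> E y n.+1 -> E y^-1 m -> E y n.
Proof.
move=> y0 mn [p [pV ps pE]] [r [rV rs rE]].
have [u0 Vu] := maximal_unit (rV 0%N); set u := 1 - _ in u0 Vu.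
pose c := u^-1 * f^-1 * p`_n.+1.
have Vc : V c by apply: kalgM => //; apply: kalgM.
exists (\poly_(i < n.+1) (p`_i + c * r`_(n.+1 - i))); split.
- move=> i; rewrite coef_poly; case: ifP => _; last exact: kalg0.
  by apply: kalgD => //; apply: kalgM.
- exact: size_poly.
rewrite horner_poly.
under eq_bigr do rewrite mulrDl -mulrA.
rewrite big_split -mulr_sumr /=.
rewrite (horner_coef_wide _ ps) big_ord_recr /= in pE.
rewrite (horner_coef_wide (n := n.+2)) in rE; last by apply: leq_trans rs _; rewrite ltnS.
rewrite big_ord_recl /= expr0 mulr1 in rE.
set P := \sum_(i < n.+1) _ in pE *; set Q := \sum_(i < n.+1) _ * _.
set R := \sum_(i < n.+1) _ in rE *.
have -> : Q = R * y ^+ n.+1.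
  rewrite /Q (reindex_inj rev_ord_inj) mulr_suml; apply: eq_bigr => i _ /=.
  rewrite /bump leq0n add1n.
  have i_n : (i <= n)%N by rewrite -ltnS.
  rewrite subKn // -mulrA; congr (_ * _).
  by rewrite exprVn mulrC; apply: expfB_cond; rewrite (negPf y0) add0n.
have fR : f^-1 * R = u by rewrite /u -rE mulrDr addrAC subrr add0r.
rewrite -pE !mulrDr; congr (_ + _).
have -> : f^-1 * (c * (R * y ^+ n.+1)) = (f^-1 * R) * c * y ^+ n.+1 by ring.
by rewrite fR /c -!mulrA mulVKf.
Qed.

(** If neither y nor y^-1 were in V, the longer of their two relations could always be shortened,
    down to degree 0, which would put f in V. *)
Lemma maximal_valuation y : y != 0 -> V y \/ V y^-1.
Proof.
move=> y0; apply: contrapT => /not_orP[Vy Vy'].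
have init w : ~ V w -> exists n, E w n.
  move=> /maxV[p pV fE]; exists (size p); exists p; split=> //.
  by rewrite -fE mulVf.
have [n En] := init _ Vy; have [m Em] := init _ Vy'.
have noE0 w : ~ E w 0.
  move=> [p [pV ps]]; rewrite (size1_polyC ps) hornerC => h; apply: Vf.
  by rewrite -[f]mulr1 -h mulVKf.
have : exists N, (n + m <= N)%N by exists (n + m)%N.
case=> N; elim: N n m En Em => [|N IH] n m En Em nm.
  have n0 : n = 0%N by lia.
  by move: En; rewrite n0; exact: noE0.
have [mn|nm'] := leqP m n.
  case: n => [|n] in En nm mn; first exact: noE0 En.
  by apply: (IH n m (maximal_step y0 mn En Em) Em); lia.
case: m => [|m] in Em nm nm'; first exact: noE0 Em.
have Em' : E y^-1 m.
  by apply: (@maximal_step _ m n) Em _; rewrite ?invr_eq0 ?invrK // ltnW.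
by apply: (IH n m En Em'); lia.
Qed.
End Maximal.

Section ValuationRing.
Context (V : set F) (kV : kalg V) (f : F) (Vf : ~ V f).
Hypothesis valV : forall y, y != 0 -> V y \/ V y^-1.

Let unit u := [/\ u != 0, V u & V u^-1].
Let nonunit u := [/\ u != 0, V u & ~ V u^-1].

Let f0 : f != 0. Proof. by apply: contra_notN Vf => /eqP ->; exact: kalg0. Qed.

Lemma vring_local y : nonunit y -> unit (1 - y).
Proof.
move=> [y0 Vy Vy'].
have y1 : 1 - y != 0.
  by apply: contra_notN Vy'; rewrite subr_eq0 => /eqP <-; rewrite invr1; exact: kalg1.
split=> //; first by apply: kalgB => //; exact: kalg1.
have [] := valV (y := y / (1 - y)); first by rewrite mulf_neq0 ?invr_eq0.
  move=> h; have -> : (1 - y)^-1 = 1 + y / (1 - y) by field.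
  by apply: kalgD => //; exact: kalg1.
rewrite invfM invrK mulrBr mulr1 mulVf // => h; case: Vy'.
by rewrite -[y^-1](subrK 1); apply: kalgD => //; exact: kalg1.
Qed.

Lemma vring_index a : a != 0 -> V a -> exists N, has_index V [set a * b | b in V] N.
Proof.
move=> a0 Va; have [B hB] := growth_bound a0.
have sV := kalg_subgroup kV.
have saV : subgroup [set a * b | b in V].
  split=> [|_ _ [b Vb <-] [c Vc <-]]; first by exists 0; rewrite ?mulr0 //; exact: kalg0.
  by exists (b - c); rewrite ?mulrBr //; exact: kalgB.
have [N e Ve ei|N _ iN] := idx_bounded (W := V) (B := B) saV; last by exists N.
rewrite -[N]card_ord; apply: (hB V _ e) => // g Vg; exact: kalgM.
Qed.

Let I a : set F := [set a * b | b in V].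

Let I_subgroup a : subgroup (I a).
Proof.
split=> [|_ _ [b Vb <-] [c Vc <-]]; first by exists 0; rewrite ?mulr0 //; exact: kalg0.
by exists (b - c); rewrite ?mulrBr //; exact: kalgB.
Qed.

Let I_sub a : V a -> I a `<=` V.
Proof. by move=> Va _ [b Vb <-]; exact: kalgM. Qed.

(** Finite indices replace a Noetherian argument: p is a nonunit with V / pV of least cardinality.
    If p^-1 b is not in V, then pV lies in bV, and minimality forces the two to be equal. *)
Lemma vring_uniformizer : exists2 p, nonunit p & forall b, nonunit b -> V (p^-1 * b).
Proof.
pose P N := `[< exists2 p, nonunit p & has_index V (I p) N >].
have exP : exists N, P N.
  have nf : nonunit f^-1.
    rewrite /nonunit invr_eq0 invrK; split=> //.
    by case: (valV f0) => // /Vf.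
  have [|//|N iN] := @vring_index f^-1; rewrite ?invr_eq0 //; first by case: nf.
  by exists N; apply/asboolP; exists f^-1.
case: (ex_minnP exP) => N /asboolP[p np iN] minN; exists p => // b nb.
have [p0 Vp Vp'] := np; have [b0 Vb Vb'] := nb.
apply: contrapT => Vpb.
have Vbp : V (b^-1 * p).
  have [||//] := valV (y := p^-1 * b); first by rewrite mulf_neq0 ?invr_eq0.
    by move/Vpb.
  by rewrite invfM invrK mulrC.
have pb : I p `<=` I b.
  move=> _ [c Vc <-]; exists (b^-1 * p * c); first exact: kalgM.
  by rewrite -mulrA mulVKf.
have sV := kalg_subgroup kV.
have [M _ iM] := idx_sub (I_subgroup p) iN (I_sub Vb).
have [Nb _ iNb] := idx_quo (I_subgroup p) (I_subgroup b) iN pb.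
have NE := idx_uniq (I_subgroup p) iN (idx_tower sV (I_subgroup b) pb (I_sub Vb) iNb iM).
have NNb : (N <= Nb)%N by apply: minN; apply/asboolP; exists b.
have N0 : (0 < N)%N.
  by case: iN => e [_ _ /(_ 0 (kalg0 kV))[[m mN] _]]; apply: leq_ltn_trans mN.
have M1 : M = 1%N by nia.
rewrite M1 in iM; have := idx1 iM (I_subgroup _) (I_subgroup _) pb => Ibp.
have : I b b by exists 1; rewrite ?mulr1 //; exact: kalg1.
rewrite Ibp => -[c Vc bE]; apply: Vpb.
by rewrite -bE mulKf.
Qed.

Context (p : F) (np : nonunit p) (pV : forall b, nonunit b -> V (p^-1 * b)).

Let p0 : p != 0. Proof. by case: np. Qed.
Let Vp : V p. Proof. by case: np. Qed.

Let unitM a b : unit a -> unit b -> unit (a * b).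
Proof.
move=> [a0 Va Va'] [b0 Vb Vb']; split; first by rewrite mulf_neq0.
  exact: kalgM.
by rewrite invfM; exact: kalgM.
Qed.

Let unitV a : unit a -> unit a^-1.
Proof. by move=> [a0 Va Va']; split; rewrite ?invrK ?invr_eq0. Qed.

Let unitP a : a != 0 -> V a -> unit a \/ nonunit a.
Proof. by move=> a0 Va; have [Va'|Va'] := pselect (V a^-1); [left | right]. Qed.

Let pX_nonunit i : ~ V (p^-1 ^+ i.+1).
Proof.
move=> h; case: np => _ _; apply.
have -> : p^-1 = p^-1 ^+ i.+1 * p ^+ i.
  by rewrite exprS -mulrA -exprMn mulVf // expr1n mulr1.
by apply: kalgM => //; exact: kalgX.
Qed.

(** As long as [a * p^-1 ^+ n] is in V, the powers p^i with i < n are incongruent modulo aV, so n is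
    at most the index of aV. At the largest such n the quotient is a unit. *)
Lemma vring_factor a : a != 0 -> V a -> exists n, unit (a * p^-1 ^+ n).
Proof.
move=> a0 Va; have [N iN] := vring_index a0 Va.
pose P n := `[< V (a * p^-1 ^+ n) >].
have exP : exists n, P n by exists 0%N; apply/asboolP; rewrite expr0 mulr1.
have ubP n : P n -> (n <= N)%N.
  move=> /asboolP Van.
  have := idx_ge (e := fun i : 'I_n => p ^+ i) (I_subgroup a) iN; rewrite card_ord; apply.
    by move=> i; exact: kalgX.
  have key (i j : 'I_n) : (i < j)%N -> ~ I a (p ^+ i - p ^+ j).
    move=> ij [b Vb eq].
    have nu : nonunit (p ^+ (j - i)).
      rewrite /nonunit expf_neq0 //; split=> //; first exact: kalgX.
      by rewrite -(prednK (_ : 0 < j - i)%N) ?subn_gt0 // -exprVn; exact: pX_nonunit.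
    have [u0 Vu Vu'] := vring_local nu.
    have pE : p ^+ i * (1 - p ^+ (j - i)) = a * b.
      by rewrite mulrBr mulr1 -exprD subnKC // ltnW.
    apply: (@pX_nonunit (n - i).-1); rewrite prednK ?subn_gt0 ?(ltn_trans ij) //.
    have -> : p^-1 ^+ (n - i) = (a * p^-1 ^+ n) * (b * (1 - p ^+ (j - i))^-1).
      have -> : (a * p^-1 ^+ n) * (b * (1 - p ^+ (j - i))^-1) =
          (a * b) * (1 - p ^+ (j - i))^-1 * p^-1 ^+ n by ring.
      by rewrite -pE mulfK //; apply: exprVB; rewrite ?(ltnW (ltn_trans ij (ltn_ord j))).
    by apply: kalgM => //; exact: kalgM.
  move=> i j; case: (ltngtP i j) => [ij|ji|/val_inj //].
    by move/(key _ _ ij).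
  by move/(subgroupC (I_subgroup a)) /(key _ _ ji).
case: (ex_maxnP exP ubP) => n /asboolP Van maxn; exists n.
have an0 : a * p^-1 ^+ n != 0 by rewrite mulf_neq0 // expf_neq0 // invr_eq0.
have [//|/pV h] := unitP an0 Van.
suff /maxn : P n.+1 by rewrite ltnn.
by apply/asboolP; rewrite exprS mulrCA.
Qed.

Lemma vring_place : exists x : place X, x f < 0.
Proof.
have /choice[v0 v0P] : forall a, exists n : int, a != 0 -> unit (a * p ^ (- n)).
  move=> a; have [->|a0] := eqVneq a 0; first by exists 0.
  have [Va|Va] := valV a0.
    by have [n un] := vring_factor a0 Va; exists n => _; rewrite -invr_expz -exprnP -exprVn.
  have [|n un] := vring_factor _ Va; first by rewrite invr_eq0.
  exists (- n%:Z) => _; rewrite opprK; move: un => /unitV.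
  by rewrite invfM invrK exprVn invrK.
pose v a : int := if a == 0 then 0 else v0 a.
have vP a : a != 0 -> unit (a * p ^ (- v a)) by move=> a0; rewrite /v (negPf a0); exact: v0P.
have unit_pX (n : int) : unit (p ^ n) -> n = 0.
  case: n => [[//|n]|n] [_ h1 h2].
    by case: (@pX_nonunit n); move: h2; rewrite -exprnP -exprVn.
  by case: (@pX_nonunit n); move: h1; rewrite NegzE -exprnN exprVn.
have vE a n : a != 0 -> unit (a * p ^ (- n)) -> v a = n.
  move=> a0 un; apply/eqP; rewrite -subr_eq0; apply/eqP; apply: unit_pX.
  have -> : p ^ (v a - n) = (a * p ^ (- n)) * (a * p ^ (- v a))^-1.
    rewrite invfM mulrACA mulfV // mul1r invr_expz opprK addrC expfzDr //.
  by apply: unitM => //; apply: unitV; exact: vP.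
have unit1 : unit 1 by split; rewrite ?oner_neq0 ?invr1 //; exact: kalg1.
have vM a b : a != 0 -> b != 0 -> v (a * b) = v a + v b.
  move=> a0 b0; apply: vE; first by rewrite mulf_neq0.
  by rewrite opprD expfzDr // mulrACA; apply: unitM; exact: vP.
have vp (n : int) : v (p ^ n) = n.
  by apply: vE; rewrite ?expfz_neq0 // -expfzDr // subrr.
have vge0 a : a != 0 -> V a -> 0 <= v a.
  move=> a0 Va; rewrite leNgt; apply/negP => va.
  suff /unit_pX va0 : unit (p ^ (v a)) by rewrite va0 in va.
  split; first exact: expfz_neq0.
    have -> : p ^ (v a) = a * (a * p ^ (- v a))^-1.
      by rewrite invfM mulVKf // invr_expz opprK.
    by apply: kalgM => //; case: (vP a a0).
  rewrite invr_expz; case: (v a) va => n //.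
  by rewrite NegzE opprK => _; exact: kalgX.
have geV0 a : a != 0 -> 0 <= v a -> V a.
  move=> a0 va; have -> : a = (a * p ^ (- v a)) * p ^ (v a).
    by rewrite -mulrA -expfzDr // addNr mulr1.
  apply: kalgM => //; first by case: (vP a a0).
  by case: (v a) va => n // _; exact: kalgX.
have v1 : v 1 = 0 by apply: vE; rewrite ?oner_neq0 // oppr0 expr0z mulr1.
have dv : is_dval v.
  split=> //.
  - by rewrite /v eqxx.
  - move=> a b a0 b0 ab0; set n := Num.min _ _.
    have na : n <= v a by rewrite /n ge_min lexx.
    have nb : n <= v b by rewrite /n ge_min lexx orbT.
    have vn c : c != 0 -> v (c * p ^ (- n)) = v c - n.
      by move=> c0; rewrite vM ?expfz_neq0 // vp.
    have Vn c : c != 0 -> n <= v c -> V (c * p ^ (- n)).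
      by move=> c0 nc; apply: geV0; rewrite ?vn ?subr_ge0 // mulf_neq0 // expfz_neq0.
    rewrite -subr_ge0 -vn //; apply: vge0; first by rewrite mulf_neq0 ?expfz_neq0.
    by rewrite mulrDl; apply: kalgD => //; exact: Vn.
  - by exists p => //; have := vp 1.
have vc c : c != 0 -> v (Defs.cst X c) = 0.
  move=> c0; apply: vE; rewrite ?fmorph_eq0 //.
  rewrite oppr0 expr0z mulr1; case: kV => h _ _.
  by split; rewrite ?fmorph_eq0 // -fmorphV.
exists (Place dv vc) => /=; rewrite ltNge; apply/negP => /(geV0 _ f0); exact: Vf.
Qed.
End ValuationRing.

(** The ring k[f^-1] misses f because f is transcendental. A subring maximal among those containing
    it and missing f is a discrete valuation ring, at which f has a pole. *)
Lemma transcendental_pole f : (forall p : {poly k}, (map_poly (Defs.cst X) p).[f] = 0 -> p = 0) ->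
  exists x : place X, x f < 0.
Proof.
move=> tf.
have f0 : f != 0 by exact: (t_neq0 tf).
pose B0 : set F := [set s | exists p : {poly k}, s = (map_poly (Defs.cst X) p).[f^-1]].
have kB0 : kalg B0.
  split=> [c|_ _ [p ->] [r ->]|_ _ [p ->] [r ->]].
  - by exists c%:P; rewrite map_polyC hornerC.
  - by exists (p - r); rewrite rmorphB hornerD hornerN.
  - by exists (p * r); rewrite rmorphM hornerM.
have B0z : B0 f^-1 by exists 'X; rewrite map_polyX hornerX.
have B0f : ~ B0 f.
  move=> [p fE]; pose n := size p.
  (* If f = p(f^-1), then f^(n+1) = f^n p(f^-1) is the value at f of this reversed polynomial of
     degree at most n. *)
  pose r : {poly k} := \sum_(i < n) p`_i *: 'X^(n - i).
  have rf : pev f r = f ^+ n * (map_poly (Defs.cst X) p).[f^-1].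
    rewrite /pev rmorph_sum horner_sum horner_coef mulr_sumr.
    have -> : size (map_poly (Defs.cst X) p) = n by rewrite size_map_poly.
    apply: eq_bigr => i _; rewrite /= map_polyZ map_polyXn hornerZ hornerXn coef_map.
    rewrite mulrCA exprVn; congr (_ * _).
    by apply: expfB_cond; rewrite (negPf f0) add0n ltnW.
  have /tf : pev f ('X^(n.+1) - r) = 0.
    by rewrite pevB pevXn rf -fE -exprSr subrr.
  move=> /(congr1 (fun s : {poly k} => s`_n.+1)).
  rewrite coefB coefXn eqxx coef0 coef_sum big1 ?subr0; first by move/eqP; rewrite oner_eq0.
  move=> i _; rewrite coefZ coefXn; case: eqP => [eq|_]; last by rewrite mulr0.
  by have := leq_subr i n; rewrite -eq ltnn.
have [V [kV BV Vf maxV]] := maximal_kalg kB0 B0f.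
have Vz := BV _ B0z.
have valV := maximal_valuation kV Vf Vz maxV.
have [p np pV] := vring_uniformizer kV Vf valV.
exact: (vring_place kV Vf valV np pV).
Qed.

(** The minimal polynomial of f over k stays irreducible over F by geometric irreducibility; having
    the root f there, it is linear. *)
Lemma algebraic_cst (f : F) (p : {poly k}) : p != 0 -> (map_poly (Defs.cst X) p).[f] = 0 ->
  exists c, f = Defs.cst X c.
Proof.
move=> p0 pf.
pose P n := `[< exists r : {poly k}, [/\ r != 0, (map_poly (Defs.cst X) r).[f] = 0 & size r = n] >].
have exP : exists n, P n by exists (size p); apply/asboolP; exists p.
case: (ex_minnP exP) => n /asboolP[r [r0 rf rn]] minn.
have min_le s : s != 0 -> (map_poly (Defs.cst X) s).[f] = 0 -> (size r <= size s)%N.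
  by move=> s0 sf; rewrite rn; apply: minn; apply/asboolP; exists s.
have r1 : (1 < size r)%N.
  rewrite ltnNge; apply/negP => /size1_polyC rE; move: rf r0.
  by rewrite rE map_polyC hornerC polyC_eq0 => /eqP; rewrite fmorph_eq0 => ->.
have irr : irreducible_poly r.
  split=> // s s1 sr; have /dvdpP[u uE] := sr.
  have us0 : u * s != 0 by rewrite -uE.
  have [u0 s0] : u != 0 /\ s != 0 by move: us0; rewrite mulf_eq0 negb_or => /andP.
  have : pev f (u * s) = 0 by rewrite -uE.
  rewrite pevM => /eqP; rewrite mulf_eq0 => /orP[/eqP uf|/eqP sf].
    have h1 := min_le u u0 uf.
    have h2 : (size u + size s).-1 = size r by rewrite -size_mul // -uE.
    have h3 : (0 < size s)%N by rewrite size_poly_gt0.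
    have h4 : (0 < size u)%N by rewrite size_poly_gt0.
    by move/eqP: s1 h1 h2 h3 h4; move: (size u) (size s) (size r) => a b c; lia.
  have := min_le s s0 sf => rs; rewrite -dvdp_size_eqp // eqn_leq rs andbT.
  exact: dvdp_leq.
have [irr1 irr2] := @ff_geom _ X _ irr.
have := irr2 ('X - f%:P); rewrite size_XsubC dvdp_XsubCl => /(_ isT).
rewrite /root rf eqxx => /(_ isT) /eqp_size; rewrite size_XsubC size_map_poly => r2.
have := rf; rewrite horner_coef size_map_poly -r2 big_ord_recl big_ord1 /= !coef_map /=.
rewrite expr0 mulr1 expr1 => /eqP; rewrite addrC addr_eq0 => /eqP h.
have l0 : r`_1 != 0 by rewrite -lead_coef_eq0 lead_coefE -r2 in r0.
exists (- r`_0 / r`_1); rewrite fmorph_div rmorphN.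
apply: (mulfI (x := Defs.cst X r`_1)); first by rewrite fmorph_eq0.
by rewrite h mulrCA mulfV ?mulr1 // fmorph_eq0.
Qed.

Lemma ev_integral_cst (f : F) : (forall x : place X, vge x 0 f) -> exists c, f = Defs.cst X c.
Proof.
move=> intf; have [[p pf p0]|np] := pselect (exists2 p : {poly k},
  (map_poly (Defs.cst X) p).[f] = 0 & p != 0); first exact: algebraic_cst p0 pf.
have [|x xf] := transcendental_pole (f := f).
  by move=> p pf; apply/eqP/negPn/negP => p0; apply: np; exists p.
have := intf x; rewrite vgeE; first by rewrite leNgt xf.
by apply: contraTneq xf => ->; rewrite dval0 //; exact: ord_dval.
Qed.

Lemma place_inhabited : exists x : place X, True.
Proof.
have [t [n [e [tt sp _]]]] := ff_generator X.
by have [x _] := transcendental_pole tt; exists x.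
Qed.
End Poles.

Lemma dim_functional (K : fieldType) (L : nzRingType) (sc : {rmorphism K -> L}) (V : lmodType L)
    (W U : set V) d : ksubspace sc U -> ksubspace sc W -> U `<=` W -> is_dim sc W U d.+1 ->
  exists om : V -> K, [/\ forall a b, W a -> W b -> om (a - b) = om a - om b,
    forall c a, W a -> om (sc c *: a) = c * om a,
    forall a, U a -> om a = 0 & exists2 a, W a & om a = 1].
Proof.
move=> sU sW UW [e [We he]].
have /choice[c cP] : forall w, exists c : {ffun 'I_d.+1 -> K}, W w -> U (w - \sum_i sc (c i) *: e i).
  move=> w; have [Ww|nW] := pselect (W w); last by exists [ffun=> 0].
  by have [c [Uc _]] := he w Ww; exists c.
have cE w (c' : 'I_d.+1 -> K) : W w -> U (w - \sum_i sc (c' i) *: e i) -> forall i, c w i = c' i.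
  move=> Ww Uw i; have [c0 [_ cu]] := he w Ww.
  rewrite -(cu (c w) (cP w Ww)) (cu [ffun i => c' i]) ?ffunE //.
  by under eq_bigr do rewrite ffunE.
exists (fun w => c w ord0); split.
- move=> a b Wa Wb.
  apply: (cE _ (fun i => c a i - c b i)); first exact: subgroupB sW.1 Wa Wb.
  have := subgroupB sU.1 (cP a Wa) (cP b Wb); congr (U _).
  have -> : \sum_i sc (c a i - c b i) *: e i = \sum_i sc (c a i) *: e i - \sum_i sc (c b i) *: e i.
    by rewrite -sumrB; apply: eq_bigr => i _; rewrite rmorphB scalerBl.
  by rewrite !opprB addrACA [RHS]addrACA [- _ - b]addrC.
- move=> x a Wa; apply: (cE _ (fun i => x * c a i)); first exact: sW.2.
  have := sU.2 x _ (cP a Wa); congr (U _); rewrite scalerBr scaler_sumr.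
  by congr (_ - _); apply: eq_bigr => i _; rewrite scalerA -rmorphM.
- move=> a Ua; apply: (cE _ (fun=> 0)); first exact: UW.
  by rewrite big1 ?subr0 // => i _; rewrite rmorph0 scale0r.
- exists (e ord0) => //; rewrite (cE _ (fun i => (i == ord0)%:R)) ?eqxx //.
  rewrite (bigD1 ord0) //= rmorph1 scale1r big1 ?addr0 ?subrr; first exact: subgroup0 sU.1.
  by move=> i /negPf ->; rewrite rmorph0 scale0r.
Qed.

(** * The Riemann-Roch theorem *)

Section RiemannRoch.
Context (k : finFieldType) (X : curve k).
Local Notation F := (ff X).
Local Notation q := #|k|.
Local Notation V := (place X -> F^o).
Implicit Types (x y : place X) (f : F) (D : place X -> int) (r : V).

Definition rep : set V := [set r | almost_all (fun x : place X => vge x 0 (r x))].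
Definition glob : set V := [set r | exists f, r = fun=> f].

Lemma rep_subspace : ksubspace (Defs.cst X) rep.
Proof.
split; last first.
  move=> c r; apply: almost_allW => x rx; apply: vge_mul0 => //; [exact: ord_dval | exact: vge_cst].
split=> [|a b ra rb]; first by apply: almost_allT => x; exact: vge_0.
by apply: almost_allW (almost_allI ra rb) => x [? ?]; apply: vge_sub => //; exact: ord_dval.
Qed.

Lemma glob_subspace : ksubspace (Defs.cst X) glob.
Proof.
split; last by move=> c _ [f ->]; exists (Defs.cst X c * f).
split=> [|_ _ [f ->] [g ->]]; first by exists 0.
by exists (f - g).
Qed.

Lemma addset_subspace (A B : set V) : ksubspace (Defs.cst X) A -> ksubspace (Defs.cst X) B ->
  ksubspace (Defs.cst X) (addset A B).
Proof.
move=> [sA zA] [sB zB]; split; first exact: addset_subgroup.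
move=> c _ [a [b [Aa Bb ->]]]; exists (Defs.cst X c *: a), (Defs.cst X c *: b).
by rewrite scalerDr; split; auto.
Qed.

Lemma glob_rep : glob `<=` rep.
Proof.
move=> _ [f ->]; have := ord_finite f; apply: almost_allW => x xf.
by have [->|f0] := eqVneq f 0; [exact: vge_0 | rewrite vgeE // xf].
Qed.

Lemma box_rep D : fsupp D -> box D `<=` rep.
Proof. by move=> fD r Dr; apply: almost_allW fD => x Dx; have := Dr x; rewrite Dx. Qed.

Lemma cospace_rep D : fsupp D -> addset glob (box D) `<=` rep.
Proof.
move=> fD _ [a [b [/glob_rep ra /(box_rep fD) rb ->]]].
exact: subgroupD rep_subspace.1 ra rb.
Qed.

Lemma rep_bounded N (r : 'I_N -> V) : (forall i, rep (r i)) ->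
  exists D, [/\ fsupp D, forall x, D x <= 0 & forall i, box D (r i)].
Proof.
elim: N r => [|N IH] r rr.
  by exists (fun=> 0); split=> //; [exact: almost_allT | case].
have [D [fD D0 Dr]] := IH (fun i => r (lift ord0 i)) (fun i => rr _).
exists (fun x => Num.min (D x) (if vge x 0 (r ord0 x) then 0 else x (r ord0 x))); split.
- by apply: almost_allW (almost_allI fD (rr ord0)) => x [-> ->].
- by move=> x; rewrite ge_min D0.
- move=> i x; case: (unliftP ord0 i) => [j ->|->].
    by apply: vge_trans (Dr j x); rewrite ge_min lexx.
  case: ifPn => [h|_]; first by apply: vge_trans h; rewrite ge_min lexx orbT.
  have [->|r0] := eqVneq (r ord0 x) 0; first exact: vge_0.
  by rewrite vgeE // ge_min lexx orbT.
Qed.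

Lemma global_constants : has_index (glob `&` box (fun=> 0)) [set 0] q.
Proof.
apply: (idx_card (e := fun (c : k) => (fun=> Defs.cst X c) : V)).
- by move=> c; split; [exists (Defs.cst X c) | move=> x; exact: vge_cst].
- move=> c c' eq; apply: (fmorph_inj (Defs.cst X)).
  have [x _] := place_inhabited X; apply/eqP; rewrite -subr_eq0; apply/eqP.
  exact: (congr1 (fun r : V => r x) eq).
- move=> _ [[f ->] intf]; have [c ->] := ev_integral_cst intf.
  by exists c; apply/funext => x; rewrite !fctE subrr.
Qed.

Section Finiteness.
Context (t : F) (n : nat) (e : 'I_n -> F).
Hypothesis t_transc : forall p : {poly k}, (map_poly (Defs.cst X) p).[t] = 0 -> p = 0.
Hypothesis e_spans : spans t e.
Hypothesis e_indep : forall p : 'I_n -> {poly k},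
  \sum_i pev t (p i) * e i = 0 -> forall i, p i = 0.

Lemma clear_poles D : fsupp D -> exists2 p, p != 0 &
  forall x, vge x 0 t -> D x <= x (pev t p).
Proof.
move=> /fsupp_seq[s us Ds].
have /choice[g gP] : forall x, exists p, p != 0 /\ (vge x 0 t -> 0 < x (pev t p)).
  move=> x; have [xt|nt] := boolP (vge x 0 t); last by exists 1; rewrite oner_neq0.
  by have [p p0 xp] := place_poly t_transc e_spans xt; exists p.
have g0 y : g y != 0 by case: (gP y).
have ge0 x p : vge x 0 t -> p != 0 -> 0 <= x (pev t p).
  by move=> xt p0; have := pev_int p xt; rewrite vgeE // pev_eq0.
have gs0 s' : \prod_(y <- s') g y ^+ `|D y|%N != 0.
  by rewrite prodf_seq_neq0; apply/allP => y _; rewrite expf_neq0.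
exists (\prod_(y <- s) g y ^+ `|D y|%N) => //.
move=> x xt; have dx := ord_dval x.
have [xs|xs] := boolP (x \in s); last first.
  by rewrite Ds // ge0.
rewrite (big_rem x xs) /= pevM dvalM ?pev_eq0 ?expf_neq0 //.
have h1 : 0 <= x (pev t (\prod_(y <- rem x s) g y ^+ `|D y|%N)).
  by apply: ge0.
rewrite pev_exp dvalX ?pev_eq0 // -[D x]addr0; apply: lerD h1.
have := (gP x).2 xt; move: (x _) (D x) => a b; nia.
Qed.

Lemma pole_pev x p : x t < 0 -> p != 0 -> x (pev t p) = (size p).-1%:Z * x t.
Proof.
move=> xt p0; have dx := ord_dval x; have t0 := t_neq0 t_transc.
rewrite /pev horner_coef size_map_poly; have sp : (0 < size p)%N by rewrite size_poly_gt0.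
rewrite -(prednK sp) big_ord_recr /= addrC.
have lc0 : Defs.cst X (lead_coef p) != 0 by rewrite fmorph_eq0 lead_coef_eq0.
have topE : x (Defs.cst X (lead_coef p) * t ^+ (size p).-1) = (size p).-1%:Z * x t.
  by rewrite dvalM ?expf_neq0 // ord_cst ?lead_coef_eq0 // add0r dvalX.
rewrite coef_map -lead_coefE -topE.
apply: (dval_domin dx _ _).2; first by rewrite mulf_neq0 ?expf_neq0.
rewrite topE; apply: vge_sum => // i _; rewrite coef_map; apply: vge_mul0 => //; first exact: vge_cst.
rewrite vgeE ?expf_neq0 // dvalX //.
by have := ltn_ord i; move: xt; move: (x t) (size p).-1 (nat_of_ord i) => a b c; nia.
Qed.

(* A multiple of the basis [e] of F over k(t) is integral away from the poles of [t];
   its multiples by polynomials in [t] supply enough sections of [box D'] to absorb, up to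
   a bounded factor, any finite family of adeles. *)
Lemma finite_cokernel : exists N, has_index rep (addset glob (box (fun=> 0))) N.
Proof.
have t0 := t_neq0 t_transc; have s0 := box_subgroup (X := X) (fun=> 0).
have sg := glob_subspace.1.
have [De [fDe De0 Dee]] := rep_bounded (r := fun i => (fun=> e i) : V) (fun i => glob_rep (ex_intro _ (e i) erefl)).
have fNDe : fsupp (fun x => - De x) by apply: (fsupp_op (op := -%R)); rewrite ?oppr0.
have [pe pe0 peP] := clear_poles fNDe.
pose e' i := pev t pe * e i.
have e'int x i : vge x 0 t -> vge x 0 (e' i).
  move=> xt; have dx := ord_dval x; have := peP x xt; have := Dee i x => /= h1 h2.
  rewrite /e' vge_mull ?pev_eq0 //; apply: vge_trans h1; rewrite sub0r; lia.
have tV0 : t^-1 != 0 by rewrite invr_eq0.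
have /finite_seqP[s0' s0E] := zeros_finite (X := X) tV0.
pose sI := undup s0'; have usI : uniq sI by exact: undup_uniq.
have sIP x : (x \in sI) = (x t < 0).
  have -> : (x t < 0) = (0 < x t^-1) by rewrite dvalV ?oppr_gt0 //; exact: ord_dval.
  rewrite /sI mem_undup; apply/idP/idP => xs.
    by have : [set` s0'] x by []; rewrite -s0E.
  by have : [set x : place X | 0 < x t^-1] x by []; rewrite s0E.
pose C := (\sum_(x <- sI) \sum_i `|x (e' i)|)%N.
have CP x i : x t < 0 -> vge x (C%:Z * x t) (e' i).
  move=> xt; have dx := ord_dval x; have [->|ei0] := eqVneq (e' i) 0; first exact: vge_0.
  rewrite vgeE //; have xs : x \in sI by rewrite sIP.
  have : (`|x (e' i)| <= C)%N by rewrite /C (big_rem x xs) /= (bigD1 i) //= -addnA leq_addr.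
  nia.
have [N e0 re ei|N _ iN] := idx_bounded (W := rep) (U := addset glob (box (fun=> 0)))
  (B := (q ^ (n * C).+1)%N) (addset_subgroup sg s0); last by exists N.
have [D [fD D0 De0']] := rep_bounded re.
have fND : fsupp (fun x => - D x) by apply: (fsupp_op (op := -%R)); rewrite ?oppr0.
have [p p0 pP] := clear_poles fND.
pose d := (size p).-1.
pose m := (C + \sum_(x <- sI) `|D x|)%N.
(* Minus the zeros of p where t is integral, and m times the order of t at its poles: low enough for
   every [e0 i] to lie in its box, and explicit enough for its degree to be bounded by n d + n m. *)
pose D' x : int := if x t < 0 then m%:Z * x t else - x (pev t p).
have tge x : ~~ (x t < 0) -> vge x 0 t by rewrite -leNgt => xt; rewrite vgeE.
have p0' : pev t p != 0 by rewrite pev_eq0.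
have D'D x : D' x <= D x.
  rewrite /D'; case: ifPn => xt; last by have := pP x (tge x xt); lia.
  have xs : x \in sI by rewrite sIP.
  have : (`|D x| <= m)%N by rewrite /m (big_rem x xs) /= addnCA leq_addr.
  by have := D0 x; nia.
have D'0 x : D' x <= 0 by exact: le_trans (D'D x) (D0 x).
have fD' : fsupp D'.
  apply: almost_allW (almost_allI (ord_finite t) (ord_finite (pev t p))) => x [xt xp].
  by rewrite /D' xt ltxx xp oppr0.
have /finite_seqP[sp spE] := zeros_finite (X := X) p0'.
pose sP := [seq x : place X <- undup sp | ~~ (x t < 0)].
have uP : uniq sP by rewrite filter_uniq // undup_uniq.
have sPP x : x \in sP -> 0 < x (pev t p).
  rewrite mem_filter mem_undup => /andP[_ xs].
  by have : [set` sp] x by []; rewrite -spE.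
have [S iS SE] := idx_box_le fD' (fsupp0 X) D'0.
have SdE : (S <= n * d + n * m)%N.
  rewrite -lez_nat SE dg0 sub0r.
  rewrite (dgE (s := sI ++ sP)); first last.
  - move=> x; rewrite mem_cat negb_or sIP mem_filter mem_undup => /andP[xt].
    rewrite xt /= /D' (negPf xt) => xs; have := pev_int p (tge x xt); rewrite vgeE // => ge0.
    have : ~ (0 < x (pev t p)).
      by move=> h; move/negP: xs; apply; have : [set x : place X | 0 < x (pev t p)] x by []; rewrite spE.
    by move: ge0; case: ltgtP => // <-; rewrite oppr0.
  - rewrite cat_uniq usI uP andbT /=; apply/hasPn => x; rewrite mem_filter => /andP[xt _].
    by rewrite /= sIP.
  rewrite big_cat /= opprD.
  have h1 : - (\sum_(x <- sI) (degp x)%:Z * D' x) <= (n * m)%:Z.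
    have := zeros_degree t_transc e_spans tV0 (good_inv t_transc e) usI.
    have sIV x : x \in sI -> 0 < x t^-1.
      by rewrite sIP dvalV ?oppr_gt0 //; exact: ord_dval.
    move=> /(_ sIV); rewrite muln1 -lez_nat (big_morph Posz PoszD (erefl _)) => h.
    have -> : - (\sum_(x <- sI) (degp x)%:Z * D' x) =
        m%:Z * (\sum_(x <- sI) (`|x t^-1| * degp x)%N%:Z).
      rewrite mulr_sumr -sumrN big_seq [RHS]big_seq; apply: eq_bigr => x xs.
      have xt : x t < 0 by rewrite -sIP.
      have := sIV x xs; rewrite dvalV; last exact: ord_dval.
      by rewrite /D' xt PoszM; nia.
    by rewrite mulnC PoszM; apply: ler_wpM2l.
  have h2 : - (\sum_(x <- sP) (degp x)%:Z * D' x) <= (n * d)%:Z.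
    have gp : good t e (pev t p) d by apply: good_poly; rewrite /d; case: (size p).
    have := zeros_degree t_transc e_spans p0' gp uP sPP.
    rewrite -lez_nat (big_morph Posz PoszD (erefl _)); congr (_ <= _).
    rewrite -sumrN big_seq [RHS]big_seq; apply: eq_bigr => x xs.
    have xp := sPP x xs; have : ~~ (x t < 0) by move: xs; rewrite mem_filter => /andP[].
    by rewrite /D' => /negPf ->; rewrite PoszM; nia.
  by rewrite PoszD addrC lerD.
have [a [b [ia ib ab]]] := idx_modular s0 (box_subgroup D') sg (box_mono D'0) iS.
have aK : (a <= q ^ (n * C).+1)%N.
  have sL D1 : subgroup (glob `&` box D1) by apply: subsetI_subgroup => //; exact: box_subgroup.
  have sz : subgroup [set (0 : V)] by split=> // ? ? /= -> ->; rewrite subr0.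
  have z_sub : [set (0 : V)] `<=` glob `&` box (fun=> 0).
    by move=> _ ->; exact: subgroup0 (sL _).
  have L_sub : glob `&` box (fun=> 0) `<=` glob `&` box D'.
    by move=> w [gw bw]; split=> //; exact: box_mono D'0 _ bw.
  have il := idx_tower (sL D') (sL (fun=> 0)) z_sub L_sub ib global_constants.
  (* At a pole of t, coefficients of degree at most M give a sum of order at least (M + C) x(t), and
     division by p, of degree d, leaves m x(t). The resulting q^(n M) sections make b so large that
     a b = q^S leaves for a a bound in which D no longer occurs. *)
  pose M := (m + d - C)%N.
  pose fam (A : 'M[k]_(n, M)) : V := fun=> (\sum_i pev t (rVpoly (row i A)) * e' i) / pev t p.
  have := idx_ge (e := fam) sz il; rewrite card_mx => bM.
  have {}bM : (q ^ (n * M) <= b * q)%N.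
    apply: bM => [A|A B /= AB].
      split; first by exists ((\sum_i pev t (rVpoly (row i A)) * e' i) / pev t p).
      move=> x; have dx := ord_dval x; rewrite /fam /D' [X in vge _ _ X]mulrC vge_mull ?invr_eq0 // dvalV // opprK.
      case: ifPn => xt; last first.
        rewrite addNr; apply: vge_sum => // i _; apply: vge_mul0 => //.
          by apply: pev_int; exact: tge.
        by apply: e'int; exact: tge.
      rewrite pole_pev // -/d; apply: vge_sum => // i _.
      have [->|r0] := eqVneq (rVpoly (row i A)) 0; first by rewrite pev0 mul0r vge_0.
      rewrite vge_mull ?pev_eq0 // pole_pev //; apply: vge_trans (CP x i xt).
      have : ((size (rVpoly (row i A))).-1 <= M)%N.
        by apply: leq_trans (leq_pred _) _; exact: size_poly.
      have : (C <= m + d)%N by rewrite /m -addnA leq_addr.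
      by rewrite /M; move: xt; clear; move: (x t) (size _).-1 => a b; nia.
    have [x _] := place_inhabited X.
    have := congr1 (fun r : V => r x) AB; rewrite /fam !fctE -mulrBl => /eqP.
    rewrite mulf_eq0 invr_eq0 (negPf p0') orbF => /eqP h.
    have := e_indep (p := fun i => pe * (rVpoly (row i A) - rVpoly (row i B))).
    have -> : \sum_i pev t (pe * (rVpoly (row i A) - rVpoly (row i B))) * e i = 0.
      rewrite -[RHS]h -sumrB; apply: eq_bigr => i _.
      by rewrite pevM pevB /e'; ring.
    move=> /(_ erefl) h'; apply/row_matrixP => i; apply: (can_inj (@rVpolyK _ _)).
    apply/eqP; rewrite -subr_eq0; have /eqP := h' i.
    by rewrite mulf_eq0 (negPf pe0).
  have q1 : (1 < q)%N by exact: card_finNzRing_gt1.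
  have h1 : (a * q ^ (n * M) <= q ^ (n * d + n * m).+1)%N.
    apply: (@leq_trans (a * (b * q))); first by rewrite leq_mul2l bM orbT.
    rewrite mulnA -ab -expnSr leq_exp2l // ltnS; exact: SdE.
  have ME : (n * d + n * m = n * M + n * C)%N.
    by rewrite -!mulnDr subnK ?[(d + m)%N]addnC // /m -addnA leq_addr.
  move: h1; rewrite ME -addnS expnD mulnC leq_pmul2l //.
  by rewrite expn_gt0 (ltnW q1).
apply: leq_trans aK; rewrite -[N]card_ord; apply: (idx_ge (e := e0) (addset_subgroup sg s0) ia) => // i.
exact: (@addset_subr _ glob (box D') sg _ (box_mono D'D (De0' i))).
Qed.
End Finiteness.

End RiemannRoch.

Lemma ratio_trans (E : fieldType) (h l h' l' h1 l1 a b c : E) : h1 != 0 -> l1 != 0 -> a != 0 ->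
  h1 * l = h * l1 * b -> h1 * l' = h' * l1 * a -> b = c * a -> h' * l = h * l' * c.
Proof.
move=> h10 l10 a0 e1 e2 bE; have n0 : h1 * l1 * a != 0 by rewrite !mulf_neq0.
apply: (mulIf n0); transitivity ((h' * l1 * a) * (h1 * l)); first by ring.
by rewrite -e2 e1 bE; ring.
Qed.

(** * Euler characteristics and the vanishing of H^1 *)

Section RiemannRochFormula.
Context (k : finFieldType) (X : curve k).
Local Notation F := (ff X).
Local Notation q := #|k|.
Local Notation V := (place X -> F^o).
Local Notation rep := (@rep k X).
Local Notation glob := (@glob k X).
Implicit Types (x y : place X) (f : F) (D : place X -> int) (r : V).

Let sg : subgroup glob. Proof. exact: (glob_subspace X).1. Qed.
Let sbox D : subgroup (box D). Proof. exact: box_subgroup. Qed.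
Let scos D : subgroup (addset glob (box D)). Proof. exact: addset_subgroup. Qed.
Let sL D : subgroup (glob `&` box D). Proof. exact: subsetI_subgroup. Qed.
Let srep : subgroup rep. Proof. exact: (rep_subspace X).1. Qed.
Let sz : subgroup [set (0 : V)]. Proof. by split=> // ? ? /= -> ->; rewrite subr0. Qed.
Let zL D : [set (0 : V)] `<=` glob `&` box D. Proof. by move=> _ ->; exact: subgroup0. Qed.
Let L_mono D D' : (forall x, D x <= D' x) -> glob `&` box D' `<=` glob `&` box D.
Proof. by move=> DD w [gw bw]; split=> //; exact: box_mono DD _ bw. Qed.
Let cos_mono D D' : (forall x, D x <= D' x) -> addset glob (box D') `<=` addset glob (box D).
Proof. by move=> DD; apply: addset_mono => //; exact: box_mono. Qed.

Lemma fsupp_max D D' : fsupp D -> fsupp D' -> fsupp (fun x => Num.max (D x) (D' x)).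
Proof. by apply: (fsupp_op2 (op := Num.max)); rewrite maxxx. Qed.

Lemma fsupp_min D D' : fsupp D -> fsupp D' -> fsupp (fun x => Num.min (D x) (D' x)).
Proof. by apply: (fsupp_op2 (op := Num.min)); rewrite minxx. Qed.

Lemma finite_cospace D : fsupp D -> exists N, has_index rep (addset glob (box D)) N.
Proof.
move=> fD; have [t [n [e [tt sp ei]]]] := ff_generator X.
have [N0 i0] := finite_cokernel tt sp ei.
pose D1 x := Num.max (D x) 0.
have fD1 : fsupp D1 by apply: fsupp_max => //; exact: fsupp0.
have D01 x : 0 <= D1 x by rewrite /D1 le_max lexx orbT.
have DD1 x : D x <= D1 x by rewrite /D1 le_max lexx.
have [s is_ _] := idx_box_le (fsupp0 X) fD1 D01.
have [a [b [ia _ _]]] := idx_modular (sbox D1) (sbox (fun=> 0)) sg (box_mono D01) is_.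
have i1 := idx_tower srep (scos _) (cos_mono D01) (cospace_rep (fsupp0 X)) i0 ia.
by have [N _ iN] := idx_quo (scos D1) (scos D) i1 (cos_mono DD1); exists N.
Qed.

Lemma finite_global D : fsupp D -> exists N, has_index (glob `&` box D) [set 0] N.
Proof.
move=> fD; pose D1 x := Num.min (D x) 0.
have fD1 : fsupp D1 by apply: fsupp_min => //; exact: fsupp0.
have D10 x : D1 x <= 0 by rewrite /D1 ge_min lexx orbT.
have D1D x : D1 x <= D x by rewrite /D1 ge_min lexx.
have [s is_ _] := idx_box_le fD1 (fsupp0 X) D10.
have [a [b [_ ib _]]] := idx_modular (sbox (fun=> 0)) (sbox D1) sg (box_mono D10) is_.
have i1 := idx_tower (sL D1) (sL _) (@zL _) (L_mono D10) ib (global_constants X).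
by have [N _ iN] := idx_sub sz i1 (L_mono D1D); exists N.
Qed.

(** h and l are the cardinalities of H^1 and H^0 of O(-D). *)
Definition hsize D h l := has_index rep (addset glob (box D)) h /\ has_index (glob `&` box D) [set 0] l.

Lemma hsize_exists D : fsupp D -> exists h l, hsize D h l.
Proof.
by move=> fD; have [h ih] := finite_cospace fD; have [l il] := finite_global fD; exists h, l.
Qed.

Lemma index_gt0 (W U : set V) N : W !=set0 -> has_index W U N -> (0 < N)%N.
Proof. by move=> [w Ww] [e [_ _ /(_ _ Ww)[[i iN] _]]]; apply: leq_ltn_trans iN. Qed.

Lemma hsize_gt0 D h l : hsize D h l -> (0 < h)%N /\ (0 < l)%N.
Proof.
move=> [ih il]; split; [apply: index_gt0 ih | apply: index_gt0 il]; exists 0;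
  exact: subgroup0.
Qed.

Let q0 : (q%:Q != 0). Proof. by rewrite intr_eq0 -lt0n ltnW // card_finNzRing_gt1. Qed.

Lemma riemann_roch_le D D' h l h' l' : fsupp D -> fsupp D' -> (forall x, D x <= D' x) ->
  hsize D h l -> hsize D' h' l' ->
  h'%:Q * l%:Q = h%:Q * l'%:Q * q%:Q ^ (dg D' - dg D).
Proof.
move=> fD fD' DD [ih il] [ih' il'].
have [s is_ <-] := idx_box_le fD fD' DD.
have [a [b [ia ib qs]]] := idx_modular (sbox D') (sbox D) sg (box_mono DD) is_.
have hE := idx_uniq (scos D') ih' (idx_tower srep (scos D) (cos_mono DD) (cospace_rep fD) ih ia).
have lE := idx_uniq sz il (idx_tower (sL D) (sL D') (@zL _) (L_mono DD) ib il').
have -> : q%:Q ^ s = (a * b)%N%:Q by rewrite -qs -exprnP; elim: s {is_ qs} => [|s IH] //; rewrite exprS IH expnS PoszM intrM.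
by rewrite hE lE !PoszM !intrM; ring.
Qed.

Lemma riemann_roch_rel D D' h l h' l' : fsupp D -> fsupp D' ->
  hsize D h l -> hsize D' h' l' ->
  h'%:Q * l%:Q = h%:Q * l'%:Q * q%:Q ^ (dg D' - dg D).
Proof.
move=> fD fD' H H'; have fM := fsupp_max fD fD'.
have [h1 [l1 H1]] := hsize_exists fM.
have DM x : D x <= Num.max (D x) (D' x) by rewrite le_max lexx.
have D'M x : D' x <= Num.max (D x) (D' x) by rewrite le_max lexx orbT.
have e2 := riemann_roch_le fD fM DM H H1.
have e1 := riemann_roch_le fD' fM D'M H' H1.
have [h10 l10] := hsize_gt0 H1.
apply: ratio_trans e2 e1 _; rewrite ?intr_eq0 -?lt0n ?expfz_neq0 //.
by rewrite -expfzDr //; congr (_ ^ _); lia.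
Qed.

(** The second set in the definition of [genus] is F plus the integral adeles, so finiteness of the
    cokernel makes its [xget] meaningful. *)
Lemma genus_index : has_index rep (addset glob (box (fun=> 0))) (q ^ genus X).
Proof.
have UE : [set r | exists f : F, forall x : place X, vge x 0 (r x - f)] = addset glob (box (fun=> 0)).
  apply/seteqP; split=> [r [f rf]|_ [_ [b [[f ->] Bb ->]]]].
    by exists (fun=> f), (fun x => r x - f); split=> //; [exists f | apply/funext => x /=; rewrite !fctE addrC subrK].
  by exists f => x; rewrite !fctE addrAC subrr add0r; exact: Bb.
have su := addset_subspace (glob_subspace X) (box_subspace (X := X) (fun=> 0)).
have [N iN] := finite_cospace (fsupp0 X).
have [d hd Nd] := idx_is_dim su (rep_subspace X) iN.
have : is_dim (Defs.cst X) (V := V) rep (addset glob (box (fun=> 0))) (genus X).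
  by rewrite /genus UE; case: xgetP => [d' -> //|nd]; have := nd d hd.
exact: is_dim_idx su (rep_subspace X).
Qed.

Lemma genus_basis : is_dim (Defs.cst X) (V := V) rep (addset glob (box (fun=> 0))) (genus X).
Proof.
have su := addset_subspace (glob_subspace X) (box_subspace (X := X) (fun=> 0)).
have [d hd /eqP] := idx_is_dim su (rep_subspace X) genus_index.
by rewrite eqn_exp2l ?card_finNzRing_gt1 // => /eqP ->.
Qed.

(** In exponents of q this is chi(O(-D)) = 1 - g - deg D. The identity is stated in the rationals
    because the exponent may be negative. *)
Lemma riemann_roch D h l : fsupp D -> hsize D h l ->
  h%:Q = l%:Q * q%:Q ^ (dg D + (genus X)%:Z - 1).
Proof.
move=> fD H; have H0 : hsize (fun=> 0) (q ^ genus X) q.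
  by split; [exact: genus_index | exact: global_constants].
have := riemann_roch_rel (fsupp0 X) fD H0 H; rewrite dg0 subr0.
have -> : (q ^ genus X)%N%:Q = q%:Q ^ (genus X)%:Z.
  by rewrite -exprnP; elim: (genus X) => [|s IH] //; rewrite exprS -IH expnS PoszM intrM.
move=> e1; apply: (mulIf q0); rewrite e1 !expfzDr // -invr_expz expr1z !mulrA mulfVK //.
by rewrite -!mulrA mulrCA [q%:~R ^ _ * _]mulrC.
Qed.

Lemma mulr_box f D r : f != 0 -> box D r -> box (fun x => D x + x f) (fun x => f * r x).
Proof.
by move=> f0 Dr x; rewrite vge_mull ?addrK //; exact: ord_dval.
Qed.

Lemma fsupp_ord f : fsupp (fun x => x f). Proof. exact: ord_finite. Qed.

(** Multiplication by f is an automorphism of the adeles that preserves F and carries the box of 0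
    to the box of div f. The two divisors have the same h and l, so Riemann-Roch forces q^(deg div
    f) = 1. *)
Lemma product_formula f : f != 0 -> dg (fun x => x f) = 0.
Proof.
move=> f0; have [h [l H]] := hsize_exists (fsupp0 X).
have fV0 : f^-1 != 0 by rewrite invr_eq0.
have ordV x : x f^-1 = - x f by rewrite dvalV //; exact: ord_dval.
pose m g : V -> V := fun r x => g * r x.
have mB g : {morph m g : a b / a - b}.
  by move=> a b; apply/funext => x; rewrite /m !fctE mulrBr.
have mK : cancel (m f) (m f^-1) by move=> r; apply/funext => x; rewrite /m mulKf.
have mVK : cancel (m f^-1) (m f) by move=> r; apply/funext => x; rewrite /m mulVKf.
have mg g r : glob r -> glob (m g r) by move=> [a ->]; exists (g * a).
have mrep g r : rep r -> rep (m g r).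
  have [->|g0] := eqVneq g 0.
    by move=> _; apply: almost_allT => x; rewrite /m mul0r; exact: vge_0.
  move=> rr; apply: almost_allW (almost_allI rr (ord_finite g)) => x [rx xg].
  by rewrite /m vge_mull ?xg ?subr0 //; exact: ord_dval.
have mb r : box (fun=> 0) r -> box (fun x => x f) (m f r).
  by move=> br x; have := mulr_box f0 br x; rewrite add0r.
have mbV r : box (fun x => x f) r -> box (fun=> 0) (m f^-1 r).
  by move=> br x; have := mulr_box fV0 br x; rewrite ordV subrr.
have Hf : hsize (fun x => x f) h l.
  case: H => ih il; split.
    apply: (idx_inj (h := m f) (h' := m f^-1)) ih => //; try exact: mrep.
      move=> _ [a [b [ga bb ->]]]; exists (m f a), (m f b); split=> //; [exact: mg|exact: mb|].
      by apply/funext => x; rewrite /m !fctE mulrDr.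
    move=> _ [a [b [ga bb ->]]]; exists (m f^-1 a), (m f^-1 b); split=> //; [exact: mg|exact: mbV|].
    by apply/funext => x; rewrite /m !fctE mulrDr.
  apply: (idx_inj (h := m f) (h' := m f^-1)) il => //.
  - by move=> a [ga ba]; split; [exact: mg | exact: mb].
  - by move=> a /= ->; apply/funext => x; exact: mulr0.
  - by move=> a [ga ba]; split; [exact: mg | exact: mbV].
  - by move=> a /= ->; apply/funext => x; exact: mulr0.
have := riemann_roch_rel (fsupp0 X) (fsupp_ord f) H Hf; rewrite dg0 subr0.
have [h0 l0] := hsize_gt0 H.
have n0 : h%:Q * l%:Q != 0 by rewrite mulf_neq0 // intr_eq0 -lt0n.
rewrite -[LHS]mulr1 => /(mulfI n0)/esym/eqP.
have q1 : 1 < q%:Q by rewrite ltr1z ltz_nat card_finNzRing_gt1.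
rewrite -[X in _ == X](expr0z q%:Q) => /eqP; apply: ieexprIz; last by rewrite gt_eqF.
exact: lt_trans q1.
Qed.

(* Duality in disguise: a nonzero functional [om] on the cokernel makes
   [f |-> (om (f E_i))_i], [E_i] a basis of H^1(O), an embedding of [glob `&` box D]
   into k^g, which is too small by Riemann-Roch. *)
Lemma vanishing D : fsupp D -> dg D < 2 - 2 * (genus X)%:Z -> rep = addset glob (box D).
Proof.
move=> fD dD; have [h [l H]] := hsize_exists fD; have [ih il] := H.
have su := addset_subspace (glob_subspace X) (box_subspace D).
have sr := rep_subspace X.
have [[|d] hd hE] := idx_is_dim su sr ih.
  by rewrite hE expn0 in ih; exact: (idx1 ih (scos D) srep (cospace_rep fD)).
have [om [omB omZ om0 [a0 ra0 oma0]]] := dim_functional su sr (cospace_rep fD) hd.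
have [E [rE basisE]] := genus_basis.
pose mul f r : V := fun x => f * r x.
have mrep f r : rep r -> rep (mul f r).
  have [->|f0] := eqVneq f 0.
    by move=> _; apply: almost_allT => x; rewrite /mul mul0r; exact: vge_0.
  move=> rr; apply: almost_allW (almost_allI rr (ord_finite f)) => x [rx xf].
  by rewrite /mul vge_mull ?xf ?subr0 //; exact: ord_dval.
have omD a b : rep a -> rep b -> om (a + b) = om a + om b.
  move=> ra rb; have rNb : rep (- b) by exact: subgroupN.
  have om00 : om 0 = 0 by apply: om0; exact: subgroup0.
  have omN : om (- b) = - om b.
    by rewrite -sub0r omB ?om00 ?sub0r //; exact: subgroup0.
  by rewrite -[b in LHS]opprK omB // omN opprK.
(* If [om] kills all f E_i, it kills f times every adele, since f (F + box 0) lies in F + box D,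
   where [om] vanishes. But multiplication by a nonzero f is onto, while [om] is not zero. *)
have key f : (forall x, vge x (D x) f) -> (forall i, om (mul f (E i)) = 0) -> f = 0.
  move=> fDx fE; apply/eqP/negPn/negP => f0.
  have all0 r : rep r -> om (mul f r) = 0.
    move=> rr; have [c [[_ [b [[g ->] bb eq]]] _]] := basisE r rr.
    have -> : mul f r = mul f (fun x => (\sum_i Defs.cst X (c i) *: E i) x) + mul f (fun x => g + b x).
      apply/funext => x; change (f * r x = f * (\sum_i Defs.cst X (c i) *: E i) x + f * (g + b x)).
      move: eq; set S := \sum_i _ => eq.
      have <- : r x - S x = g + b x by exact: (congr1 (fun r : V => r x) eq).
      by rewrite -mulrDr addrC subrK.
    have rsum : rep (\sum_i Defs.cst X (c i) *: E i).
      by apply: (@subspace_sum _ _ (Defs.cst X) _ rep _ _ _ _ sr) => i _; apply: sr.2.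
    have rgb : rep (mul f (fun x => g + b x)).
      apply: mrep; apply: (cospace_rep (fsupp0 X)); exists (fun=> g), b; split=> //; by exists g.
    rewrite omD //; last exact: mrep.
    have -> : om (mul f (fun x => g + b x)) = 0.
      apply: om0; exists (fun=> f * g), (mul f b); split.
      - by exists (f * g).
      - move=> x; rewrite /mul mulrC; apply: vge_mul0; [exact: ord_dval | exact: bb | exact: fDx].
      - by apply/funext => x; rewrite /mul !fctE mulrDr.
    rewrite addr0.
    have : forall s : seq 'I_(genus X), om (mul f (\sum_(i <- s) Defs.cst X (c i) *: E i)) = 0.
      elim=> [|i s IH].
        rewrite big_nil; apply: om0; have -> : mul f 0 = 0 by apply/funext => x; exact: mulr0.
        exact: subgroup0.
      rewrite big_cons; have -> : mul f (Defs.cst X (c i) *: E i + \sum_(j <- s) Defs.cst X (c j) *: E j) =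
          Defs.cst X (c i) *: mul f (E i) + mul f (\sum_(j <- s) Defs.cst X (c j) *: E j).
        apply/funext => x; rewrite /mul !fctE mulrDr; congr (_ + _).
        exact: (mulrCA f (Defs.cst X (c i)) (E i x)).
      have ri : rep (mul f (E i)) by exact: mrep.
      rewrite omD; [|exact: sr.2|apply: mrep; apply: (@subspace_sum _ _ (Defs.cst X) _ rep _ _ _ _ sr) => j _; exact: sr.2].
      by rewrite IH omZ // fE mulr0 addr0.
    by move=> /(_ (index_enum _)) <-.
  have := all0 (mul f^-1 a0) (mrep _ _ ra0).
  have -> : mul f (mul f^-1 a0) = a0 by apply/funext => x; rewrite /mul mulVKf.
  by rewrite oma0 => /eqP; rewrite oner_eq0.
have lq : (l <= q ^ genus X)%N.
  case: (il) => e [Le ie _]; rewrite -[l]card_ord -[genus X in leqRHS]card_ord -card_ffun.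
  have /choice[g gE] : forall i, exists g : F, e i = fun=> g by move=> i; case: (Le i) => -[g ->] _; exists g.
  apply: (leq_card (fun i => [ffun j => om (mul (g i) (E j))])) => i i' /ffunP eq.
  apply: ie => /=; rewrite !gE; have -> : g i = g i'; last by rewrite subrr.
  apply/eqP; rewrite -subr_eq0; apply/eqP; apply: key => [x|j].
    have := subgroupB (sbox D) (Le i).2 (Le i').2; rewrite !gE; exact.
  have := eq j; rewrite !ffunE => eqj.
  have -> : mul (g i - g i') (E j) = mul (g i) (E j) - mul (g i') (E j).
    by apply/funext => x; rewrite /mul !fctE mulrBl.
  by rewrite omB ?eqj ?subrr //; exact: mrep.
have := riemann_roch fD H; have [_ l0] := hsize_gt0 H.
have q1 : 1 < q%:Q by rewrite ltr1z ltz_nat card_finNzRing_gt1.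
have qX s : (q ^ s)%N%:Q = q%:Q ^ s%:Z.
  by rewrite -exprnP; elim: s => [|s IH] //; rewrite exprS -IH expnS PoszM intrM.
move=> hlE; exfalso.
(* The cokernel is nonzero, so h >= q. Riemann-Roch with l <= q^g gives h <= q^(dg D + 2 g - 1), and
   the bound on [dg D] makes this exponent less than 1. *)
have : q%:Q ^ 1 <= h%:Q.
  by rewrite hE qX ler_eXz2l //; lia.
apply/negP; rewrite -ltNge hlE.
have : l%:Q <= q%:Q ^ (genus X)%:Z by rewrite -qX ler_int lez_nat.
move=> lqQ; apply: (@le_lt_trans _ _ (q%:Q ^ (genus X)%:Z * q%:Q ^ (dg D + (genus X)%:Z - 1))).
  by apply: ler_wpM2r => //; apply: exprz_ge0; rewrite ler0z.
rewrite -expfzDr // ltr_eXz2l //; lia.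
Qed.

End RiemannRochFormula.

(** * Adelic lattices and instability *)

Section Matrix2.
Context (E : fieldType).
Implicit Types (a b c d : E).

Definition mx2 a b c d : 'M[E]_2 :=
  \matrix_(i, j) if i == 0 then (if j == 0 then a else b) else (if j == 0 then c else d).

Lemma ord2P (P : 'I_2 -> Prop) : P 0 -> P 1 -> forall i, P i.
Proof.
move=> P0 P1 [[|[|//]] lti].
- by rewrite (_ : Ordinal lti = 0) //; exact: val_inj.
- by rewrite (_ : Ordinal lti = 1) //; exact: val_inj.
Qed.

Lemma mx2_eta (A : 'M[E]_2) : A = mx2 (A 0 0) (A 0 1) (A 1 0) (A 1 1).
Proof. by apply/matrixP; apply: ord2P; apply: ord2P; rewrite !mxE. Qed.

Lemma mul_mx2 a b c d a' b' c' d' : mx2 a b c d *m mx2 a' b' c' d' =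
  mx2 (a * a' + b * c') (a * b' + b * d') (c * a' + d * c') (c * b' + d * d').
Proof.
by apply/matrixP; apply: ord2P; apply: ord2P; rewrite !mxE !big_ord_recl big_ord0 !mxE /= addr0.
Qed.

Lemma scale_mx2 e a b c d : e *: mx2 a b c d = mx2 (e * a) (e * b) (e * c) (e * d).
Proof. by apply/matrixP; apply: ord2P; apply: ord2P; rewrite !mxE. Qed.

Lemma det2 (A : 'M[E]_2) : \det A = A 0 0 * A 1 1 - A 0 1 * A 1 0.
Proof.
rewrite (expand_det_row _ 0) !big_ord_recl big_ord0 /cofactor !det_mx11 !mxE /=.
rewrite expr0 expr1 mul1r mulN1r addr0 mulrN.
by congr (A _ _ * A _ _ - A _ _ * A _ _); exact: val_inj.
Qed.

Lemma det_mx2 a b c d : \det (mx2 a b c d) = a * d - b * c.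
Proof. by rewrite det2 !mxE. Qed.

Lemma mx2_unit a b c d : (mx2 a b c d \in unitmx) = (a * d - b * c != 0).
Proof. by rewrite unitmxE det_mx2 unitfE. Qed.

End Matrix2.

Lemma map_mx2 (E E' : fieldType) (h : {rmorphism E -> E'}) a b c d :
  map_mx h (mx2 a b c d) = mx2 (h a) (h b) (h c) (h d).
Proof. by apply/matrixP; apply: ord2P; apply: ord2P; rewrite !mxE. Qed.

Section LocalMatrix.
Context (E : fieldType) (v : E -> int) (dv : is_dval v).

Lemma GLint_mx2 a b c d : vge v 0 a -> vge v 0 b -> vge v 0 c -> vge v 0 d ->
  a * d - b * c != 0 -> v (a * d - b * c) = 0 -> GLint v (mx2 a b c d).
Proof.
move=> ha hb hc hd d0 vd; split; rewrite ?mx2_unit ?det_mx2 //.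
by apply: ord2P; apply: ord2P; rewrite mxE.
Qed.

Lemma GLint_mul n (A B : 'M[E]_n) : GLint v A -> GLint v B -> GLint v (A *m B).
Proof.
move=> [uA iA dA] [uB iB dB]; split; first by rewrite unitmx_mul uA.
  by move=> i j; rewrite mxE; apply: vge_sum => // l _; apply: vge_mul0; [exact: dv | exact: iA | exact: iB].
by rewrite det_mulmx dvalM ?dA ?dB // -unitfE -unitmxE.
Qed.

Lemma GLint_id n : GLint v (1%:M : 'M[E]_n).
Proof.
split; rewrite ?unitmx1 ?det1 ?dval1 // => i j; rewrite mxE.
by case: (i == j); [exact: vge_1 | exact: vge_0].
Qed.

Lemma mxint_mul m n p (A : 'M[E]_(m, n)) (B : 'M[E]_(n, p)) : mxint v A -> mxint v B -> mxint v (A *m B).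
Proof.
by move=> iA iB i j; rewrite mxE; apply: vge_sum => // l _; apply: vge_mul0; [exact: dv | exact: iA | exact: iB].
Qed.

Lemma mxint_det n (A : 'M[E]_n) : mxint v A -> vge v 0 (\det A).
Proof.
move=> iA; apply: vge_sum => // s _; apply: vge_mul0 => //.
  apply: vge_exp => //; rewrite vge_opp //; exact: vge_1.
by apply: (big_ind (fun a => vge v 0 a)) => //; [exact: vge_1 | move=> *; exact: vge_mul0].
Qed.

Lemma GLint_inv n (A : 'M[E]_n) : GLint v A -> GLint v (invmx A).
Proof.
move=> [uA iA dA]; have d0 : \det A != 0 by rewrite -unitfE -unitmxE.
split; rewrite ?unitmx_inv ?det_inv ?dvalV ?dA ?oppr0 //.
move=> i j; rewrite /invmx uA !mxE; apply: vge_mul0 => //.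
  by rewrite vgeE ?invr_eq0 // dvalV // dA.
apply: vge_mul0 => //; first by apply: vge_exp => //; rewrite vge_opp //; exact: vge_1.
by apply: mxint_det => i' j'; rewrite !mxE; exact: iA.
Qed.

(* The least order of the nonzero entries; the value at [r = 0] is junk. *)
Definition minv (r : 'rV[E]_2) : int :=
  if r 0 0 == 0 then v (r 0 1) else if r 0 1 == 0 then v (r 0 0) else Num.min (v (r 0 0)) (v (r 0 1)).

Lemma row2_neq0 (r : 'rV[E]_2) : (r != 0) = (r 0 0 != 0) || (r 0 1 != 0).
Proof.
apply/idP/idP; last first.
  by apply: contraTneq => ->; rewrite !mxE eqxx.
apply: contraNT; rewrite negb_or !negbK => /andP[/eqP r0 /eqP r1].
by apply/eqP/rowP; apply: ord2P; rewrite mxE.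
Qed.

Lemma minvP (r : 'rV[E]_2) n : r != 0 -> (n <= minv r) = vge v n (r 0 0) && vge v n (r 0 1).
Proof.
rewrite row2_neq0 /minv /vge; case: eqVneq => //= r0; case: eqVneq => //= r1; rewrite ?orbF ?andbT //.
by rewrite le_min.
Qed.

Lemma minv_le (r : 'rV[E]_2) n : r != 0 -> (forall j, vge v n (r 0 j)) -> n <= minv r.
Proof. by move=> r0 h; rewrite minvP // !h. Qed.

Lemma minv_ge (r : 'rV[E]_2) j : r != 0 -> vge v (minv r) (r 0 j).
Proof.
move=> r0; have := minvP (minv r) r0; rewrite lexx => /esym/andP[h0 h1].
by move: j; apply: ord2P.
Qed.

Lemma minv_mul_ge (r : 'rV[E]_2) (A : 'M[E]_2) n : r != 0 -> r *m A != 0 ->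
  (forall i j, vge v n (A i j)) -> minv r + n <= minv (r *m A).
Proof.
move=> r0 rA0 nA; apply: minv_le => // j; rewrite mxE; apply: vge_sum => // i _.
by apply: vge_mul => //; exact: minv_ge.
Qed.

Lemma mulmx_unit_neq0 (r : 'rV[E]_2) (A : 'M[E]_2) : A \in unitmx -> r != 0 -> r *m A != 0.
Proof. by move=> uA; apply: contraNneq => h; rewrite -[r](mulmxK uA) h mul0mx. Qed.

Lemma minv_GLint (r : 'rV[E]_2) (A : 'M[E]_2) : r != 0 -> GLint v A -> minv (r *m A) = minv r.
Proof.
move=> r0 GA; have [uA iA _] := GA; have [uB iB _] := GLint_inv GA.
have rA0 := mulmx_unit_neq0 uA r0.
apply/eqP; rewrite eq_le; apply/andP; split.
  have := minv_mul_ge (n := 0) rA0 (A := invmx A); rewrite mulmxK // addr0; exact.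
by have := minv_mul_ge r0 rA0 iA; rewrite addr0.
Qed.

Lemma minvZ c (r : 'rV[E]_2) : c != 0 -> r != 0 -> minv (c *: r) = v c + minv r.
Proof.
move=> c0 r0; have cr0 : c *: r != 0 by rewrite scaler_eq0 negb_or c0.
have h n : (n <= minv (c *: r)) = (n - v c <= minv r).
  by rewrite !minvP // !mxE !vge_mull.
apply/eqP; rewrite eq_le; apply/andP; split; last by rewrite h addrC addKr.
by have := h (minv (c *: r)); rewrite lexx => /esym; rewrite lerBlDl.
Qed.

(** The bottom row is cleared by dividing by its entry of lowest order; if that is the left one, the
    columns are exchanged as well. *)
Lemma iwasawa_local (A : 'M[E]_2) : A \in unitmx -> exists2 u, GLint v u & (A *m u) 1 0 = 0.
Proof.
rewrite [A]mx2_eta mx2_unit; set a := A 0 0; set b := A 0 1; set c := A 1 0; set d := A 1 1 => D0.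
have v1 := vge_1 dv; have v0 := vge_0 v 0.
have [/andP[d0 cd]|h] := boolP ((d != 0) && vge v (v d) c).
  exists (mx2 1 0 (- (c / d)) 1); last by rewrite mul_mx2 mxE /=; field.
  apply: GLint_mx2 => //; last by rewrite mul1r mul0r subr0 dval1.
    by rewrite vge_opp // mulrC vge_mull ?invr_eq0 // dvalV // opprK add0r.
  by rewrite mul1r mul0r subr0 oner_eq0.
have c0 : c != 0.
  apply: contraNneq h => c0; rewrite c0 vge_0 andbT.
  by apply: contraNneq D0 => ->; rewrite c0 !mulr0 subrr.
have dc : vge v (v c) d.
  have [->|d0] := eqVneq d 0; first exact: vge_0.
  by move: h; rewrite d0 /= !vgeE // -ltNge => /ltW.
exists (mx2 (- (d / c)) 1 1 0); last by rewrite mul_mx2 mxE /=; field.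
apply: GLint_mx2 => //.
- by rewrite vge_opp // mulrC vge_mull ?invr_eq0 // dvalV // opprK add0r.
- by rewrite mulr0 mul1r sub0r oppr_eq0 oner_eq0.
- by rewrite mulr0 mul1r sub0r dvalN // dval1.
Qed.
End LocalMatrix.

Section Adelic.
Context (k : finFieldType) (X : curve k) (Fh : forall x : place X, completion x).
Local Notation F := (ff X).
Local Notation v x := (@cval _ _ x (Fh x)).
Local Notation GL2A := (GL2A Fh).
Local Notation adele := (adele Fh).
Local Notation em x := (cemb (Fh x)).
Implicit Types (x : place X) (f : F) (g h : GL2A).

Lemma vge_emb x n f : vge (v x) n (em x f) = vge x n f.
Proof. by rewrite /vge fmorph_eq0 cval_emb. Qed.

Lemma adele_approx (b : forall x, Fh x) D : fsupp D -> almost_all (fun x => vge (v x) 0 (b x)) ->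
  exists2 r : place X -> F^o, rep r & forall x, vge (v x) (D x) (b x - em x (r x)).
Proof.
move=> fD ib.
(* Nonnegative precision at every place keeps the approximating family integral wherever b is. *)
have /choice[r rP] : forall x, exists r, vge (v x) (Num.max (D x) 0) (b x - em x r).
  by move=> x; have [r rP] := cval_dense (b x) (Num.max (D x) 0); exists r.
exists r => [|x]; last by apply: vge_trans (rP x); rewrite le_max lexx.
apply: almost_allW ib => x bx; rewrite -vge_emb.
have -> : em x (r x) = b x - (b x - em x (r x)) by ring.
apply: (vge_sub (cval_dval (Fh x))); first exact: bx.
by apply: vge_trans (rP x); rewrite le_max lexx orbT.
Qed.

Lemma adele_split (D : place X -> int) (a : adele) : fsupp D ->
  dg D < 2 - 2 * (genus X)%:Z -> exists f, forall x, vge (v x) (D x) (a x - em x f).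
Proof.
move=> fD dD; have [r rr rP] := adele_approx fD (aval_int a); have dv x := cval_dval (Fh x).
move: rr; rewrite (vanishing fD dD) => -[_ [b [[f ->] bb eq]]]; exists f => x.
have rE : r x = f + b x by exact: (congr1 (fun r : place X -> F^o => r x) eq).
have -> : a x - em x f = (a x - em x (r x)) + em x (b x) by rewrite rE rmorphD; ring.
by apply: (vge_add (dv x)); [exact: rP | rewrite vge_emb; exact: bb].
Qed.

Lemma mk_GL2A (m : forall x, 'M[Fh x]_2) : (forall x, m x \in unitmx) ->
  almost_all (fun x => GLint (v x) (m x)) -> exists g : GL2A, forall x, g x = m x.
Proof. by move=> um im; exists (GL2 um im). Qed.

Lemma GL2A_det0 g x : \det (g x) != 0.
Proof. by rewrite -unitfE -unitmxE; exact: gval_unit. Qed.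

(* Same double coset in GL_2(F) \ GL_2(A) / A^* GL_2(O_A). *)
Definition gequiv g h := exists gam (z : forall x, Fh x) (u : forall x, 'M[Fh x]_2),
  [/\ gam \in unitmx, idele z, forall x, GLint (v x) (u x) &
      forall x, h x = z x *: (map_mx (em x) gam *m g x *m u x)].

Lemma idele1 : idele (fun x => 1 : Fh x).
Proof. by split=> [x|]; [exact: oner_neq0 | apply: almost_allT => x; exact: cval1]. Qed.

Lemma gequiv_sym g h : gequiv g h -> gequiv h g.
Proof.
move=> [gam [z [u [ug iz iu hE]]]].
exists (invmx gam), (fun x => (z x)^-1), (fun x => invmx (u x)); split.
- by rewrite unitmx_inv.
- exact: idele_inv.
- by move=> x; apply: GLint_inv; [exact: cval_dval | exact: iu].
move=> x; have [uu _ _] := iu x; rewrite hE -scalemxAr -scalemxAl scalerA mulVf ?(iz.1 x) // scale1r.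
rewrite -!mulmxA (mulmxV uu) mulmx1 mulmxA -map_mxM mulVmx //.
by rewrite map_mx1 mul1mx.
Qed.

Lemma gequiv_trans g h l : gequiv g h -> gequiv h l -> gequiv g l.
Proof.
move=> [gam [z [u [ug iz iu hE]]]] [gam' [z' [u' [ug' iz' iu' lE]]]].
exists (gam' *m gam), (fun x => z' x * z x), (fun x => u x *m u' x); split.
- by rewrite unitmx_mul ug'.
- exact: idele_mul.
- by move=> x; apply: GLint_mul; [exact: cval_dval | exact: iu | exact: iu'].
by move=> x; rewrite lE hE map_mxM -scalemxAr -scalemxAl scalerA !mulmxA.
Qed.

(* For the bundle attached to [g], [wdeg w g] is the degree of the line subbundle generated
   by [w], and [instab w g] is 2 deg L - deg M. *)
Definition rowg (w : 'rV[F]_2) g x : 'rV[Fh x]_2 := map_mx (em x) w *m g x.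
Definition word w g x := minv (v x) (rowg w g x).
Definition wdeg w g := dg (word w g).
Definition gord g x := v x (\det (g x)).
Definition instab w g : int := 2 * wdeg w g - dg (gord g).

Lemma rowg_neq0 w g x : w != 0 -> rowg w g x != 0.
Proof.
move=> w0; apply: mulmx_unit_neq0; first exact: gval_unit.
by apply: contraNneq w0 => h; apply/eqP/rowP => j; apply: (fmorph_inj (em x));
  have := congr1 (fun r : 'rV_2 => r 0 j) h; rewrite !mxE rmorph0.
Qed.

Lemma fsupp_gord g : fsupp (gord g).
Proof. by apply: almost_allW (gval_int g) => x [_ _]. Qed.

Lemma fsupp_word w g : w != 0 -> fsupp (word w g).
Proof.
move=> w0; have h := almost_allI (ord_finite (w 0 0)) (ord_finite (w 0 1)).
apply: almost_allW (almost_allI h (gval_int g)) => x [[x0 x1] ig].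
have dv := cval_dval (Fh x).
have ew0 : map_mx (em x) w != 0.
  apply: contraNneq w0 => h'; apply/eqP/rowP => j; apply: (fmorph_inj (em x)).
  by have := congr1 (fun r : 'rV_2 => r 0 j) h'; rewrite !mxE rmorph0.
rewrite /word /rowg minv_GLint // /minv !mxE !fmorph_eq0 !cval_emb x0 x1.
by case: ifP => // _; case: ifP => // _; rewrite minxx.
Qed.

Lemma fsupp_idele (z : forall x, Fh x) : idele z -> fsupp (fun x => v x (z x)).
Proof. by case. Qed.

(** The scalar z adds 2 deg z to both terms of [instab], det gam has degree 0 by the product
    formula, and the integral matrices u change no orders. *)
Lemma instab_gequiv w g h gam z u : w != 0 -> gam \in unitmx -> idele z -> (forall x, GLint (v x) (u x)) ->
  (forall x, h x = z x *: (map_mx (em x) gam *m g x *m u x)) -> instab w h = instab (w *m gam) g.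
Proof.
move=> w0 ug iz iu hE; have wg0 := mulmx_unit_neq0 ug w0.
have fz := fsupp_idele iz.
have d0 : \det gam != 0 by rewrite -unitfE -unitmxE.
have wE : word w h = (fun x => v x (z x) + word (w *m gam) g x).
  apply/funext => x; have dv := cval_dval (Fh x).
  rewrite /word /rowg hE -scalemxAr mulmxA mulmxA -map_mxM.
  have r0 := rowg_neq0 g x wg0.
  rewrite minvZ //; last 2 first.
  - exact: iz.1.
  - by apply: mulmx_unit_neq0 => //; case: (iu x).
  by rewrite (minv_GLint dv r0 (iu x)).
have gE : gord h = (fun x => (2 * v x (z x) + x (\det gam)) + gord g x).
  apply/funext => x; have dv := cval_dval (Fh x); have [uu _ du] := iu x.
  have u0 : \det (u x) != 0 by rewrite -unitfE -unitmxE.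
  have z0 := iz.1 x.
  rewrite /gord hE detZ !det_mulmx det_map_mx !dvalM ?mulf_neq0 ?expf_neq0 ?fmorph_eq0 ?GL2A_det0 //.
  by rewrite du addr0 cval_emb addrA -mulr2n mulr_natl.
have fzd : fsupp (fun x => 2 * v x (z x) + x (\det gam)).
  by apply: almost_allW (almost_allI fz (ord_finite (\det gam))) => x [-> ->]; rewrite mulr0.
have f2z : fsupp (fun x => 2 * v x (z x)) by apply: almost_allW fz => x ->; rewrite mulr0.
rewrite /instab /wdeg wE gE !dgD //; [|exact: fsupp_ord|exact: fsupp_gord|exact: fsupp_word].
by rewrite product_formula // dgZ //; ring.
Qed.

(** The bound delta <= N, tested on nonzero vectors of the generic fibre: each of them generates
    exactly one line subbundle. *)
Definition dbound N g := forall w, w != 0 -> instab w g <= N.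

Lemma dbound_gequiv N g h : gequiv g h -> dbound N g -> dbound N h.
Proof.
move=> [gam [z [u [ug iz iu hE]]]] gN w w0; rewrite (instab_gequiv w0 ug iz iu hE).
by apply: gN; exact: mulmx_unit_neq0.
Qed.

(** Multiplying the row of w by g^-1 recovers w, so a nonzero coordinate of w has order at least
    [word w g] plus a constant depending on g only. Its divisor has degree 0. *)
Lemma dbound_exists g : exists N : nat, dbound N%:Z g.
Proof.
have /choice[c cP] : forall x, exists n : int, [/\ n <= 0,
    forall i j, vge (v x) n (invmx (g x) i j) & GLint (v x) (g x) -> n = 0].
  move=> x; have dv := cval_dval (Fh x).
  have [G|nG] := pselect (GLint (v x) (g x)).
    by exists 0; split=> //; have [] := GLint_inv dv G.
  pose A : 'M[Fh x]_2 := invmx (g x).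
  have low (a b c d : int) : exists m : int, [/\ m <= 0, m <= a, m <= b, m <= c & m <= d].
    by exists (- (`|a| + `|b| + `|c| + `|d|)); split; lia.
  have [m [m0 ma mb mc md]] := low (v x (A 0 0)) (v x (A 0 1)) (v x (A 1 0)) (v x (A 1 1)).
  have h a : m <= v x a -> vge (v x) m a by rewrite /vge => ->; rewrite orbT.
  by exists m; split=> //; apply: ord2P; apply: ord2P; apply: h.
have fc : fsupp c by apply: almost_allW (gval_int g) => x G; case: (cP x) => _ _; apply.
exists (`|(2 * dg c)%R| + `|dg (gord g)|)%N => w w0.
have [j wj] : exists j, w 0 j != 0.
  by move: w0; rewrite row2_neq0 => /orP[]; [exists 0 | exists 1].
have h x : word w g x + c x <= x (w 0 j).
  have dv := cval_dval (Fh x); have [_ cA _] := cP x.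
  have r0 := rowg_neq0 g x w0.
  have : vge (v x) (word w g x + c x) ((rowg w g x *m invmx (g x)) 0 j).
    rewrite mxE; apply: vge_sum => // i _; apply: vge_mul => //; exact: minv_ge.
  rewrite /rowg mulmxK; last exact: gval_unit.
  by rewrite mxE vge_emb vgeE.
have := le_dg _ (fsupp_ord (w 0 j)) h; rewrite dgD ?product_formula //; last exact: fsupp_word.
have fwc : fsupp (fun x => word w g x + c x).
  by apply: almost_allW (almost_allI (fsupp_word g w0) fc) => x [-> ->].
by move=> /(_ fwc); rewrite /instab /wdeg; lia.
Qed.
End Adelic.

(** * Upper triangular forms and split classes *)

Section Borel.
Context (k : finFieldType) (X : curve k) (Fh : forall x : place X, completion x).
Local Notation F := (ff X).
Local Notation v x := (@cval _ _ x (Fh x)).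
Local Notation GL2A := (GL2A Fh).
Local Notation adele := (adele Fh).
Local Notation em x := (cemb (Fh x)).
Implicit Types (x : place X) (f : F) (g h t : GL2A) (a b : forall x, Fh x).

Let dv x : is_dval (v x). Proof. exact: cval_dval. Qed.

(** The normal form, up to scalars, of a lattice with a chosen line, here that of the second basis
    vector. b is the adelic cocycle of the extension: by [bor_shift] it matters only modulo F and
    modulo the multiples of a by integral adeles. *)
Definition bor h a b := forall x, h x = mx2 (a x) (b x) 0 1.

Lemma idele_exists (D : place X -> int) : fsupp D -> exists2 z, idele z & forall x, v x (z x) = D x.
Proof.
move=> fD; have /choice[p pP] : forall x, exists p : F, p != 0 /\ x p = D x.
  by move=> x; have [p p0 xp] := dval_surj (ord_dval x) (D x); exists p.
exists (fun x => em x (p x)); last by move=> x; rewrite cval_emb (pP x).2.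
split=> [x|]; first by rewrite fmorph_eq0 (pP x).1.
by apply: almost_allW fD => x Dx; rewrite cval_emb (pP x).2.
Qed.

Lemma bor_exists a b : idele a -> almost_all (fun x => vge (v x) 0 (b x)) -> exists h, bor h a b.
Proof.
move=> [a0 ua] ib.
have [x||h hE] := @mk_GL2A _ _ Fh (fun x => mx2 (a x) (b x) 0 1).
- by rewrite mx2_unit mulr1 mulr0 subr0 a0.
- apply: almost_allW (almost_allI ua ib) => x [ax bx].
  apply: GLint_mx2; rewrite ?vge_0 ?vge_1 ?mulr1 ?mulr0 ?subr0 ?a0 //.
  by rewrite vgeE ?a0 // ax.
by exists h.
Qed.

Lemma em_int f : almost_all (fun x => vge (v x) 0 (em x f)).
Proof.
apply: almost_allW (ord_finite f) => x xf; rewrite vge_emb.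
by have [->|f0] := eqVneq f 0; [exact: vge_0 | rewrite vgeE // xf].
Qed.

Lemma rational_row (w : 'rV[F]_2) : w != 0 -> exists2 gam : 'M[F]_2, gam \in unitmx &
  delta_mx 0 1 *m gam = w.
Proof.
have rE (p r : F) : delta_mx 0 1 *m mx2 p r (w 0 0) (w 0 1) = w.
  by apply/rowP; apply: ord2P; rewrite !mxE !big_ord_recl big_ord0 !mxE /= mul0r mul1r addr0 add0r.
rewrite row2_neq0; have [w1|w1] := eqVneq (w 0 1) 0; last first.
  by move=> _; exists (mx2 1 0 (w 0 0) (w 0 1)) => //; rewrite mx2_unit mul1r mul0r subr0.
rewrite orbF => w0; exists (mx2 0 1 (w 0 0) (w 0 1)) => //.
by rewrite mx2_unit mul0r mul1r sub0r oppr_eq0.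
Qed.

Lemma rational_GLint (gam : 'M[F]_2) : gam \in unitmx ->
  almost_all (fun x => GLint (v x) (map_mx (em x) gam)).
Proof.
move=> ug; have h := almost_allI (almost_allI (em_int (gam 0 0)) (em_int (gam 0 1)))
  (almost_allI (em_int (gam 1 0)) (em_int (gam 1 1))).
apply: almost_allW (almost_allI h (ord_finite (\det gam))) => x [[[h1 h2] [h3 h4]] h5].
split; first by rewrite map_unitmx.
  by apply: ord2P; apply: ord2P; rewrite mxE.
by rewrite det_map_mx cval_emb.
Qed.

(* Iwasawa decomposition in which the second basis vector spans the line of [w]. *)
Lemma upper_form w g : w != 0 -> exists a b h,
  [/\ idele a, almost_all (fun x => vge (v x) 0 (b x)), bor h a b, gequiv g h & dg (fun x => v x (a x)) = - instab w g].
Proof.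
move=> w0; have [gam ug gamw] := rational_row w0.
have emu x : map_mx (em x) gam \in unitmx by rewrite map_unitmx.
have uex : forall x, exists u, GLint (v x) u /\ (map_mx (em x) gam *m g x *m u) 1 0 = 0.
  move=> x; have [|u iu u0] := iwasawa_local (dv x) (A := map_mx (em x) gam *m g x).
    by rewrite unitmx_mul emu gval_unit.
  by exists u.
pose u x := sval (cid (uex x)).
have uP x : GLint (v x) (u x) /\ (map_mx (em x) gam *m g x *m u x) 1 0 = 0 := svalP (cid (uex x)).
pose m x := map_mx (em x) gam *m g x *m u x.
have um x : m x \in unitmx.
  by rewrite !unitmx_mul emu gval_unit; case: (uP x) => -[].
have gamint := rational_GLint ug.
have im : almost_all (fun x => GLint (v x) (m x)).
  apply: almost_allW (almost_allI gamint (gval_int g)) => x [i1 i2].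
  by apply: GLint_mul => //; [exact: GLint_mul | case: (uP x)].
pose p x : Fh x := m x 0 0.
pose r x : Fh x := m x 0 1.
pose d x : Fh x := m x 1 1.
have mE x : m x = mx2 (p x) (r x) 0 (d x) by rewrite {1}[m x]mx2_eta (uP x).2.
have detE x : \det (m x) = p x * d x by rewrite mE det_mx2 mulr0 subr0.
have pd0 x : p x * d x != 0 by rewrite -detE -unitfE -unitmxE um.
have p0 x : p x != 0 by have := pd0 x; rewrite mulf_eq0 negb_or => /andP[].
have d0 x : d x != 0 by have := pd0 x; rewrite mulf_eq0 negb_or => /andP[].
have ints : almost_all (fun x => [/\ v x (p x) = 0, v x (d x) = 0 & vge (v x) 0 (r x)]).
  apply: almost_allW im => x [_ i]; rewrite detE (dvalM (dv x) (p0 x) (d0 x)) => pd.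
  have hp := i 0 0; have hd := i 1 1; have hr := i 0 1.
  rewrite -/(p x) vgeE ?p0 // in hp; rewrite -/(d x) vgeE ?d0 // in hd.
  by split => //; lia.
have ip : idele p by split=> //; apply: almost_allW ints => x [].
have id : idele d by split=> //; apply: almost_allW ints => x [].
have idV := idele_inv id.
have ia : idele (fun x => p x / d x) by exact: idele_mul ip idV.
have ib : almost_all (fun x => vge (v x) 0 (r x / d x)).
  apply: almost_allW ints => x [_ dx rx]; apply: vge_mul0 => //.
  by rewrite vgeE ?invr_eq0 ?d0 // dvalV // dx.
have [h hE] := bor_exists ia ib.
exists (fun x => p x / d x), (fun x => r x / d x), h; split=> //.
  exists gam, (fun x => (d x)^-1), u; split=> //; first by move=> x; case: (uP x).
  move=> x; rewrite -/(m x) hE mE scale_mx2 mulr0 mulVf ?d0 //.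
  by rewrite [_ * p x]mulrC [_ * r x]mulrC.
have wdE : word w g = (fun x => v x (d x)).
  apply/funext => x; rewrite /word; have [iu _] := uP x.
  rewrite -(minv_GLint (dv x) (rowg_neq0 g x w0) iu) /rowg -gamw map_mxM -!mulmxA.
  rewrite [map_mx _ gam *m _]mulmxA -/(m x) mE.
  set s := _ *m _; have sE j : s 0 j = (mx2 (p x) (r x) 0 (d x)) 1 j.
    by rewrite /s mxE !big_ord_recl big_ord0 !mxE /= rmorph0 rmorph1 mul0r mul1r addr0 add0r.
  by rewrite /minv !sE !mxE /= eqxx.
have gE x : v x (p x) + v x (d x) = x (\det gam) + gord g x.
  have g0 : \det gam != 0 by rewrite -unitfE -unitmxE.
  have [[uu _ du] _] := uP x; have u0 : \det (u x) != 0 by rewrite -unitfE -unitmxE.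
  rewrite -dvalM ?p0 ?d0 // -detE /m !det_mulmx det_map_mx.
  by rewrite !dvalM ?mulf_neq0 ?fmorph_eq0 ?GL2A_det0 // cval_emb du addr0.
have aE : (fun x => v x (p x / d x)) = (fun x => (x (\det gam) + gord g x) - 2 * word w g x).
  by apply/funext => x; rewrite dval_div ?p0 ?d0 // -gE wdE; ring.
have f1 : fsupp (fun x => x (\det gam) + gord g x).
  by apply: almost_allW (almost_allI (ord_finite (\det gam)) (fsupp_gord g)) => x [-> ->].
have f2 : fsupp (fun x => 2 * word w g x).
  by apply: almost_allW (fsupp_word g w0) => x ->; rewrite mulr0.
rewrite aE dgB // dgD ?dgZ //; [|exact: fsupp_word|exact: fsupp_ord|exact: fsupp_gord].
rewrite product_formula; last by rewrite -unitfE -unitmxE.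
by rewrite /instab /wdeg; ring.
Qed.

Lemma bor_shift h h' a b b' f : idele a -> bor h a b -> bor h' a b' ->
  (forall x, vge (v x) (v x (a x)) (b x - b' x - em x f)) -> gequiv h h'.
Proof.
move=> [a0 _] hE h'E bf.
exists (mx2 1 (- f) 0 1), (fun x => 1), (fun x => mx2 1 ((b' x - b x + em x f) / a x) 0 1); split.
- by rewrite mx2_unit mul1r mulr0 subr0 oner_eq0.
- exact: idele1.
- move=> x; have v1 := vge_1 (dv x); have v0 := vge_0 (v x) 0.
  apply: GLint_mx2 => //; rewrite ?mul1r ?mulr0 ?subr0 ?oner_eq0 ?dval1 //.
  rewrite mulrC vge_mull ?invr_eq0 ?a0 // dvalV // opprK add0r.
  by have := bf x; rewrite -vge_opp //; congr (vge _ _ _); ring.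
- move=> x; rewrite hE h'E map_mx2 !mul_mx2 scale_mx2 rmorph1 rmorph0 rmorphN.
  by congr mx2; field; rewrite ?a0.
Qed.

Lemma bor_scale h h' a b a' f : idele a -> idele a' -> f != 0 -> bor h a b -> bor h' a' (fun x => em x f * b x) ->
  (forall x, v x (a' x) = v x (a x) + x f) -> gequiv h h'.
Proof.
move=> [a0 _] [a'0 _] f0 hE h'E vE.
have ef0 x : em x f != 0 by rewrite fmorph_eq0.
exists (mx2 f 0 0 1), (fun x => 1), (fun x => mx2 (a' x / (em x f * a x)) 0 0 1); split.
- by rewrite mx2_unit mulr1 mulr0 subr0.
- exact: idele1.
- move=> x; have v1 := vge_1 (dv x); have v0 := vge_0 (v x) 0.
  have efa : em x f * a x != 0 by rewrite mulf_neq0 ?ef0 ?a0.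
  have q0 : a' x / (em x f * a x) != 0 by rewrite mulf_neq0 ?invr_eq0 ?efa ?a'0.
  have vq : v x (a' x / (em x f * a x)) = 0.
    by rewrite dval_div ?a'0 // dvalM ?a0 ?ef0 // cval_emb vE; apply/eqP; rewrite subr_eq0 addrC.
  by apply: GLint_mx2; rewrite ?mulr1 ?mulr0 ?subr0 // vgeE ?vq.
- move=> x; rewrite hE h'E map_mx2 !mul_mx2 scale_mx2 rmorph1 rmorph0.
  by congr mx2; field; rewrite ?ef0 ?a0.
Qed.

(** The Weyl element exchanges the two summands, and the scalar a^-1 restores the normal form. *)
Lemma bor_inv h h' a a' : idele a -> bor h a (fun=> 0) -> bor h' a' (fun=> 0) ->
  (forall x, a' x = (a x)^-1) -> gequiv h h'.
Proof.
move=> ia hE h'E aE; have [a0 _] := ia.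
exists (mx2 0 1 1 0), (fun x => (a x)^-1), (fun x => mx2 0 1 1 0); split.
- by rewrite mx2_unit mul0r mul1r sub0r oppr_eq0 oner_eq0.
- exact: idele_inv.
- move=> x; have v1 := vge_1 (dv x); have v0 := vge_0 (v x) 0.
  by apply: GLint_mx2; rewrite ?mul0r ?mul1r ?sub0r ?oppr_eq0 ?oner_eq0 ?dvalN ?dval1.
- move=> x; rewrite hE h'E aE map_mx2 !mul_mx2 scale_mx2 rmorph1 rmorph0.
  by congr mx2; field; rewrite ?a0.
Qed.

Lemma tor_val h h' a a' : idele a -> idele a' -> bor h a (fun=> 0) -> bor h' a' (fun=> 0) ->
  (forall x, v x (a' x) = v x (a x)) -> gequiv h h'.
Proof.
move=> ia ia' hE h'E vE; apply: (bor_scale (f := 1)) ia ia' _ hE _ _; rewrite ?oner_neq0 //.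
  by move=> x; rewrite h'E mulr0.
by move=> x; rewrite dval1 ?addr0 //; exact: ord_dval.
Qed.

Lemma tor_val_inv h h' a a' : idele a -> idele a' -> bor h a (fun=> 0) -> bor h' a' (fun=> 0) ->
  (forall x, v x (a' x) = - v x (a x)) -> gequiv h h'.
Proof.
move=> ia ia' hE h'E vE; have iV := idele_inv ia.
have [h1 h1E] := bor_exists (b := fun=> 0) iV (almost_allT (fun x => vge_0 (v x) 0)).
apply: (gequiv_trans (bor_inv ia hE h1E (fun x => erefl))).
by apply: (tor_val iV ia' h1E h'E) => x; rewrite dvalV.
Qed.

Lemma bor_split h t a b : idele a -> almost_all (fun x => vge (v x) 0 (b x)) -> bor h a b ->
  bor t a (fun=> 0) -> dg (fun x => v x (a x)) < 2 - 2 * (genus X)%:Z -> gequiv h t.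
Proof.
move=> ia ib hE tE dga; have [f fP] := adele_split (Adele ib) (fsupp_idele ia) dga.
by apply: (bor_shift (f := f)) ia hE tE _ => x; rewrite subr0; exact: fP.
Qed.

(** The two bounds add up to dg D < 1 - g, so that l = 1 would give h < 1 in Riemann-Roch. With dg D
    = -N they read N > 2 g - 2 and N > 0, which is the maximum in [m_X]. *)
Lemma section_exists (D : place X -> int) : fsupp D -> dg D < 2 - 2 * (genus X)%:Z -> dg D < 0 ->
  exists2 f, f != 0 & forall x, D x <= x f.
Proof.
move=> fD d1 d2; have [h [l H]] := hsize_exists fD.
have [h0 l0] := hsize_gt0 H; have hl := riemann_roch fD H.
have q1 : 1 < #|k|%:Q by rewrite ltr1z ltz_nat card_finNzRing_gt1.
have l1 : (1 < l)%N.
  rewrite ltnNge; apply/negP => l1; have {}l1 : l = 1%N by lia.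
  move: hl; rewrite l1 mul1r => hE.
  have : h%:Q < 1.
    rewrite hE -[ltRHS](expr0z #|k|%:Q) ltr_eXz2l //; lia.
  by rewrite ltNge (_ : 1 = 1%:Q) // ler_int lez_nat h0.
have [_ [e [eL ie _]]] := H.
have h2 : e (Ordinal l1) <> e (Ordinal l0).
  by move=> eq; have := ie (Ordinal l1) (Ordinal l0); rewrite eq subrr => /(_ erefl) /(congr1 val).
have [[f1 fE1] b1] := eL (Ordinal l1); have [[f2 fE2] b2] := eL (Ordinal l0).
exists (f1 - f2); first by apply/eqP => /eqP; rewrite subr_eq0 => /eqP f12; apply: h2; rewrite fE1 fE2 f12.
move=> x; have := subgroupB (box_subgroup D) b1 b2 x; rewrite fE1 fE2.
rewrite vgeE //; apply/eqP => /eqP; rewrite subr_eq0 => /eqP f12; apply: h2; by rewrite fE1 fE2 f12.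
Qed.

(** Beyond [m_X] the extension splits, and minus the divisor of a is linearly equivalent to an
    effective divisor E = div f - div a, of degree N. *)
Lemma deep_form g w N : w != 0 -> instab w g = N -> m_X X < N -> exists E s t,
  [/\ [/\ forall x, 0 <= E x, fsupp E & dg E = N], idele s, forall x, v x (s x) = E x,
      bor t s (fun=> 0) & gequiv g t].
Proof.
rewrite /m_X gt_max => w0 eeN /andP[N1 N2].
have [a [b [h [ia ib hE gh dga]]]] := upper_form g w0.
have int0 := almost_allT (fun x => vge_0 (v x) 0).
have fa := fsupp_idele ia.
have [t0 t0E] := bor_exists (b := fun=> 0) ia int0.
have dN : dg (fun x => v x (a x)) < 2 - 2 * (genus X)%:Z by rewrite dga eeN; lia.
have ht := bor_split ia ib hE t0E dN.
have dN0 : dg (fun x => v x (a x)) < 0 by rewrite dga eeN; lia.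
have [f f0 fP] := section_exists fa dN dN0.
pose E x := x f - v x (a x).
have fE : fsupp E by apply: almost_allW (almost_allI (ord_finite f) fa) => x [h1 h2]; rewrite /E h1 h2.
have [s ids sE] := idele_exists fE.
have [t tE] := bor_exists (b := fun=> 0) ids int0.
have fNE : fsupp (fun x => - E x) by apply: almost_allW fE => x ->; rewrite oppr0.
have [s1 is1 s1E] := idele_exists fNE.
have [t1 t1E] := bor_exists (b := fun=> 0) is1 int0.
exists E, s, t; split=> //.
  split=> //; first by move=> x; rewrite subr_ge0.
  by rewrite dgB ?product_formula ?sub0r ?dga ?opprK //; exact: fsupp_ord.
apply: (gequiv_trans gh); apply: (gequiv_trans ht).
apply: (gequiv_trans (h := t1)).
  apply: (bor_scale (f := f^-1)) ia is1 _ t0E _ _; rewrite ?invr_eq0 //.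
    by move=> x; rewrite t1E mulr0.
  by move=> x; rewrite s1E /E dvalV ?opprB //; exact: ord_dval.
by apply: (tor_val_inv is1 ids t1E tE) => x; rewrite sE s1E opprK.
Qed.

Lemma unipE x (c : Fh x) : unip c = mx2 1 c 0 1.
Proof.
by apply/matrixP; apply: ord2P; apply: ord2P; rewrite !mxE /= ?mulr1 ?mulr0 ?addr0 ?add0r.
Qed.

(* [m] runs over the lattices at which the constant term of Phi_E samples a function. *)
Lemma hecke_dichotomy E s t h (m : GL2A) (c : forall x, Fh x) w : m_X X < dg E ->
  (forall x, 0 <= E x) -> fsupp E -> idele s -> (forall x, v x (s x) = E x) -> bor t s (fun=> 0) ->
  (forall x, mxint (v x) (h x)) -> (forall x, gord h x = E x) ->
  (forall x, m x = mx2 1 (c x) 0 1 *m h x) -> w != 0 -> dg E <= instab w m -> gequiv m t.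
Proof.
rewrite /m_X gt_max => /andP[N1 N2] E0 fE ids sE tE ih hE mE w0 eew.
have uex : forall x, exists u, GLint (v x) u /\ (h x *m u) 1 0 = 0.
  move=> x; have [|u iu u0] := iwasawa_local (dv x) (A := h x); first exact: gval_unit.
  by exists u.
pose u x := sval (cid (uex x)).
have uP x : GLint (v x) (u x) /\ (h x *m u x) 1 0 = 0 := svalP (cid (uex x)).
have uu x : u x \in unitmx by case: (uP x) => -[].
pose p x : Fh x := (h x *m u x) 0 0.
pose r x : Fh x := (h x *m u x) 0 1.
pose d x : Fh x := (h x *m u x) 1 1.
have hu x : h x *m u x = mx2 (p x) (r x) 0 (d x) by rewrite {1}[h x *m u x]mx2_eta (uP x).2.
have [x||m2 m2E] := @mk_GL2A _ _ Fh (fun x => m x *m u x).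
- by rewrite unitmx_mul gval_unit uu.
- apply: almost_allW (gval_int m) => x im; apply: GLint_mul => //; by case: (uP x).
pose r' x := r x + c x * d x.
have m2mx x : m2 x = mx2 (p x) (r' x) 0 (d x).
  by rewrite m2E mE -mulmxA hu mul_mx2; congr mx2; rewrite /r'; ring.
have mm2 : gequiv m m2.
  exists 1%:M, (fun=> 1), u; split; rewrite ?unitmx1 //; [exact: idele1 | by move=> x; case: (uP x)|].
  by move=> x; rewrite m2E map_mx1 mul1mx scale1r.
have eem2 : instab w m2 = instab w m.
  rewrite (@instab_gequiv _ _ _ w m m2 1%:M (fun=> 1) u) ?mulmx1 // ?unitmx1 //; [exact: idele1 | by move=> x; case: (uP x)|].
  by move=> x; rewrite m2E map_mx1 mul1mx scale1r.
have detE x : \det (m2 x) = p x * d x by rewrite m2mx det_mx2 mulr0 subr0.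
have pd0 x : p x * d x != 0 by rewrite -detE GL2A_det0.
have p0 x : p x != 0 by have := pd0 x; rewrite mulf_eq0 negb_or => /andP[].
have d0 x : d x != 0 by have := pd0 x; rewrite mulf_eq0 negb_or => /andP[].
have ihu x : mxint (v x) (h x *m u x) by apply: mxint_mul => //; case: (uP x) => -[].
have pge x : 0 <= v x (p x) by have := ihu x 0 0; rewrite -/(p x) vgeE ?p0.
have dge x : 0 <= v x (d x) by have := ihu x 1 1; rewrite -/(d x) vgeE ?d0.
have pdE x : v x (p x) + v x (d x) = E x.
  rewrite -dvalM ?p0 ?d0 // -hE /gord; have -> : p x * d x = \det (h x) * \det (u x).
    by rewrite -det_mulmx hu det_mx2 mulr0 subr0.
  rewrite dvalM ?GL2A_det0 //; last by rewrite -unitfE -unitmxE uu.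
  by case: (uP x) => -[_ _ ->] _; rewrite addr0.
have ints : almost_all (fun x => [/\ v x (p x) = 0, v x (d x) = 0 & vge (v x) 0 (r' x)]).
  apply: almost_allW (almost_allI fE (gval_int m2)) => x [Ex [_ i _]].
  have := i 0 1; rewrite m2mx mxE /= => ir; have := pdE x; have := pge x; have := dge x.
  by split=> //; lia.
have ip : idele p by split=> //; apply: almost_allW ints => x [].
have id : idele d by split=> //; apply: almost_allW ints => x [].
have idV := idele_inv id.
have ia : idele (fun x => p x / d x) by exact: idele_mul ip idV.
have ib : almost_all (fun x => vge (v x) 0 (r' x / d x)).
  apply: almost_allW ints => x [_ dx rx]; apply: vge_mul0 => //.
  by rewrite vgeE ?invr_eq0 ?d0 // dvalV // dx.
have int0 := almost_allT (fun x => vge_0 (v x) 0).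
have [m3 m3E] := bor_exists ia ib.
have [t1 t1E] := bor_exists (b := fun=> 0) ia int0.
have m23 : gequiv m2 m3.
  exists 1%:M, (fun x => (d x)^-1), (fun=> 1%:M); split; rewrite ?unitmx1 //.
    by move=> x; exact: GLint_id.
  move=> x; rewrite map_mx1 mul1mx mulmx1 m3E m2mx scale_mx2 mulr0 mulVf ?d0 //.
  by rewrite [_ * p x]mulrC [_ * r' x]mulrC.
have vaE x : v x (p x / d x) = v x (p x) - v x (d x) by rewrite dval_div ?p0 ?d0.
apply: (gequiv_trans mm2); apply: (gequiv_trans m23).
have gm2 : gord m2 = E by apply/funext => x; rewrite /gord detE dvalM ?p0 ?d0.
move: eew; rewrite -eem2 /instab gm2 => eew.
have row0 x : rowg w m2 x 0 0 = em x (w 0 0) * p x.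
  by rewrite /rowg m2mx mxE !big_ord_recl big_ord0 !mxE /= mulr0 !addr0.
have row1 x : rowg w m2 x 0 1 = em x (w 0 0) * r' x + em x (w 0 1) * d x.
  rewrite /rowg m2mx mxE !big_ord_recl big_ord0 !mxE /= addr0.
  by congr (_ + em x (w 0 _) * _); exact: val_inj.
have fd := fsupp_idele id; have fp := fsupp_idele ip.
have fw := fsupp_word m2 w0.
(* If the first coordinate of w is zero, w spans the line fixed by N, and the instability bound
   forces d to have divisor E and p to have order 0. The extension then has degree -deg E, hence
   splits, and exchanging the summands gives t. *)
have [w00|w00] := eqVneq (w 0 0) 0.
  have w1 : w 0 1 != 0 by move: w0; rewrite row2_neq0 w00 eqxx.
  have wE : word w m2 = (fun x => x (w 0 1) + v x (d x)).
    apply/funext => x; rewrite /word /minv row0 row1 w00 rmorph0 !mul0r eqxx add0r.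
    by rewrite dvalM ?fmorph_eq0 ?d0 // cval_emb.
  move: eew; rewrite /wdeg wE dgD ?product_formula // ?add0r; last exact: fsupp_ord.
  move=> eew; have dE : (fun x => v x (d x)) = E.
    apply: ge_dg_eq => //; last lia.
    by move=> x; have := pdE x; have := pge x; lia.
  have {}dE x : v x (d x) = E x by rewrite -dE.
  have aNE x : v x (p x / d x) = - E x by rewrite vaE; have := pdE x; have := dE x; lia.
  apply: (gequiv_trans (h := t1)); last first.
    by apply: (tor_val_inv ia ids t1E tE) => x; rewrite sE aNE opprK.
  apply: (bor_split ia ib m3E t1E).
  by rewrite (_ : (fun x => _) = (fun x => - E x)) ?dgN //; [lia | apply/funext].
(* If it is nonzero, [word w m2] is at most div (w 0 0) plus the order of p, and the instability
   bound forces p to have divisor E, d to have order 0, and equality here. The second entry of the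
   row of w then says that the line of w splits the extension, with slope w 0 1 / w 0 0. *)
have wle x : word w m2 x <= x (w 0 0) + v x (p x).
  have := minv_ge (v x) 0 (rowg_neq0 m2 x w0); rewrite row0 vgeE ?mulf_neq0 ?fmorph_eq0 ?p0 //.
  by rewrite dvalM ?fmorph_eq0 ?p0 // cval_emb.
have fwp : fsupp (fun x => x (w 0 0) + v x (p x)).
  by apply: almost_allW (almost_allI (ord_finite (w 0 0)) fp) => x [-> ->].
have dgwp : dg (fun x => x (w 0 0) + v x (p x)) = dg (fun x => v x (p x)).
  by rewrite dgD ?product_formula ?add0r //; exact: fsupp_ord.
have dgpd : dg (fun x => v x (p x)) + dg (fun x => v x (d x)) = dg E.
  by rewrite -dgD //; congr dg; apply/funext => x; exact: pdE.
have dgd0 : 0 <= dg (fun x => v x (d x)) by rewrite -(dg0 X); apply: le_dg => //; exact: fsupp0.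
have dgw := le_dg fw fwp wle.
have dE : (fun=> 0) = (fun x => v x (d x)).
  apply: ge_dg_eq => //; first exact: fsupp0.
  by rewrite dg0; move: eew; rewrite /wdeg; lia.
have {}dE x : v x (d x) = 0 by rewrite -(congr1 (fun D => D x) dE).
have wE : word w m2 = (fun x => x (w 0 0) + v x (p x)).
  by apply: ge_dg_eq => //; move: eew; rewrite /wdeg; lia.
have aE x : v x (p x / d x) = E x by rewrite vaE dE; have := pdE x; rewrite dE; lia.
apply: (gequiv_trans (h := t1)); last by apply: (tor_val ia ids t1E tE) => x; rewrite sE aE.
apply: (bor_shift (f := - (w 0 1 / w 0 0)) ia m3E t1E) => x.
have ew0 : em x (w 0 0) != 0 by rewrite fmorph_eq0.
have -> : r' x / d x - 0 - em x (- (w 0 1 / w 0 0)) =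
    (em x (w 0 0) * d x)^-1 * (em x (w 0 0) * r' x + em x (w 0 1) * d x).
  by rewrite rmorphN fmorph_div; field; rewrite d0 ew0.
rewrite vaE dE subr0 -row1 vge_mull ?invr_eq0 ?mulf_neq0 ?d0 // dvalV // opprK.
rewrite dvalM ?d0 // cval_emb dE addr0 addrC.
have := minv_ge (v x) 1 (rowg_neq0 m2 x w0); rewrite -/(word w m2 x) wE; exact.
Qed.

End Borel.

(** * Finiteness of the set of bounded classes *)

Section FinitelyManyClasses.
Context (k : finFieldType) (X : curve k) (Fh : forall x : place X, completion x).
Local Notation F := (ff X).
Local Notation q := #|k|.
Local Notation v x := (@cval _ _ x (Fh x)).
Local Notation GL2A := (GL2A Fh).
Local Notation em x := (cemb (Fh x)).
Local Notation g_X := ((genus X)%:Z).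
Implicit Types (x : place X) (f : F) (g h t : GL2A) (a b : forall x, Fh x) (D : place X -> int).

Let dv x : is_dval (v x). Proof. exact: cval_dval. Qed.
Let q1 : 1 < q%:Q. Proof. by rewrite ltr1z ltz_nat card_finNzRing_gt1. Qed.

(** Among q^M + 1 distinct powers of t two agree in a residue field of degree at most M where t is
    integral. So x is a pole of t or a zero of one of finitely many differences of powers. *)
Lemma places_degree_finite M : finite_set [set x : place X | (degp x <= M)%N].
Proof.
have [t [n [e [tt sp _]]]] := ff_generator X.
have t0 := t_neq0 tt; pose N := (q ^ M)%N.
pose P (ij : 'I_N.+1 * 'I_N.+1) : set (place X) :=
  [set x | ij.1 != ij.2 /\ 0 < x (t ^+ ij.1 - t ^+ ij.2)].
apply: (@sub_finite_set _ _ ([set x : place X | 0 < x t^-1] `|` \bigcup_ij P ij)).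
  move=> x /= xM; have dx := ord_dval x; have [xt|xt] := ltP (x t) 0.
    by left; rewrite /= dvalV // oppr_gt0.
  right; have [_ iN] := idx_residue x; apply: contrapT => nP.
  have : (N.+1 <= q ^ degp x)%N.
    rewrite -[N.+1]card_ord; apply: (idx_ge (e := fun i : 'I_N.+1 => t ^+ i) _ iN).
    - exact: vge_subgroup.
    - by move=> i; apply: vge_exp => //; rewrite vgeE.
    - move=> i j /= ij; apply/eqP/negPn/negP => nij; apply: nP; exists (i, j) => //; split=> //=.
      move: ij; rewrite vgeE; first by move=> h; apply: lt_le_trans h.
      by rewrite -!(pevXn t) -pevB pev_eq0 // subr_eq0; apply: contraNneq nij => /(congr1 (fun p : {poly k} => size p)); rewrite !size_polyXn => -[] /val_inj ->.
  by rewrite ltnNge leq_exp2l ?xM // card_finNzRing_gt1.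
rewrite finite_setU; split; first by apply: zeros_finite; rewrite invr_eq0.
apply: bigcup_finite => [|ij _]; first exact: finite_finset.
have [ij1|ij1] := eqVneq ij.1 ij.2.
  by apply: (@sub_finite_set _ _ set0) => // x [] /=; rewrite ij1 eqxx.
apply: (@sub_finite_set _ _ [set x : place X | 0 < x (t ^+ ij.1 - t ^+ ij.2)]); first by move=> x [].
apply: zeros_finite; rewrite -!(pevXn t) -pevB pev_eq0 // subr_eq0.
by apply: contraNneq ij1 => /(congr1 (fun p : {poly k} => size p)); rewrite !size_polyXn => -[] /val_inj ->.
Qed.

Lemma effective_finite M : exists (I : finType) (E : I -> place X -> int),
  (forall i, fsupp (E i)) /\
  forall D, fsupp D -> (forall x, 0 <= D x) -> dg D <= M%:Z -> exists i, D = E i.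
Proof.
have /finite_seqP[s0 s0E] := places_degree_finite M.
pose s := undup s0; have us : uniq s by exact: undup_uniq.
pose E (c : {ffun 'I_(size s).+1 -> 'I_M.+1}) (x : place X) : int :=
  if x \in s then (c (inord (index x s)) : nat)%:Z else 0.
exists {ffun 'I_(size s).+1 -> 'I_M.+1}, E; split.
  move=> c; apply: (@sub_finite_set _ _ [set` s]); last exact: finite_seq.
  by move=> x /=; rewrite /E; case: ifP.
move=> D fD D0 dM.
have DM x : 0 < D x -> (degp x)%:Z * D x <= M%:Z.
  move=> Dx; pose D1 y := if y == x then D x else 0.
  have fD1 : fsupp D1.
    apply: (@sub_finite_set _ _ [set x]); last exact: finite_set1.
    by move=> y /=; rewrite /D1; case: eqP.
  have D1D y : D1 y <= D y by rewrite /D1; case: eqP => [->|].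
  have := le_dg fD1 fD D1D; rewrite (dgE (s := [:: x])) //; last first.
    by move=> y; rewrite inE /D1 => /negPf ->.
  by rewrite big_seq1 /D1 eqxx => /le_trans; apply.
have small x : x \notin s -> D x = 0.
  move=> xs; apply/eqP; rewrite eq_le D0 andbT leNgt; apply/negP => Dx.
  have := DM x Dx => h; move/negP: xs; apply; rewrite mem_undup.
  have : [set x : place X | (degp x <= M)%N] x by rewrite /= -lez_nat; nia.
  by rewrite s0E.
have DleM x : D x <= M%:Z.
  have [Dx|Dx] := ltP 0 (D x); last by lia.
  by have := DM x Dx; have := degp_gt0 x; nia.
exists [ffun i : 'I_(size s).+1 => inord `|(nth 0 [seq D x | x <- s] i)%R|%N].
apply/funext => x; rewrite /E; case: ifPn => [xs|/small //].
have ix : (index x s < size s)%N by rewrite index_mem.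
rewrite ffunE; have -> : (inord (index x s) : 'I_(size s).+1) = index x s :> nat.
  by rewrite inordK // ltnS ltnW.
rewrite (nth_map x) // nth_index //; have h1 := D0 x; have h2 := DleM x.
by rewrite inordK; lia.
Qed.

Lemma divisor_classes_finite M : exists (I : finType) (E : I -> place X -> int),
  (forall i, fsupp (E i)) /\
  forall D, fsupp D -> `|dg D| <= M%:Z -> exists f i, f != 0 /\ forall x, D x + x f = E i x.
Proof.
have [x0 _] := place_inhabited X; have d0 := degp_gt0 x0.
(* Large enough for [section_exists] to apply to -J x0 - D whenever the degree of D is at most M in
   absolute value; D + J x0 is then equivalent to an effective divisor of bounded degree. *)
pose J := (M + 2 * genus X + 2)%N.
pose P j y : int := if y == x0 then j else 0.
have fP j : fsupp (P j).
  apply: (@sub_finite_set _ _ [set x0]); last exact: finite_set1.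
  by move=> y /=; rewrite /P; case: eqP.
have dgP j : dg (P j) = (degp x0)%:Z * j.
  rewrite (dgE (s := [:: x0])) //; last by move=> y; rewrite inE /P => /negPf ->.
  by rewrite big_seq1 /P eqxx.
have [I [E [fE effE]]] := effective_finite (M + degp x0 * J).
exists I, (fun i x => E i x + P (- J%:Z) x); split.
  by move=> i; apply: almost_allW (almost_allI (fE i) (fP (- J%:Z))) => x [-> ->].
move=> D fD dM.
have fPD : fsupp (fun x => P (- J%:Z) x - D x).
  by apply: almost_allW (almost_allI (fP (- J%:Z)) fD) => x [-> ->].
have dPD : dg (fun x => P (- J%:Z) x - D x) = - ((degp x0)%:Z * J%:Z) - dg D.
  by rewrite dgB // dgP mulrN.
have dJ : J%:Z <= (degp x0)%:Z * J%:Z by nia.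
have [||f f0 fPf] := section_exists fPD; rewrite ?dPD; try (by move: dM dJ; rewrite /J; lia).
have fDf : fsupp (fun x => D x + x f).
  by apply: almost_allW (almost_allI fD (ord_finite f)) => x [-> ->].
have fDfP : fsupp (fun x => (D x + x f) - P (- J%:Z) x).
  by apply: almost_allW (almost_allI fDf (fP (- J%:Z))) => x [-> ->].
have [||i iE] := effE _ fDfP.
- by move=> x; have := fPf x; lia.
- rewrite dgB // dgD // ?product_formula ?addr0 //; last exact: fsupp_ord.
  by rewrite dgP PoszD PoszM; move: dM; lia.
exists f, i; split=> // x; have <- := congr1 (fun D => D x) iE; by rewrite subrK.
Qed.

(** Reduction theory by the pigeonhole principle. With h in the form (a, b; 0, 1), a vector w = (f,
    -s) with all orders at least D needs f of order at least D minus that of a, and f b - s of order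
    at least D. There are more such f than classes in H^1(O(-D)), so two products f b have the same
    class, and the difference of the two f admits an s. *)
Lemma instab_lower : exists c : int, forall g, exists2 w : 'rV[F]_2, w != 0 & c <= instab w g.
Proof.
have [x0 _] := place_inhabited X; have d0 := degp_gt0 x0.
pose d := (degp x0)%:Z; exists (- (2 * d + 2 * g_X)) => g.
pose w0 : 'rV[F]_2 := delta_mx 0 1.
have w00 : w0 != 0 by rewrite row2_neq0 !mxE /= oner_eq0 orbT.
have [a [b [h [ia ib hE gh dga]]]] := upper_form g w00.
have [big|small] := ltP (2 * d + 2 * g_X) (dg (fun x => v x (a x))); last first.
  by exists w0 => //; move: small; rewrite dga; lia.
set A := dg _ in big dga.
(* The largest j for which 2 deg (j x0) <= A + 1 - 2 g, the range in which Riemann-Roch yields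
   [h1 < l2]. As A is large, j is positive, so no nonzero function has order at least D everywhere
   and [l1 = 1]. *)
pose j := ((A + 1 - 2 * g_X) %/ (2 * d))%Z.
have jle : j * (2 * d) <= A + 1 - 2 * g_X by apply: lez_floor; rewrite mulf_neq0 // /d; lia.
have jgt : A + 1 - 2 * g_X < (j + 1) * (2 * d) by apply: ltz_ceil; rewrite /d; lia.
have j1 : 1 <= j by move: jgt big; rewrite /d; clear -d0; nia.
pose D y : int := if y == x0 then j else 0.
have fD : fsupp D.
  apply: (@sub_finite_set _ _ [set x0]); last exact: finite_set1.
  by move=> y /=; rewrite /D; case: eqP.
have dgD' : dg D = d * j.
  rewrite (dgE (s := [:: x0])) //; last by move=> y; rewrite inE /D => /negPf ->.
  by rewrite big_seq1 /D eqxx.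
have fa := fsupp_idele ia.
pose Da x := D x - v x (a x).
have fDa : fsupp Da by apply: almost_allW (almost_allI fD fa) => x; rewrite /Da => -[-> ->].
have [h1 [l1 H1]] := hsize_exists fD; have [h2 [l2 H2]] := hsize_exists fDa.
have [h10 l10] := hsize_gt0 H1; have [h20 l20] := hsize_gt0 H2.
have l1E : l1 = 1%N.
  apply: (idx_uniq (W := glob (X := X) `&` box D) (U := [set 0])) H1.2 _; first by split=> // ? ? /= -> ->; rewrite subr0.
  rewrite -(card_ord 1); apply: (idx_card (e := fun=> 0)).
  - move=> _; split; [exact: subgroup0 (glob_subspace X).1 | exact: subgroup0 (box_subgroup D)].
  - by move=> i i' _; rewrite !ord1.
  - move=> _ [[f ->] fDb]; exists ord0; rewrite subr0; apply/funext => x /=; apply/eqP/negPn/negP => f0.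
    have : dg D <= 0.
      rewrite -(product_formula f0); apply: le_dg => //; first exact: fsupp_ord.
      by move=> y; have := fDb y; rewrite vgeE.
    by rewrite dgD'; move: j1; rewrite /d; clear -d0; nia.
have hl : (h1 < l2)%N.
  rewrite -ltz_nat -(ltr_int rat) (riemann_roch fD H1) l1E mul1r.
  have : q%:Q ^ (- (dg Da + g_X - 1)) <= l2%:Q.
    have l2E : l2%:Q = h2%:Q * q%:Q ^ (- (dg Da + g_X - 1)).
      by rewrite (riemann_roch fDa H2) -mulrA -expfzDr ?subrr ?mulr1 // gt_eqF // (lt_trans _ q1).
    rewrite l2E; apply: ler_peMl; last by rewrite (_ : 1 = 1%:Q) // ler_int lez_nat.
    by apply: exprz_ge0; rewrite ler0z.
  apply: lt_le_trans; rewrite ltr_eXz2l // /Da dgB // dgD' -/A.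
  by move: jle; rewrite mulrC; lia.
have [r rr rP] := adele_approx fa ib.
have [e [_ _ ec]] := H1.1; have [e2 [e2L e2i _]] := H2.2.
have /choice[f2 f2E] : forall i, exists f, e2 i = fun=> f by move=> i; have [[f fE] _] := e2L i; exists f.
have mulr_rep f : rep (fun x => f * r x : F^o).
  have [->|f0] := eqVneq f 0; first by apply: almost_allT => x; rewrite mul0r; exact: vge_0.
  apply: almost_allW (almost_allI rr (ord_finite f)) => x [rx xf].
  by rewrite vge_mull ?xf ?subr0 //; exact: ord_dval.
have /choice[c cP] : forall i, exists c, addset (glob (X := X)) (box D) ((fun x => f2 i * r x) - e c).
  by move=> i; exact: ec.
have [i [i' [ii' cii]]] : exists i i', i != i' /\ c i = c i'.
  apply: contrapT => nex; have ci : injective c.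
    by move=> i i' cii; apply/eqP/negPn/negP => ii'; apply: nex; exists i, i'.
  by have := leq_card c ci; rewrite !card_ord leqNgt hl.
pose f := f2 i - f2 i'.
have f0 : f != 0.
  apply: contraNneq ii' => /eqP; rewrite subr_eq0 => /eqP f12; apply/eqP/e2i.
  by rewrite !f2E f12 subrr.
have fDa' x : vge x (Da x) f.
  by have := subgroupB (box_subgroup Da) (e2L i).2 (e2L i').2 x; rewrite !f2E.
have [_ [be [[s ->] bD eq]]] : addset (glob (X := X)) (box D) (fun x => f * r x).
  have scos : subgroup (addset (glob (X := X)) (box D)) by apply: addset_subgroup; [exact: (glob_subspace X).1 | exact: box_subgroup].
  have := subgroupB scos (cP i) (cP i'); rewrite cii; congr (addset _ _ _).
  rewrite opprB addrA subrK; apply/funext => x; by rewrite /f mulrBl.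
have eqx x : f * r x = s + be x by exact: (congr1 (fun r : place X -> F^o => r x) eq).
pose w : 'rV[F]_2 := \row_j (if j == 0 then f else - s).
have wn0 : w != 0 by rewrite row2_neq0 mxE /= f0.
have wD x : D x <= word w h x.
  have row0 : rowg w h x 0 0 = em x f * a x.
    by rewrite /rowg hE mxE !big_ord_recl big_ord0 !mxE /= mulr0 !addr0.
  have row1 : rowg w h x 0 1 = em x f * b x - em x s.
    by rewrite /rowg hE mxE !big_ord_recl big_ord0 !mxE /= addr0 mulr1 rmorphN.
  apply: minv_le; first exact: rowg_neq0.
  apply: ord2P.
    rewrite row0 mulrC vge_mull //; last by case: ia.
    by rewrite vge_emb; exact: fDa'.
  rewrite row1; have -> : em x f * b x - em x s = em x f * (b x - em x (r x)) + em x (be x).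
    by rewrite mulrBr -rmorphM eqx rmorphD; ring.
  apply: vge_add => //; last by rewrite vge_emb; exact: bD.
  have := vge_mul (dv x) (_ : vge (v x) (Da x) (em x f)) (rP x).
  by rewrite vge_emb /Da subrK; apply; exact: fDa'.
have [gam [z [u [ug iz iu hgE]]]] := gh.
exists (w *m gam); first exact: mulmx_unit_neq0.
rewrite -(instab_gequiv wn0 ug iz iu hgE) /instab.
have := le_dg fD (fsupp_word h wn0) wD; rewrite dgD' -/(wdeg w h) => wd.
have -> : gord h = (fun x => v x (a x)) by apply/funext => x; rewrite /gord hE det_mx2 mulr1 mulr0 subr0.
rewrite -/A; move: wd jgt; rewrite mulrDl mul1r mulrCA; lia.
Qed.

(** The line supplied by [instab_lower] has instability between c and m, so the degree of a is
    bounded. This leaves finitely many divisor classes for a and, for each, finitely many extension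
    classes in a finite H^1. *)
Lemma classes_finite (m : int) : exists (I : finType) (r : I -> GL2A), forall g,
  dbound m g -> exists i, gequiv g (r i).
Proof.
have [c cP] := instab_lower.
have [I [E [fE EP]]] := divisor_classes_finite (`|c| + `|m|)%N.
have aex i : exists a, idele a /\ forall x, v x (a x) = E i x.
  by have [a ia aE] := idele_exists Fh (fE i); exists a.
pose a i := sval (cid (aex i)).
have aP i : idele (a i) /\ forall x, v x (a i x) = E i x := svalP (cid (aex i)).
have /choice[n nP] := fun i => finite_cospace (fE i).
have eex i : exists e : 'I_(n i) -> (place X -> F^o),
    (forall j, rep (e j)) /\ forall w, rep w -> exists j, addset (glob (X := X)) (box (E i)) (w - e j).
  by have [e [e1 _ e3]] := nP i; exists e.
pose e i := sval (cid (eex i)).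
have eP i : (forall j, rep (e i j)) /\ forall w, rep w ->
    exists j, addset (glob (X := X)) (box (E i)) (w - e i j) := svalP (cid (eex i)).
have emb_rep (w : place X -> F^o) : rep w -> almost_all (fun x => vge (v x) 0 (em x (w x))).
  by apply: almost_allW => x; rewrite vge_emb.
have rex (ij : {i : I & 'I_(n i)}) : exists h, bor h (a (tag ij)) (fun x => em x (e (tag ij) (tagged ij) x)).
  by apply: bor_exists; [case: (aP (tag ij)) | apply: emb_rep; case: (eP (tag ij))].
have /choice[r rP] := rex.
exists {i : I & 'I_(n i)}, r => g gm.
have [w w0 cw] := cP g; have wm := gm w w0.
have [a0 [b0 [h0 [ia0 ib0 h0E gh0 dga0]]]] := upper_form g w0.
have [|f [i [f0 fE']]] := EP _ (fsupp_idele ia0); first by rewrite dga0; lia.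
have [iai vai] := aP i.
have ibf : almost_all (fun x => vge (v x) 0 (em x f * b0 x)).
  by apply: almost_allW (almost_allI (em_int Fh f) ib0) => x [h1 h2]; apply: vge_mul0.
have [h1 h1E] := bor_exists iai ibf.
have [s rs sP] := adele_approx (fE i) ibf.
have [j [_ [be [[p ->] bE eq]]]] := (eP i).2 s rs.
exists (Tagged (fun i => 'I_(n i)) j).
apply: (gequiv_trans gh0); apply: (gequiv_trans (h := h1)).
  by apply: (bor_scale ia0 iai f0 h0E h1E) => x; rewrite vai fE'.
have rE : bor _ (a i) (fun x => em x (e i j x)) := rP (Tagged (fun i => 'I_(n i)) j).
apply: (bor_shift (f := p) iai h1E rE) => x.
have eqx : s x - e i j x = p + be x by exact: (congr1 (fun r : place X -> F^o => r x) eq).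
have sE : s x = p + be x + e i j x by rewrite -eqx subrK.
rewrite vai; have -> : em x f * b0 x - em x (e i j x) - em x p = (em x f * b0 x - em x (s x)) + em x (be x).
  by rewrite sE !rmorphD; ring.
by apply: vge_add => //; rewrite vge_emb; exact: bE.
Qed.
End FinitelyManyClasses.

(** * Compactness *)

Lemma filter_seq (T : Type) (I : eqType) (G : set_system T) (s : seq I) (P : I -> set T) : Filter G ->
  (forall i, i \in s -> G (P i)) -> G [set t | forall i, i \in s -> P i t].
Proof.
move=> fG; elim: s => [|i s IH] h; first by apply: filterS filterT => t _ i.
have h1 := h i (mem_head _ _).
have h2 := IH (fun j js => h j (@mem_behead _ (i :: s) j js)).
apply: filterS (filterI h1 h2) => t [Pi Ps] j.
by rewrite inE => /orP[/eqP -> //|]; exact: Ps.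
Qed.

Lemma ultra_finite_cover (T : Type) (G : set_system T) n (S : 'I_n -> set T) : UltraFilter G ->
  G [set t | exists i, S i t] -> exists i, G (S i).
Proof.
move=> uG GS; apply: contrapT => nex.
have pG : ProperFilter G by exact: ultra_proper.
have fG : Filter G by exact: filter_filter.
have h : G [set t | forall i, i \in enum 'I_n -> (~` S i) t].
  apply: filter_seq => i _; have [Gi|//] := in_ultra_setVsetC (S i) uG.
  by case: nex; exists i.
have : G set0.
  by apply: filterS (filterI GS h) => t [[i Si]] /(_ i); rewrite mem_enum => /(_ isT).
exact: filter_not_empty.
Qed.

Section Topology.
Context (k : finFieldType) (X : curve k) (Fh : forall x : place X, completion x).
Local Notation F := (ff X).
Local Notation v x := (@cval _ _ x (Fh x)).
Local Notation GL2A := (GL2A Fh).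
Local Notation GA := (GA Fh).
Local Notation NFA := (NFA Fh).
Local Notation adele := (adele Fh).
Local Notation em x := (cemb (Fh x)).
Implicit Types (x : place X) (f : F) (g h t : GL2A) (D : place X -> int).

Let dv x : is_dval (v x). Proof. exact: cval_dval. Qed.

(** By density the representatives may be sought in F, where the growth bound for an element of
    order max(n - m, 0) limits their number. *)
Lemma finite_residues x (m n : int) : exists N (r : 'I_N -> F), forall e : Fh x, vge (v x) m e ->
  exists i, vge (v x) n (e - em x (r i)).
Proof.
have [z z0 xz] := dval_surj (ord_dval x) (Num.max (n - m) 0).
have [B hB] := growth_bound z0; have dx := ord_dval x.
have [||N _ [r [_ _ cr]]] := @idx_bounded _ [set f | vge x m f] [set f | vge x (m + Num.max (n - m) 0) f] B.
- exact: vge_subgroup.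
- move=> N e xe ei; rewrite -[N]card_ord; apply: (hB [set f | vge x m f] _ e) => //.
  + exact: vge_subgroup.
  + by move=> f xf; rewrite /= vge_mull // xz; apply: vge_trans xf; rewrite gerBl le_max lexx orbT.
  + by rewrite scaled_vge // xz.
exists N, r => e me; have [f fP] := cval_dense e (Num.max m n).
have mf : vge x m f.
  rewrite -(vge_emb Fh); have -> : em x f = e - (e - em x f) by ring.
  by apply: (vge_sub (dv x)) => //; apply: vge_trans fP; rewrite le_max lexx.
have [i iP] := cr f mf; exists i.
have -> : e - em x (r i) = (e - em x f) + em x (f - r i) by rewrite rmorphB; ring.
apply: (vge_add (dv x)) => //; first by apply: vge_trans fP; rewrite le_max lexx orbT.
rewrite vge_emb; apply: vge_trans iP; rewrite -lerBlDl le_max lexx //.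
Qed.

(** At each precision the ultrafilter selects one of finitely many residue classes; the selected
    representatives form a Cauchy sequence. *)
Lemma ultra_limit (T : Type) (G : set_system T) x (m : int) (e : T -> Fh x) : UltraFilter G ->
  G [set t | vge (v x) m (e t)] -> exists l, forall n, G [set t | vge (v x) n (e t - l)].
Proof.
move=> uG Gm; have pG : ProperFilter G by exact: ultra_proper.
have fG : Filter G by exact: filter_filter.
have /choice[r rP] : forall n : nat, exists r : F, G [set t | vge (v x) n%:Z (e t - em x r)].
  move=> n; have [N [r rP]] := finite_residues x m n%:Z.
  have [|i Gi] := @ultra_finite_cover _ G N (fun i => [set t | vge (v x) n%:Z (e t - em x (r i))]) => //.
    by apply: filterS Gm => t /rP.
  by exists (r i).
have [|l lP] := @cval_complete _ _ x (Fh x) (fun n => em x (r n)).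
  move=> n; exists `|n|%N => i j ni nj.
  have [t [ti tj]] := filter_ex (filterI (rP i) (rP j)).
  have -> : em x (r i) - em x (r j) = (e t - em x (r j)) - (e t - em x (r i)) by ring.
  by apply: (vge_sub (dv x)) => //; [apply: vge_trans tj | apply: vge_trans ti]; lia.
exists l => n; have [M MP] := lP n; pose i := (M + `|n|)%N.
apply: filterS (rP i) => t /= ti; have -> : e t - l = (e t - em x (r i)) + (em x (r i) - l) by ring.
apply: (vge_add (dv x)) => //; last by apply: MP; rewrite leq_addr.
by apply: vge_trans ti; rewrite /i; lia.
Qed.

Lemma open_GL2A (U : set GL2A) : open U = open_for (@near_GL2A _ _ Fh) U.
Proof. by []. Qed.

Lemma open_adele (U : set adele) : open U = open_for (@near_adele _ _ Fh) U.
Proof. by []. Qed.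

(* The support of the Hecke operator of the effective divisor [E], lifted to GL_2(A). *)
Definition coarse (E : place X -> int) : set GL2A :=
  [set g : GL2A | forall x, mxint (v x) (g x) /\ gord g x = E x].

Lemma invmx2 (K : fieldType) (A B : 'M[K]_2) : A \in unitmx -> B \in unitmx ->
  invmx A - invmx B = invmx A *m (B - A) *m invmx B.
Proof. by move=> uA uB; rewrite mulmxBr mulmxBl mulmxK // mulVmx // mul1mx. Qed.

Lemma mxint_inv x (A : 'M[Fh x]_2) (E : int) : A \in unitmx -> mxint (v x) A -> v x (\det A) = E ->
  forall i j, vge (v x) (- E) (invmx A i j).
Proof.
move=> uA iA dA i j; have d0 : \det A != 0 by rewrite -unitfE -unitmxE.
rewrite /invmx uA !mxE vge_mull ?invr_eq0 // dvalV // dA opprK addNr.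
apply: (vge_mul0 (dv x)) => //; first by apply: (vge_exp (dv x)) => //; rewrite vge_opp //; exact: vge_1.
by apply: (mxint_det (dv x)) => i' j'; rewrite !mxE; exact: iA.
Qed.

(** The ultrafilter has an entrywise limit at each place, whose determinant keeps its order because
    orders are locally constant. Outside a finite set of places all matrices lie in GL_2(O_x), so
    only finitely many places matter for convergence. *)
Lemma coarse_compact E : fsupp E -> (forall x, 0 <= E x) -> compact (coarse E).
Proof.
move=> fE E0; rewrite compact_ultra => G uG GE; have pG : ProperFilter G by exact: ultra_proper.
have fG : Filter G by exact: filter_filter.
have lex x : exists l : 'M[Fh x]_2, forall n, G [set g : GL2A | forall i j, vge (v x) n (g x i j - l i j)].
  have l1 i j : exists l : Fh x, forall n, G [set g : GL2A | vge (v x) n (g x i j - l)].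
    apply: (ultra_limit (m := 0)) => //; apply: filterS GE => g /= gE; exact: (gE x).1.
  pose l : 'M[Fh x]_2 := \matrix_(i, j) sval (cid (l1 i j)).
  exists l => n; have lP i j : G [set g : GL2A | vge (v x) n (g x i j - l i j)].
    by rewrite mxE; exact: (svalP (cid (l1 i j))).
  apply: filterS (filterI (filterI (lP 0 0) (lP 0 1)) (filterI (lP 1 0) (lP 1 1))).
  by move=> g [[h1 h2] [h3 h4]]; apply: ord2P; apply: ord2P.
pose l x := sval (cid (lex x)).
have lP x n : G [set g : GL2A | forall i j, vge (v x) n (g x i j - l x i j)] := svalP (cid (lex x)) n.
have near_in x n : exists g : GL2A, coarse E g /\ forall i j, vge (v x) n (g x i j - l x i j).
  by have [g [g1 g2]] := filter_ex (filterI GE (lP x n)); exists g.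
have il x : mxint (v x) (l x).
  move=> i j; have [g [gE gl]] := near_in x 0.
  have -> : l x i j = g x i j - (g x i j - l x i j) by ring.
  by apply: (vge_sub (dv x)) => //; exact: (gE x).1.
have dl x : \det (l x) != 0 /\ v x (\det (l x)) = E x.
  have [g [gE gl]] := near_in x (E x + 1); have [ig dg] := gE x.
  rewrite -dg /gord; apply: (vge_dval_eq (dv x)); first exact: GL2A_det0.
  rewrite -/(gord g x) dg !det2.
  have -> : l x 0 0 * l x 1 1 - l x 0 1 * l x 1 0 - (g x 0 0 * g x 1 1 - g x 0 1 * g x 1 0) =
    g x 0 1 * (g x 1 0 - l x 1 0) + l x 1 0 * (g x 0 1 - l x 0 1)
    - (g x 0 0 * (g x 1 1 - l x 1 1) + l x 1 1 * (g x 0 0 - l x 0 0)) by ring.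
  by apply: (vge_sub (dv x)); apply: (vge_add (dv x)); apply: (vge_mul0 (dv x));
    first [exact: ig | exact: il | exact: gl].
have ul x : l x \in unitmx by rewrite unitmxE unitfE (dl x).1.
have [x||L LE] := @mk_GL2A _ _ Fh l.
- exact: ul.
- by apply: almost_allW fE => x Ex; split=> //; rewrite (dl x).2.
have coL : coarse E L by move=> x; rewrite /gord LE; split=> //; exact: (dl x).2.
exists L; split=> //= A; rewrite nbhsE => -[B [oB BL] BA]; change (G A).
have [n fn nB] : exists2 n : place X -> int, fsupp n & forall g, near_GL2A n L g -> B g.
  by have := oB; rewrite open_GL2A => /(_ L BL).
have [s us [ns Es]] : exists2 s : seq (place X), uniq s &
    (forall x, x \notin s -> n x = 0) /\ (forall x, x \notin s -> E x = 0).
  by have [s [us h1 h2]] := fsupp_seq2 fn fE; exists s.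
(* A difference of inverses is g^-1 (l - g) l^-1, and each inverse costs up to E x; hence the
   precision raised by twice E x. *)
have Gs := @filter_seq _ _ G s (fun x => [set g : GL2A | forall i j,
  vge (v x) (Num.max (n x) (n x + E x + E x)) (g x i j - l x i j)]) fG (fun x _ => lP x _).
apply: filterS (filterI GE Gs) => g [gE gs]; apply/BA/nB => x i j.
have [ig dg] := gE x; have ug := gval_unit g x.
have ige := mxint_inv ug ig dg; have ile := mxint_inv (ul x) (il x) (dl x).2.
rewrite !mxE LE; have [xs|xs] := boolP (x \in s); last first.
  have En := Es x xs; rewrite ns //; rewrite En oppr0 in ige ile.
  by split; apply: (vge_sub (dv x)); first [exact: ig | exact: il | exact: ige | exact: ile].
have := gs x xs => gx; split.
  by apply: vge_trans (gx i j); rewrite le_max lexx.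
have -> : invmx (g x) i j + - invmx (l x) i j = (invmx (g x) - invmx (l x)) i j by rewrite !mxE.
rewrite invmx2 // mxE; apply: (vge_sum (dv x)) => // a _.
have -> : n x = (n x + E x) + (- E x) by rewrite addrK.
apply: (vge_mul (dv x)) => //; rewrite mxE; apply: (vge_sum (dv x)) => // b _.
have -> : n x + E x = - E x + (n x + E x + E x) by ring.
apply: (vge_mul (dv x)) => //; rewrite !mxE -vge_opp // opprB.
by apply: vge_trans (gx b a); rewrite le_max lexx orbT.
Qed.

(** The coset of g under the integral matrices is a neighbourhood of g: if the entries of g and g^-1
    have order at least -n, then h within n of g, with h^-1 within n of g^-1, makes g^-1 h and its
    inverse integral. *)
Lemma open_right_invariant (S : set GL2A) : (forall g h, S g -> (forall x, exists2 u, GLint (v x) u & h x = g x *m u) -> S h) ->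
  open S.
Proof.
move=> SK; rewrite open_GL2A => g Sg.
have nex x : exists n : int, [/\ 0 <= n, (forall i j, vge (v x) (- n) (g x i j)),
    (forall i j, vge (v x) (- n) (invmx (g x) i j)) & GLint (v x) (g x) -> n = 0].
  have [G|nG] := pselect (GLint (v x) (g x)).
    exists 0; rewrite oppr0; split=> //; first by case: G.
    by have [] := GLint_inv (dv x) G.
  have low (a b c d : int) : exists m : int, [/\ 0 <= m, - m <= a, - m <= b, - m <= c & - m <= d].
    by exists (`|a| + `|b| + `|c| + `|d|); split; lia.
  have lowM (A : 'M[Fh x]_2) : exists2 m : int, 0 <= m & forall i j, vge (v x) (- m) (A i j).
    have [m [m0 m1 m2 m3 m4]] := low (v x (A 0 0)) (v x (A 0 1)) (v x (A 1 0)) (v x (A 1 1)).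
    have h a : - m <= v x a -> vge (v x) (- m) a by rewrite /vge => ->; rewrite orbT.
    by exists m => //; apply: ord2P; apply: ord2P; apply: h.
  have [m1 m10 h1] := lowM (g x); have [m2 m20 h2] := lowM (invmx (g x)).
  exists (m1 + m2); split=> //; first exact: addr_ge0.
    by move=> i j; apply: vge_trans (h1 i j); rewrite lerN2 lerDl.
  by move=> i j; apply: vge_trans (h2 i j); rewrite lerN2 lerDr.
pose n x := sval (cid (nex x)).
have nP x : [/\ 0 <= n x, (forall i j, vge (v x) (- n x) (g x i j)),
    (forall i j, vge (v x) (- n x) (invmx (g x) i j)) & GLint (v x) (g x) -> n x = 0] := svalP (cid (nex x)).
exists n; first by apply: almost_allW (gval_int g) => x G; case: (nP x) => _ _ _; apply.
move=> h gh; apply: (SK g) => // x; have [n0 gn gin _] := nP x.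
have ug := gval_unit g x; have uh := gval_unit h x.
exists (invmx (g x) *m h x); last by rewrite mulmxA mulmxV // mul1mx.
have one (A B : 'M[Fh x]_2) : (forall i j, vge (v x) (- n x) (A i j)) ->
    (forall i j, vge (v x) (n x) (B i j)) -> mxint (v x) (A *m B) .
  move=> hA hB i j; rewrite mxE; apply: (vge_sum (dv x)) => // a _; rewrite -(addNr (n x)).
  exact: vge_mul.
have i1 : mxint (v x) (invmx (g x) *m h x).
  have -> : invmx (g x) *m h x = 1%:M + invmx (g x) *m (h x - g x).
    by rewrite mulmxBr mulVmx // addrC subrK.
  move=> i j; rewrite mxE; apply: (vge_add (dv x)) => //; first by case: (GLint_id (dv x) 2).
  by apply: one => // a b; case: (gh x a b).
have i2 : mxint (v x) (invmx (h x) *m g x).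
  have -> : invmx (h x) *m g x = 1%:M + (invmx (h x) - invmx (g x)) *m g x.
    by rewrite mulmxBl mulVmx // addrC subrK.
  move=> i j; rewrite mxE; apply: (vge_add (dv x)) => //; first by case: (GLint_id (dv x) 2).
  rewrite mxE; apply: (vge_sum (dv x)) => // a _; rewrite -(addrN (n x)); apply: (vge_mul (dv x)) => //.
  by case: (gh x i a).
split=> //; first by rewrite unitmx_mul unitmx_inv ug.
have e1 : v x (\det (invmx (g x) *m h x)) = - v x (\det (g x)) + v x (\det (h x)).
  by rewrite det_mulmx det_inv dvalM ?invr_eq0 ?GL2A_det0 // dvalV.
have e2 : v x (\det (invmx (h x) *m g x)) = - v x (\det (h x)) + v x (\det (g x)).
  by rewrite det_mulmx det_inv dvalM ?invr_eq0 ?GL2A_det0 // dvalV.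
have := mxint_det (dv x) i1; have := mxint_det (dv x) i2.
rewrite !vgeE; first by rewrite e1 e2; lia.
  by rewrite det_mulmx det_inv mulf_neq0 ?invr_eq0 ?GL2A_det0.
by rewrite det_mulmx det_inv mulf_neq0 ?invr_eq0 ?GL2A_det0.
Qed.

Lemma pi_GA_open (U : set GA) : open U = open (\pi_GA%qT @^-1` U).
Proof. by []. Qed.

Lemma pi_NFA_open (U : set NFA) : open U = open (\pi_NFA%qT @^-1` U).
Proof. by []. Qed.

Lemma pi_GA_eq g h : (\pi_GA%qT g = \pi_GA%qT h :> GA) <-> exists2 z, idele z & forall x, h x = z x *: g x.
Proof.
split.
  by move/eqmodP => /asboolP.
by move=> gh; apply/eqmodP/asboolP.
Qed.

Lemma pi_NFA_eq (a b : adele) : (\pi_NFA%qT a = \pi_NFA%qT b :> NFA) <-> exists f, forall x, b x = em x f + a x.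
Proof.
split.
  by move/eqmodP => /asboolP.
by move=> gh; apply/eqmodP/asboolP.
Qed.

Lemma box_compact D : fsupp D -> compact [set a : adele | forall x, vge (v x) (D x) (a x)].
Proof.
move=> fD; rewrite compact_ultra => G uG GD; have pG : ProperFilter G by exact: ultra_proper.
have fG : Filter G by exact: filter_filter.
have lex x : exists l : Fh x, forall n, G [set a : adele | vge (v x) n (a x - l)].
  by apply: (ultra_limit (m := D x)) => //; apply: filterS GD => a /=; apply.
pose l x := sval (cid (lex x)).
have lP x n : G [set a : adele | vge (v x) n (a x - l x)] := svalP (cid (lex x)) n.
have il x : vge (v x) (D x) (l x).
  have [a [aD al]] := filter_ex (filterI GD (lP x (D x))).
  have -> : l x = a x - (a x - l x) by ring.
  by apply: (vge_sub (dv x)) => //; exact: aD.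
have ail : almost_all (fun x => vge (v x) 0 (l x)).
  by apply: almost_allW fD => x Dx; have := il x; rewrite Dx.
exists (Adele ail); split=> [x|]; first exact: il.
move=> A; rewrite /= nbhsE => -[B [oB BL] BA]; change (G A).
have [n fn nB] : exists2 n : place X -> int, fsupp n & forall b, near_adele n (Adele ail) b -> B b.
  by have := oB; rewrite open_adele => /(_ _ BL).
have [s [us ns Ds]] := fsupp_seq2 fn fD.
have Gs := @filter_seq _ _ G s (fun x => [set a : adele | vge (v x) (n x) (a x - l x)]) fG (fun x _ => lP x _).
apply: filterS (filterI GD Gs) => a [aD as_]; apply/BA/nB => x /=.
have [xs|xs] := boolP (x \in s); first exact: as_.
by rewrite ns // -(Ds x xs); apply: (vge_sub (dv x)) => //; exact: aD.
Qed.

(** For D of degree below 2 - 2 g the compact box of D maps onto A / F, by the vanishing of H^1. The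
    multiple -(2 g + 1) of one point has such a degree. *)
Lemma NFA_compact : compact [set: NFA].
Proof.
have [x0 _] := place_inhabited X; have d0 := degp_gt0 x0.
pose D y : int := if y == x0 then - (2 * (genus X)%:Z + 1) else 0.
have fD : fsupp D.
  apply: (@sub_finite_set _ _ [set x0]); last exact: finite_set1.
  by move=> y /=; rewrite /D; case: eqP.
have dD : dg D < 2 - 2 * (genus X)%:Z.
  rewrite (dgE (s := [:: x0])) //; last by move=> y; rewrite inE /D => /negPf ->.
  by rewrite big_seq1 /D eqxx; nia.
have -> : [set: NFA] = [set \pi_NFA%qT a | a in [set a : adele | forall x, vge (v x) (D x) (a x)]].
  apply/seteqP; split=> // n _; pose a : adele := repr n.
  have [f fP] := adele_split a fD dD.
  have ib : almost_all (fun x => vge (v x) 0 (a x - em x f)).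
    by apply: almost_allW fD => x Dx; have := fP x; rewrite Dx.
  exists (Adele ib); first exact: fP.
  by rewrite -[n]reprK; apply/pi_NFA_eq; exists f => x /=; rewrite addrC subrK.
apply: continuous_compact; last exact: box_compact.
apply: continuous_subspaceT; exact: pi_continuous.
Qed.
End Topology.

(** * Hecke operators and constant terms *)

Section CompactlySupported.
Context (R : realType) (T : ptopologicalType) (mu : {measure set (borel T) -> \bar R}).
Local Notation intble G := (mu.-integrable [set: borel T] (EFin \o G)).

Lemma open_borel_measurable (U : set T) : open U -> measurable (U : set (borel T)).
Proof. exact: sub_sigma_algebra. Qed.

(** Open preimages of all sets say that G is locally constant; so G is measurable, and bounded
    because its image of C is compact. *)
Lemma compactly_supported_integrable (C : set T) (G : T -> R) : compact C -> open C -> (mu C < +oo)%E ->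
  (forall Y : set R, open (G @^-1` Y)) -> (forall t, ~ C t -> G t = 0) ->
  intble (G : borel T -> R).
Proof.
move=> cC oC muC oG G0; have mC := open_borel_measurable oC.
have [M [_ MP]] : bounded_set (G @` C : set R^o).
  apply: compact_bounded; apply: continuous_compact cC; apply: continuous_subspaceT.
  by apply/continuousP => A _; exact: oG.
pose B := `|M| + 1; have B0 : 0 <= B by rewrite addr_ge0.
have GB t : C t -> `|G t| <= B.
  move=> Ct; apply: (MP B); last by exists t.
  by rewrite /B (le_lt_trans (ler_norm M)) // ltrDl.
have i1 : mu.-integrable [set: borel T] (fun t => (\1_C t : R)%:E).
  apply/integrableP; split; first by apply/measurable_EFinP; exact: measurable_indic.
  under eq_integral do rewrite gee0_abs ?lee_fin //.
  by rewrite integral_indic // setIT.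
apply: (le_integrable measurableT _ _ (integrableZl measurableT B i1)).
  apply/measurable_EFinP => _ Y mY; rewrite setTI; exact: open_borel_measurable.
move=> t _ /=; rewrite lee_fin normrM (ger0_norm B0) indicE.
have [Ct|nCt] := pselect (C t); last by rewrite (G0 _ nCt) normr0 mulr_ge0.
by rewrite mem_set // normr1 mulr1; exact: GB.
Qed.

Implicit Types (f g : T -> R[i]).

Definition cintble f := intble (fun t : borel T => complex.Re (f t)) /\ intble (fun t : borel T => complex.Im (f t)).

Lemma compactly_supported_cintble (C : set T) f : compact C -> open C -> (mu C < +oo)%E ->
  (forall Y : set R[i], open (f @^-1` Y)) -> (forall t, ~ C t -> f t = 0) -> cintble f.
Proof.
move=> cC oC muC of_ f0; split; apply: (compactly_supported_integrable cC) => //.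
- by move=> Y; exact: (of_ (@complex.Re R @^-1` Y)).
- by move=> t /f0 ->.
- by move=> Y; exact: (of_ (@complex.Im R @^-1` Y)).
- by move=> t /f0 ->.
Qed.

Lemma CintegralD f g : cintble f -> cintble g ->
  Cintegral mu (fun t => f t + g t) = Cintegral mu f + Cintegral mu g.
Proof.
move=> [rf jf] [rg jg]; rewrite /Cintegral.
have -> : (fun t : borel T => complex.Re (f t + g t)) = (fun t => complex.Re (f t) + complex.Re (g t)).
  by apply/funext => t; case: (f t) => ? ?; case: (g t).
have -> : (fun t : borel T => complex.Im (f t + g t)) = (fun t => complex.Im (f t) + complex.Im (g t)).
  by apply/funext => t; case: (f t) => ? ?; case: (g t).
by rewrite !RintegralD.
Qed.

Lemma CintegralZ (c : R[i]) f : cintble f ->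
  Cintegral mu (fun t => c * f t) = c * Cintegral mu f.
Proof.
move=> [rf jf]; rewrite /Cintegral; case: c => a b.
have -> : (fun t : borel T => complex.Re ((Complex a b) * f t)) =
    (fun t => a * complex.Re (f t) - b * complex.Im (f t)).
  by apply/funext => t; case: (f t).
have -> : (fun t : borel T => complex.Im ((Complex a b) * f t)) =
    (fun t => a * complex.Im (f t) + b * complex.Re (f t)).
  by apply/funext => t; case: (f t).
have iR x := integrableZl measurableT x rf; have iI x := integrableZl measurableT x jf.
rewrite (RintegralB (f1 := fun t : borel T => a * complex.Re (f t)) (f2 := fun t : borel T => b * complex.Im (f t)) measurableT (iR a) (iI b)).
rewrite (RintegralD (f1 := fun t : borel T => a * complex.Im (f t)) (f2 := fun t : borel T => b * complex.Re (f t)) measurableT (iI a) (iR b)).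
by rewrite !RintegralZl.
Qed.

(** The explicit bound is needed twice: over G(A) it gives a lower bound independent of the point n,
    which is then integrated over N(F)\N(A). *)
Lemma Rintegral_gt0 (C U : set T) (G : T -> R) (c : R) : compact C -> open C -> (mu C < +oo)%E ->
  (forall Y : set R, open (G @^-1` Y)) -> (forall t, ~ C t -> G t = 0) ->
  open U -> U `<=` C -> (0 < mu U)%E -> 0 < c -> (forall t, 0 <= G t) -> (forall t, U t -> c <= G t) ->
  c * fine (mu U) <= Rintegral mu [set: borel T] G.
Proof.
move=> cC oC muC oG G0 oU UC muU c0 Gge cG.
have mU := open_borel_measurable oU; have mC := open_borel_measurable oC.
have muUfin : (mu U < +oo)%E by apply: le_lt_trans muC; apply: le_measure; rewrite ?inE.
have i1 : mu.-integrable [set: borel T] (fun t => (\1_U t : R)%:E).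
  apply/integrableP; split; first by apply/measurable_EFinP; exact: measurable_indic.
  under eq_integral do rewrite gee0_abs ?lee_fin //.
  by rewrite integral_indic // setIT.
have -> : c * fine (mu U) = Rintegral mu [set: borel T] (fun t => c * \1_U t).
  by rewrite RintegralZl // /Rintegral integral_indic // setIT.
apply: le_Rintegral => //.
- exact: (integrableZl measurableT c i1).
- exact: (compactly_supported_integrable cC).
- move=> t _; rewrite indicE; have [Ut|nUt] := pselect (U t).
    by rewrite mem_set // mulr1; exact: cG.
  by rewrite memNset // mulr0.
Qed.
End CompactlySupported.

Section HeckeOperators.
Context (R : realType) (k : finFieldType) (X : curve k) (Fh : forall x : place X, completion x).
Local Notation F := (ff X).
Local Notation v x := (@cval _ _ x (Fh x)).
Local Notation GL2A := (GL2A Fh).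
Local Notation GA := (GA Fh).
Local Notation NFA := (NFA Fh).
Local Notation adele := (adele Fh).
Local Notation em x := (cemb (Fh x)).
Local Notation piG := (\pi_GA%qT : GL2A -> GA).
Local Notation piN := (\pi_NFA%qT : adele -> NFA).
Context (mu : {measure set (borel GA) -> \bar R}) (nu : {measure set (borel NFA) -> \bar R}).
Hypothesis mu_fin : forall C : set GA, compact C -> open C -> (mu C < +oo)%E.
Hypothesis mu_pos : forall U : set GA, open U -> U !=set0 -> (0 < mu U)%E.
Hypothesis nu_fin : (nu [set: NFA] < +oo)%E.
Hypothesis nu_pos : (0 < nu [set: NFA])%E.
Implicit Types (x : place X) (g h t : GL2A) (E : place X -> int) (f : GA -> R[i]^o) (a b : adele).

Let dv x : is_dval (v x). Proof. exact: cval_dval. Qed.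

Let cN : compact [set: NFA]. Proof. exact: NFA_compact. Qed.

Lemma repr_pi g : exists2 z, idele z & forall x, (repr (piG g)) x = z x *: g x.
Proof. by apply/pi_GA_eq; rewrite reprK. Qed.

Lemma gequiv_scale g h (z : forall x, Fh x) : idele z -> (forall x, h x = z x *: g x) -> gequiv g h.
Proof.
move=> iz hE; exists 1%:M, z, (fun=> 1%:M); split; rewrite ?unitmx1 //.
  by move=> x; exact: GLint_id.
by move=> x; rewrite hE map_mx1 mul1mx mulmx1.
Qed.

Lemma gequiv_mulr g h (u : forall x, 'M[Fh x]_2) : (forall x, GLint (v x) (u x)) ->
  (forall x, h x = g x *m u x) -> gequiv g h.
Proof.
move=> iu hE; exists 1%:M, (fun=> 1), u; split; rewrite ?unitmx1 //; first exact: idele1.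
by move=> x; rewrite hE map_mx1 mul1mx scale1r.
Qed.

Lemma gequiv_mull g h (gam : 'M[F]_2) : gam \in unitmx ->
  (forall x, h x = map_mx (em x) gam *m g x) -> gequiv g h.
Proof.
move=> ug hE; exists gam, (fun=> 1), (fun=> 1%:M); split=> //; first exact: idele1.
  by move=> x; exact: GLint_id.
by move=> x; rewrite hE mulmx1 scale1r.
Qed.

Lemma mulG_pi g h : mulG (piG g) (piG h) = piG (GL2A_mul g h).
Proof.
have [z iz zE] := repr_pi g; have [z' iz' zE'] := repr_pi h.
apply/esym/pi_GA_eq; exists (fun x => z x * z' x); first exact: idele_mul.
by move=> x /=; rewrite zE zE' -scalemxAl -scalemxAr scalerA.
Qed.

Lemma automorphic_gequiv f g h : automorphic f -> gequiv g h -> f (piG h) = f (piG g).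
Proof.
move=> af [gam [z [u [ug iz iu hE]]]].
have [x||gm gmE] := @mk_GL2A _ _ Fh (fun x => map_mx (em x) gam).
- by rewrite map_unitmx.
- exact: rational_GLint.
have [x||ul ulE] := @mk_GL2A _ _ Fh u; first by case: (iu x).
  by apply: almost_allT.
rewrite -(af (piG gm) (piG g) (piG ul)); last 2 first.
- by exists gm => //; exists gam.
- by exists ul => // x; rewrite ulE.
congr f; rewrite !mulG_pi; apply/esym/pi_GA_eq; exists z => // x.
by rewrite hE /= gmE ulE.
Qed.

Definition coset_invariant (S : set GA) := forall g h, S (piG g) ->
  (forall x, exists2 u, GLint (v x) u & h x = g x *m u) -> S (piG h).

Lemma coset_invariant_open S : coset_invariant S -> open S.
Proof. by move=> SK; rewrite pi_GA_open; exact: open_right_invariant. Qed.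

Lemma right_coset_sym g h : (forall x, exists2 u, GLint (v x) u & h x = g x *m u) ->
  forall x, exists2 u, GLint (v x) u & g x = h x *m u.
Proof.
move=> gh x; have [u iu ->] := gh x; exists (invmx u); first exact: GLint_inv.
by rewrite mulmxK //; case: iu.
Qed.

Lemma right_coset_gequiv g h : (forall x, exists2 u, GLint (v x) u & h x = g x *m u) -> gequiv g h.
Proof.
move=> gh; have uex x : exists u, GLint (v x) u /\ h x = g x *m u.
  by have [u iu hE] := gh x; exists u.
apply: (@gequiv_mulr g h (fun x => sval (cid (uex x)))) => x; by case: (svalP (cid (uex x))).
Qed.

Definition omega E : set GA := [set piG g | g in coarse E].

Lemma coarse_coset E g h : coarse E g -> (forall x, exists2 u, GLint (v x) u & h x = g x *m u) ->
  coarse E h.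
Proof.
move=> gE gh x; have [ig dg] := gE x; have [u [uu iu du] hE] := gh x.
split; first by rewrite hE; exact: mxint_mul.
rewrite /gord hE det_mulmx dvalM ?GL2A_det0 ?du ?addr0 //.
by rewrite -unitfE -unitmxE.
Qed.

Lemma omegaP E g : omega E (piG g) -> exists g0 (z : forall x, Fh x), [/\ coarse E g0, idele z & forall x, g x = z x *: g0 x].
Proof. by move=> [g0 Eg0 /pi_GA_eq[z iz zE]]; exists g0, z. Qed.

Lemma omega_coset E : coset_invariant (omega E).
Proof.
move=> g h /omegaP[g0 [z [Eg0 iz gE]]] gh.
have izV := idele_inv iz.
have uex x : exists u, GLint (v x) u /\ h x = g x *m u.
  by have [u iu hE] := gh x; exists u.
pose u x := sval (cid (uex x)).
have uP x : GLint (v x) (u x) /\ h x = g x *m u x := svalP (cid (uex x)).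
have [x||h0 h0E] := @mk_GL2A _ _ Fh (fun x => g0 x *m u x).
- by rewrite unitmx_mul gval_unit; case: (uP x) => -[].
- by apply: almost_allW (gval_int g0) => x G; apply: GLint_mul => //; case: (uP x).
exists h0.
  by apply: (coarse_coset Eg0) => x; exists (u x); [case: (uP x) | exact: h0E].
by apply/pi_GA_eq; exists z => // x; rewrite (uP x).2 gE h0E -scalemxAl.
Qed.

Lemma omega_open E : open (omega E).
Proof. by apply: coset_invariant_open; exact: omega_coset. Qed.

Lemma omega_compact E : fsupp E -> (forall x, 0 <= E x) -> compact (omega E).
Proof.
move=> fE E0; apply: continuous_compact; last exact: coarse_compact.
by apply: continuous_subspaceT; exact: pi_continuous.
Qed.

Definition omega1 E : GA -> R[i] := fun s => if `[< omega E s >] then 1 else 0.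

Lemma omega1_coset E g h : (forall x, exists2 u, GLint (v x) u & h x = g x *m u) ->
  omega1 E (piG h) = omega1 E (piG g).
Proof.
move=> gh; rewrite /omega1; congr (if _ then _ else _); apply: asbool_equiv_eq; split=> hO.
  exact: omega_coset hO (right_coset_sym gh).
exact: omega_coset hO gh.
Qed.

Lemma fiber_open (U : Type) (H : GA -> U) (Y : set U) :
  (forall g h, (forall x, exists2 u, GLint (v x) u & h x = g x *m u) -> H (piG h) = H (piG g)) ->
  open (H @^-1` Y).
Proof. by move=> HK; apply: coset_invariant_open => g h /= Yg /HK ->. Qed.

Lemma omega_hecke E : fsupp E -> (forall x, 0 <= E x) -> hecke (omega1 E).
Proof.
move=> fE E0; split.
- move=> s s' [u uK <-]; rewrite -[s]reprK !mulG_pi; split; last first.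
    by apply: omega1_coset => x; exists (u x).
  have lr g h : (forall x, exists2 u, GLint (v x) u & h x = u *m g x) ->
      omega E (piG g) -> omega E (piG h).
    move=> gh /omegaP[g0 [z [Eg0 iz gE]]].
    have wex x : exists w, GLint (v x) w /\ h x = w *m g x.
      by have [w iw hE] := gh x; exists w.
    pose w x := sval (cid (wex x)).
    have wP x : GLint (v x) (w x) /\ h x = w x *m g x := svalP (cid (wex x)).
    have [x||h0 h0E] := @mk_GL2A _ _ Fh (fun x => w x *m g0 x).
    - by rewrite unitmx_mul gval_unit andbT; case: (wP x) => -[].
    - by apply: almost_allW (gval_int g0) => x G; apply: GLint_mul => //; case: (wP x).
    exists h0.
      move=> x; have [ig dg] := Eg0 x; have [[uw iw dw] _] := wP x.
      split; first by rewrite h0E; exact: mxint_mul.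
      rewrite /gord h0E det_mulmx dvalM ?GL2A_det0 ?dw ?add0r //.
      by rewrite -unitfE -unitmxE.
    by apply/pi_GA_eq; exists z => // x; rewrite (wP x).2 gE h0E -scalemxAr.
  rewrite /omega1; congr (if _ then _ else _); apply: asbool_equiv_eq; split; last first.
    by apply: lr => x; exists (u x).
  apply: lr => x; exists (invmx (u x)); first exact: GLint_inv.
  by rewrite /= mulKmx //; case: (uK x).
- move=> s; apply: (open_nbhs_nbhs (A := omega1 E @^-1` [set omega1 E s])).
  split=> //; apply: fiber_open => g h; exact: omega1_coset.
- have -> : [set s | omega1 E s != 0] = omega E.
    apply/seteqP; split=> s /=; rewrite /omega1; case: asboolP => //; rewrite ?eqxx ?oner_neq0 //.
  have cl : closed (omega E).
    rewrite -[omega E]setCK; apply: open_closedC; apply: coset_invariant_open => g h nO gh hO.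
    by apply: nO; exact: omega_coset hO (right_coset_sym gh).
  by rewrite -(closure_id _).1 //; exact: omega_compact.
Qed.

Lemma hecke_integrand_coset f E s g h : automorphic f ->
  (forall x, exists2 u, GLint (v x) u & h x = g x *m u) ->
  omega1 E (piG h) * f (mulG s (piG h)) = omega1 E (piG g) * f (mulG s (piG g)).
Proof.
move=> af gh; rewrite (omega1_coset _ gh); congr (_ * _).
rewrite -[s]reprK !mulG_pi; apply: automorphic_gequiv => //; apply: right_coset_gequiv => x.
by have [u iu hE] := gh x; exists u => //=; rewrite hE mulmxA.
Qed.

Lemma hecke_integrable f E s : automorphic f -> fsupp E -> (forall x, 0 <= E x) ->
  cintble mu (fun h : GA => omega1 E h * f (mulG s h)).
Proof.
move=> af fE E0; have cO := omega_compact fE E0; have oO := @omega_open E.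
apply: (compactly_supported_cintble cO oO (mu_fin cO oO)).
  by move=> Y; apply: fiber_open => g h; exact: hecke_integrand_coset.
by move=> h nO; rewrite /omega1; case: asboolP => // _; rewrite mul0r.
Qed.

Definition constant_term f E (n : NFA) := hecke_act mu (omega1 E) f (nA (repr n)).

Lemma nA_gequiv a b g : (exists p, forall x, b x = em x p + a x) ->
  exists m m' : GL2A, [/\ mulG (nA a) (piG g) = piG m, mulG (nA b) (piG g) = piG m', gequiv m m',
   forall x, m x = mx2 1 (a x) 0 1 *m g x & forall x, m' x = mx2 1 (b x) 0 1 *m g x].
Proof.
move=> [p ab].
exists (GL2A_mul (GL2 (unip_unit a) (unip_int a)) g), (GL2A_mul (GL2 (unip_unit b) (unip_int b)) g).
split; rewrite ?mulG_pi //; [|by move=> x; rewrite /= unipE|by move=> x; rewrite /= unipE].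
apply: (@gequiv_mull _ _ (mx2 1 p 0 1)).
  by rewrite mx2_unit mul1r mulr0 subr0 oner_eq0.
move=> x; rewrite /= !unipE mulmxA map_mx2 mul_mx2 ab rmorph1 rmorph0.
by congr (_ *m _); congr mx2; ring.
Qed.

Lemma hecke_act_nA f E a b : automorphic f -> (forall g, omega E (piG g) -> f (mulG (nA a) (piG g)) = f (mulG (nA b) (piG g))) ->
  hecke_act mu (omega1 E) f (nA a) = hecke_act mu (omega1 E) f (nA b).
Proof.
move=> af h; rewrite /hecke_act; congr (Cintegral mu _); apply/funext => s.
rewrite /omega1; case: asboolP => [Os|_]; last by rewrite !mul0r.
by congr (_ * _); rewrite -[s]reprK; apply: h; rewrite reprK.
Qed.

(** Changing the representative chosen by [repr] multiplies on the left by a rational unipotent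
    matrix, under which f is invariant. *)
Lemma constant_term_pi f E a : automorphic f -> constant_term f E (piN a) = hecke_act mu (omega1 E) f (nA a).
Proof.
move=> af; apply: hecke_act_nA => // g _.
have [|m [m' [-> -> mm' _ _]]] := @nA_gequiv a (repr (piN a)) g; last exact: automorphic_gequiv.
by apply/pi_NFA_eq; rewrite reprK.
Qed.

(** E itself serves as precision: for g integral with determinant of divisor E, the inverse has
    order at least -E, so conjugating by g a unipotent matrix with entry in the box of E gives an
    integral matrix. Both translates of g lie in the same coset under K. *)
Lemma constant_term_open f E (Y : set R[i]) : automorphic f -> fsupp E -> (forall x, 0 <= E x) ->
  open (constant_term f E @^-1` Y).
Proof.
move=> af fE E0; rewrite pi_NFA_open open_adele => a; rewrite /= constant_term_pi // => Ya.
exists E => // b ab; rewrite /= constant_term_pi //.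
rewrite -(@hecke_act_nA f E a b) // => s /omegaP[g [z [Eg iz sE]]].
rewrite /nA !mulG_pi; apply/esym; apply: automorphic_gequiv => //.
have us x : s x \in unitmx by exact: gval_unit.
pose c x := b x - a x.
pose u x := 1%:M + c x *: (invmx (g x) *m delta_mx 0 1 *m g x).
have uE x : invmx (g x) *m mx2 1 (c x) 0 1 *m g x = u x.
  have -> : mx2 1 (c x) 0 1 = 1%:M + c x *: delta_mx 0 1 by rewrite -unipE.
  by rewrite mulmxDr mulmxDl mulmx1 mulVmx ?gval_unit // -scalemxAr -scalemxAl.
apply: (@gequiv_mulr _ _ u) => x.
  have [ig dg] := Eg x; have ug := gval_unit g x.
  have ige := mxint_inv ug ig dg.
  split.
  - by rewrite -uE !unitmx_mul unitmx_inv ug mx2_unit mul1r mulr0 subr0 oner_eq0.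
  - move=> i j; rewrite mxE; apply: (vge_add (dv x)); first by case: (GLint_id (dv x) 2).
    rewrite mxE -(subrr (E x)); apply: (vge_mul (dv x)); first exact: ab.
    rewrite mxE; apply: (vge_sum (dv x)) => l _; rewrite mulrC; apply: (vge_mul0 (dv x)); first exact: ig.
    rewrite mxE; apply: (vge_sum (dv x)) => l' _; rewrite mulrC; apply: (vge_mul0 (dv x)); last exact: ige.
    by rewrite mxE; case: (_ && _); rewrite ?(vge_1 (dv x)) ?vge_0.
  - rewrite -uE !det_mulmx det_inv det_mx2 mul1r mulr0 subr0 mulr1 mulVf ?GL2A_det0 //.
    by rewrite (dval1 (dv x)).
rewrite /= !unipE sE -uE -!scalemxAr -!scalemxAl; congr (_ *: _).
rewrite !mulmxA mulmxK ?gval_unit // mul_mx2; congr (_ *m _).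
by congr mx2; rewrite /c; ring.
Qed.

Lemma constant_term_integrable f E : automorphic f -> fsupp E -> (forall x, 0 <= E x) ->
  cintble nu (constant_term f E).
Proof.
move=> af fE E0; apply: (@compactly_supported_cintble R _ nu [set: NFA] _ cN openT nu_fin).
  by move=> Y; exact: constant_term_open.
by move=> t [].
Qed.

(* The conditions defining [V0] for the indicator functions [omega1 E] alone. *)
Definition V1 : set (GA -> R[i]^o) := [set f | automorphic f /\
  forall E, fsupp E -> (forall x, 0 <= E x) -> Cintegral nu (constant_term f E) = 0].

Lemma V1_add f f' : V1 f -> V1 f' -> V1 (f + f').
Proof.
move=> [af cf] [af' cf']; have aff : automorphic (f + f').
  by move=> gam g u h1 h2; rewrite !fctE af // af'.
split=> // E fE E0.
have -> : constant_term (f + f') E = (fun n => constant_term f E n + constant_term f' E n).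
  apply/funext => n; rewrite /constant_term /hecke_act -CintegralD; last 2 first.
  - exact: hecke_integrable.
  - exact: hecke_integrable.
  by congr (Cintegral mu _); apply/funext => h; rewrite fctE mulrDr.
by rewrite CintegralD ?cf ?cf' ?addr0 //; exact: constant_term_integrable.
Qed.

Lemma constant_term_scale (c : R[i]) f E : automorphic f -> fsupp E -> (forall x, 0 <= E x) ->
  forall n, constant_term (fun s => c * f s) E n = c * constant_term f E n.
Proof.
move=> af fE E0 n; rewrite /constant_term /hecke_act -CintegralZ; last exact: hecke_integrable.
by congr (Cintegral mu _); apply/funext => h; rewrite mulrCA.
Qed.

Lemma V1_scale (c : R[i]) f : V1 f -> V1 (c *: f).
Proof.
move=> [af cf]; split=> [gam g u h1 h2|E fE E0].
  by rewrite !fctE af.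
have -> : constant_term (c *: f) E = (fun n => c * constant_term f E n).
  by apply/funext => n; exact: constant_term_scale.
by rewrite CintegralZ ?cf ?mulr0 //; exact: constant_term_integrable.
Qed.

Lemma V1_zero : V1 0.
Proof.
split=> // E fE E0.
have -> : constant_term 0 E = (fun n => 0 * constant_term 0 E n).
  apply/funext => n; rewrite -constant_term_scale //.
  by congr (constant_term _ E n); apply/funext => s; rewrite mul0r.
by rewrite CintegralZ ?mul0r //; exact: constant_term_integrable.
Qed.

(** For the functions [omega1 E] all integrals converge, so the conditions of [V1] are linear. A
    combination of members of [V0] is handled as a member of [V1]. *)
Lemma V1_sum (I : Type) (s : seq I) (c : I -> R[i]) (f : I -> GA -> R[i]^o) :
  (forall i, V1 (f i)) -> V1 (\sum_(i <- s) c i *: f i).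
Proof.
move=> Vf; apply: (big_ind V1); [exact: V1_zero | exact: V1_add |].
by move=> i _; exact: V1_scale.
Qed.

Lemma V0_V1 f : V0 mu nu f -> V1 f.
Proof. by move=> [af cf]; split=> // E fE E0; apply: cf; exact: omega_hecke. Qed.

(** * Positivity on the class of a split bundle *)

Section Induction.
Context (E : place X -> int) (s : forall x, Fh x) (t : GL2A).
Hypothesis (E0 : forall x, 0 <= E x) (fE : fsupp E) (mE : m_X X < dg E).
Hypothesis (ids : idele s) (sE : forall x, v x (s x) = E x) (tE : bor t s (fun=> 0)).

Definition class1 : GA -> R[i]^o := fun q : GA => if `[< gequiv t (repr q) >] then 1 else 0.

Lemma class1_pi g : class1 (piG g) = if `[< gequiv t g >] then 1 else 0.
Proof.
rewrite /class1; congr (if _ then _ else _); apply: asbool_equiv_eq.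
have [z iz zE] := repr_pi g; have gg := gequiv_scale iz zE.
by split=> h; [exact: gequiv_trans h (gequiv_sym gg) | exact: gequiv_trans h gg].
Qed.

Lemma class1_automorphic : automorphic class1.
Proof.
move=> gam g u [gm [ga gaE] <-] [ul ulK <-]; rewrite -[g]reprK (mulG_pi gm (repr g)) (mulG_pi _ ul) !class1_pi.
have gg : gequiv (repr g) (GL2A_mul (GL2A_mul gm (repr g)) ul).
  have [x0 _] := place_inhabited X.
  have uga : ga \in unitmx by have := gval_unit gm x0; rewrite gaE map_unitmx.
  exists ga, (fun=> 1), (fun x => ul x); split=> //; first exact: idele1.
  by move=> x; rewrite /= gaE scale1r.
congr (if _ then _ else _); apply: asbool_equiv_eq.
by split=> h; [exact: gequiv_trans h (gequiv_sym gg) | exact: gequiv_trans h gg].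
Qed.

(** The point is diag(1, s). In each of its unipotent translates the second basis vector has
    instability exactly deg E, so the dichotomy leaves only the class of t. *)
Lemma base_point : exists2 h, coarse E h & forall a (m : GL2A), (forall x, m x = mx2 1 (a x) 0 1 *m h x) -> gequiv m t.
Proof.
have s0 x : s x != 0 by case: ids.
have [x||h hE] := @mk_GL2A _ _ Fh (fun x => mx2 1 0 0 (s x)).
- by rewrite mx2_unit mul1r mulr0 subr0; exact: s0.
- apply: almost_allW fE => x Ex; have v1 := vge_1 (dv x); have v0 := vge_0 (v x) 0.
  have vs : vge (v x) 0 (s x) by rewrite vgeE ?sE ?Ex // s0.
  by apply: GLint_mx2 => //; rewrite mul1r mulr0 subr0 ?sE // s0.
have ch : coarse E h.
  move=> x; rewrite /gord hE det_mx2 mul1r mulr0 subr0 sE; split=> //.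
  have v1 := vge_1 (dv x); have v0 := vge_0 (v x) 0.
  have vs : vge (v x) 0 (s x) by rewrite vgeE ?sE ?s0.
  by apply: ord2P; apply: ord2P; rewrite mxE.
exists h => // a m mEq.
pose w : 'rV[F]_2 := delta_mx 0 1.
have w0 : w != 0 by rewrite row2_neq0 !mxE /= oner_eq0 orbT.
apply: (@hecke_dichotomy _ _ Fh E s t h m a w mE E0 fE ids sE tE) => //.
- by move=> x; case: (ch x).
- by move=> x; case: (ch x).
have gmE : gord m = E.
  apply/funext => x; rewrite /gord mEq hE mul_mx2 det_mx2 -sE; congr (v x _); ring.
have wmE : word w m = E.
  apply/funext => x; rewrite /word /minv /rowg mEq hE mul_mx2 !mxE !big_ord_recl !big_ord0 !mxE /=.
  by rewrite rmorph0 rmorph1 !(mul0r, mulr0, mul1r, addr0, add0r) eqxx sE.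
by rewrite /instab /wdeg gmE wmE; lia.
Qed.

(** On the coset U of the base point the inner integrand is at least 1 at every n, so the real part
    of the constant term is at least the measure of U throughout the compact quotient N(F)\N(A). *)
Lemma class1_positive : Cintegral nu (constant_term class1 E) != 0.
Proof.
have ac := class1_automorphic; have [h ch ht] := base_point.
have cO := omega_compact fE E0; have oO := @omega_open E.
pose U : set GA := [set piG g | g in [set g : GL2A | forall x, exists2 u, GLint (v x) u & g x = h x *m u]].
have Uh : U (piG h) by exists h => // x; exists 1%:M; [exact: GLint_id | rewrite mulmx1].
have UO : U `<=` omega E by move=> _ [g gh <-]; exists g => //; exact: coarse_coset ch gh.
have oU : open U.
  apply: coset_invariant_open => g g' [g0 g0h /pi_GA_eq[z iz gE]] gg'.
  have uex x : exists u, GLint (v x) u /\ g' x = g x *m u.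
    by have [u iu hE] := gg' x; exists u.
  pose u x := sval (cid (uex x)).
  have uP x : GLint (v x) (u x) /\ g' x = g x *m u x := svalP (cid (uex x)).
  have [x||h0 h0E] := @mk_GL2A _ _ Fh (fun x => g0 x *m u x).
  - by rewrite unitmx_mul gval_unit; case: (uP x) => -[].
  - by apply: almost_allW (gval_int g0) => x G; apply: GLint_mul => //; case: (uP x).
  exists h0; last by apply/pi_GA_eq; exists z => // x; rewrite (uP x).2 gE h0E -scalemxAl.
  move=> x; have [u1 iu1 g0E] := g0h x; exists (u1 *m u x); last by rewrite h0E g0E mulmxA.
  by apply: GLint_mul => //; case: (uP x).
have mU := mu_pos oU (ex_intro _ _ Uh).
pose G a (g : GA) : R := complex.Re (omega1 E g * class1 (mulG (nA a) g)).
have Gge a (g : GA) : 0 <= G a g.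
  rewrite /G /omega1; case: asboolP => _; last by rewrite mul0r.
  by rewrite mul1r /class1; case: asboolP.
have GU a (g : GA) : U g -> 1 <= G a g.
  move=> Ug; have Og := UO _ Ug; rewrite /G /omega1; case: asboolP => // _.
  move: Ug => [g0 g0h <-]; have [|m [_ [-> _ _ mg _]]] := @nA_gequiv a a g0.
    by exists 0 => x; rewrite rmorph0 add0r.
  rewrite mul1r class1_pi; case: asboolP => // nt; case: nt; apply: gequiv_sym.
  have [m0 m0E] : exists m0 : GL2A, forall x, m0 x = mx2 1 (a x) 0 1 *m h x.
    by exists (GL2A_mul (GL2 (unip_unit a) (unip_int a)) h) => x; rewrite /= unipE.
  apply: gequiv_trans (ht _ _ m0E); apply: gequiv_sym.
  apply: right_coset_gequiv => x; have [u iu gE] := g0h x; exists u => //.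
  by rewrite mg m0E gE mulmxA.
pose c := fine (mu U).
have c0 : 0 < c.
  rewrite /c fine_gt0 // mU /=; apply: le_lt_trans (mu_fin cO oO).
  by apply: le_measure; rewrite ?inE //; exact: open_borel_measurable.
have ReC n : c <= complex.Re (constant_term class1 E n).
  rewrite /constant_term /hecke_act /Cintegral /= -[c]mul1r.
  apply: (Rintegral_gt0 cO oO (mu_fin cO oO)) => //; [|by move=> g nO; rewrite /G /omega1; case: asboolP => // _; rewrite mul0r| exact: Gge | exact: GU].
  move=> Y; apply: (fiber_open (H := fun q : GA => complex.Re (omega1 E q * class1 (mulG (nA (repr n)) q)))).
  by move=> g g' gg'; rewrite (hecke_integrand_coset _ _ ac gg').
rewrite /Cintegral eq_complex /= negb_and; apply/orP; left; rewrite gt_eqF //.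
apply: (@lt_le_trans _ _ (c * fine (nu [set: NFA]))).
  by apply: mulr_gt0 => //; rewrite fine_gt0 // nu_pos.
apply: (@Rintegral_gt0 R _ nu [set: NFA] [set: NFA] _ _ cN openT nu_fin) => //.
- move=> Y; have := constant_term_open (Y := @complex.Re R @^-1` Y) ac fE E0; exact.
- by move=> n [].
- exact: openT.
- by move=> n; apply: le_trans (ReC n); exact: ltW.
- by move=> n _; exact: ReC.
Qed.
End Induction.

Lemma V1_determined f : V1 f -> (forall g, dbound (m_X X) g -> f (piG g) = 0) -> forall p, f p = 0.
Proof.
move=> [af cf] f0; have step (N : nat) : forall g, dbound (m_X X + N%:Z) g -> f (piG g) = 0.
  elim: N => [|N IH] g gN; first by apply: f0; move: gN; rewrite addr0.
  have [gN'|nN] := pselect (dbound (m_X X + N%:Z) g); first exact: IH.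
  have [w [w0 gw]] : exists w : 'rV[F]_2, w != 0 /\ m_X X + N%:Z < instab w g.
    apply: contrapT => nw; apply: nN => w w0; rewrite leNgt; apply/negP => gw.
    by apply: nw; exists w.
  have gw' : instab w g = m_X X + N%:Z + 1 by have := gN w w0; lia.
  have mX : m_X X < m_X X + N%:Z + 1 by lia.
  have [E [s [t [[E0 fE dE] ids sE tE gt]]]] := deep_form w0 gw' mX.
  rewrite -(automorphic_gequiv af gt); have mE : m_X X < dg E by rewrite dE.
  have ac := class1_automorphic t.
  have key n : constant_term f E n = f (piG t) * constant_term (class1 t) E n.
    rewrite -constant_term_scale // /constant_term /hecke_act; congr (Cintegral mu _).
    apply/funext => p; rewrite /omega1; case: asboolP => [Op|_]; last by rewrite !mul0r.
    rewrite !mul1r; move: Op => [h ch <-].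
    have [|m [_ [-> _ _ mh _]]] := @nA_gequiv (repr n) (repr n) h.
      by exists 0 => x; rewrite rmorph0 add0r.
    rewrite class1_pi; case: asboolP => [tm|ntm].
      by rewrite mulr1; exact: automorphic_gequiv.
    rewrite mulr0; apply: IH => w' w'0; rewrite leNgt; apply/negP => mw'.
    apply: ntm; apply: gequiv_sym.
    apply: (hecke_dichotomy (E := E) (h := h) (c := fun x => repr n x) (w := w') mE E0 fE ids sE tE) => //.
    - by move=> x; case: (ch x).
    - by move=> x; case: (ch x).
    - by rewrite dE; lia.
  have := cf E fE E0; have -> : constant_term f E = (fun n => f (piG t) * constant_term (class1 t) E n).
    by apply/funext => n; exact: key.
  rewrite CintegralZ; last exact: constant_term_integrable.
  move/eqP; rewrite mulf_eq0 (negPf (class1_positive E0 fE mE ids sE tE)) orbF.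
  by move/eqP.
(* Each class has finite delta, so the induction reaches it for some N. *)
move=> p; rewrite -[p]reprK; have [N gN] := dbound_exists (repr p).
apply: (step N) => w w0; apply: le_trans (gN w w0) _; rewrite lerDr.
by rewrite /m_X le_max lexx orbT.
Qed.
End HeckeOperators.

(** * Vector bundles as adelic lattices *)

Section Bundles.
Context (k : finFieldType) (X : curve k).
Local Notation F := (ff X).
Implicit Types (x y : place X).

Lemma lattice_sub n x (b b' : 'M[F]_n) : b' \in unitmx -> lattice x b `<=` lattice x b' ->
  mxint x (b *m invmx b').
Proof.
move=> ub' bb' i j.
have [|c ic cE] := bb' (row i b).
  exists (delta_mx 0 i); last by rewrite rowE.
  by move=> ? l; rewrite mxE; case: (_ && _); [exact: vge_1 (ord_dval x) | exact: vge_0].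
have -> : (b *m invmx b') i j = (row i (b *m invmx b')) 0 j by rewrite [RHS]mxE.
by rewrite row_mul -cE mulmxK.
Qed.

Lemma lattice_eq n x (b b' : 'M[F]_n) : b \in unitmx -> b' \in unitmx -> lattice x b = lattice x b' ->
  exists2 c, GLint x c & b = c *m b'.
Proof.
move=> ub ub' bb'; have dx := ord_dval x.
exists (b *m invmx b'); last by rewrite mulmxKV.
have i1 : mxint x (b *m invmx b') by apply: lattice_sub => //; rewrite bb'.
have i2 : mxint x (b' *m invmx b) by apply: lattice_sub => //; rewrite bb'.
have uc : b *m invmx b' \in unitmx by rewrite unitmx_mul ub unitmx_inv.
have d0 : \det (b *m invmx b') != 0 by rewrite -unitfE -unitmxE.
split=> //; apply/eqP; rewrite eq_le andbC.
have := mxint_det dx i1; rewrite vgeE // => -> /=.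
have := mxint_det dx i2.
have -> : \det (b' *m invmx b) = (\det (b *m invmx b'))^-1.
  by rewrite !det_mulmx !det_inv invfM invrK mulrC.
by rewrite vgeE ?invr_eq0 // (dvalV dx) oppr_ge0.
Qed.

(** Two frames of one lattice differ by an integral matrix of unit determinant, so the [xget] in
    [ord_det] has a single candidate. *)
Lemma ord_det_frame n (M : bundle X n) x (b : 'M[F]_n) : b \in unitmx -> stalk M x = lattice x b ->
  ord_det M x = x (\det b).
Proof.
move=> ub Mb; rewrite /ord_det.
apply: xget_unique; first by exists b.
move=> _ [b' [ub' Mb' ->]]; have [|c [uc _ dc] ->] := @lattice_eq n x b' b ub' ub; first by rewrite -Mb -Mb'.
by rewrite det_mulmx (dvalM (ord_dval x)) ?dc ?add0r // -unitfE -unitmxE.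
Qed.

Lemma fsupp_ord_det n (M : bundle X n) : fsupp (ord_det M).
Proof.
have [x0 _] := place_inhabited X; have [U [b [_ fU ub Ub]]] := loc_free M x0.
apply: almost_allW (almost_allI fU (ord_finite (\det b))) => y [Uy yb].
by rewrite (ord_det_frame ub) ?yb //; exact: Ub.
Qed.

Lemma degE n (M : bundle X n) : deg M = dg (fun x => - ord_det M x).
Proof. by rewrite dgN //; exact: fsupp_ord_det. Qed.

Lemma structure_sheaf_loc_free x : exists (U : set (place X)) (b : 'M[F]_1),
  [/\ U x, almost_all U, b \in unitmx & forall y, U y -> lattice y 1%:M = lattice y b].
Proof. by exists setT, 1%:M; split; rewrite ?unitmx1 //; exact: almost_allT. Qed.

Definition structure_sheaf : bundle X 1 := Bundle structure_sheaf_loc_free.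

Lemma pclass_refl (M : bundle X 2) : pclass M M.
Proof.
exists structure_sheaf, 1%:M; rewrite ?unitmx1 // => x.
have [U [b [Ux _ _ Ub]]] := loc_free M x; have dx := ord_dval x.
apply/seteqP; split=> w /=.
  move=> Mw; exists w; last by rewrite mulmx1.
  exists 1%:M, w; split; rewrite ?mxE ?scale1r //.
  exists 1%:M; rewrite ?mulmx1 // => i j; rewrite mxE !ord1; exact: vge_1.
move=> [_ [l [m [[c ic <-] Mm ->]]] <-]; move: Mm; rewrite !mulmx1 !(Ub x Ux) => -[d id <-].
exists (c 0 0 *: d); last by rewrite -scalemxAl.
by move=> i j; rewrite mxE; apply: (vge_mul0 dx); [exact: ic | exact: id].
Qed.

Context (Fh : forall x : place X, completion x).
Local Notation v x := (@cval _ _ x (Fh x)).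
Local Notation GL2A := (GL2A Fh).
Local Notation em x := (cemb (Fh x)).
Implicit Types (g h : GL2A).

Let dv x : is_dval (v x). Proof. exact: cval_dval. Qed.

Lemma mxint_emb m n x (c : 'M[F]_(m, n)) : mxint (v x) (map_mx (em x) c) <-> mxint x c.
Proof. by split=> ic i j; have := ic i j; rewrite mxE vge_emb. Qed.

Lemma GLint_emb n x (c : 'M[F]_n) : GLint x c -> GLint (v x) (map_mx (em x) c).
Proof. by move=> [uc ic dc]; split; [rewrite map_unitmx | exact/mxint_emb | rewrite det_map_mx cval_emb]. Qed.

(** The rational points of the lattice O_x^2 g^-1. The inverse makes the degree of the bundle equal
    to the degree of det g, without a sign. *)
Definition adelic_stalk g x : set 'rV[F]_2 := [set w | mxint (v x) (map_mx (em x) w *m g x)].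

Definition frame g x (b : 'M[F]_2) := b \in unitmx /\ GLint (v x) (map_mx (em x) b *m g x).

Lemma frame_lattice g x b : frame g x b -> adelic_stalk g x = lattice x b.
Proof.
move=> [ub Gu]; have [uu iu _] := Gu; have [_ iV _] := GLint_inv (dv x) Gu.
apply/seteqP; split=> w /=.
  move=> iw; exists (w *m invmx b); last by rewrite mulmxKV.
  apply/(mxint_emb x).
  have -> : map_mx (em x) (w *m invmx b) = map_mx (em x) w *m g x *m invmx (map_mx (em x) b *m g x).
    have -> : map_mx (em x) w = map_mx (em x) (w *m invmx b) *m map_mx (em x) b.
      by rewrite -map_mxM mulmxKV.
    by rewrite -[_ *m _ *m g x]mulmxA mulmxK.
  exact: (mxint_mul (dv x)).
move=> [c /(mxint_emb x) ic <-]; rewrite /adelic_stalk /= map_mxM -mulmxA.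
exact: (mxint_mul (dv x)).
Qed.

Lemma entries_bounded x (A : 'M[Fh x]_2) : exists m, forall i j, vge (v x) m (A i j).
Proof.
have self a : vge (v x) (v x a) a by rewrite /vge lexx orbT.
exists (Num.min (Num.min (v x (A 0 0)) (v x (A 0 1))) (Num.min (v x (A 1 0)) (v x (A 1 1)))).
by apply: ord2P; apply: ord2P; apply: vge_trans (self _); rewrite !ge_min lexx ?orbT.
Qed.

(** A rational b close to g^-1 is a frame: precision 1 - m, with m a lower bound for the orders of
    the entries of g, makes b g congruent to 1 modulo the maximal ideal. *)
Lemma frame_exists g x : exists b, frame g x b.
Proof.
have [m mP] := entries_bounded (g x).
have /choice[b0 bP] : forall ij : 'I_2 * 'I_2, exists f, vge (v x) (1 - m) (invmx (g x) ij.1 ij.2 - em x f).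
  by move=> ij; exact: cval_dense.
pose b : 'M[F]_2 := \matrix_(i, j) b0 (i, j).
pose e := (invmx (g x) - map_mx (em x) b) *m g x.
have ie i j : vge (v x) 1 (e i j).
  rewrite mxE; apply: (vge_sum (dv x)) => l _; rewrite -[1](subrK m).
  apply: (vge_mul (dv x)); last exact: mP.
  by rewrite !mxE; exact: (bP (i, l)).
have uE : map_mx (em x) b *m g x = 1%:M - e.
  by rewrite /e mulmxBl mulVmx ?gval_unit // opprB addrC subrK.
clearbody e; have [i00 i01] := (ie 0 0, ie 0 1); have [i10 i11] := (ie 1 0, ie 1 1).
have w0 a : vge (v x) 1 a -> vge (v x) 0 a by apply: vge_trans.
have d1 : vge (v x) (v x 1 + 1) (\det (1%:M - e) - 1).
  rewrite (dval1 (dv x)) add0r [X in \det X]mx2_eta det_mx2 !mxE /=.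
  have -> : (1 - e 0 0) * (1 - e 1 1) - (0 - e 0 1) * (0 - e 1 0) - 1 =
    e 0 0 * e 1 1 - e 0 0 - e 1 1 - e 0 1 * e 1 0 by ring.
  by do !(apply: (vge_sub (dv x)) => //); apply: (vge_mul0 (dv x)) => //; exact: w0.
have [d0 dE] := vge_dval_eq (dv x) (oner_neq0 _) d1.
have uu : map_mx (em x) b *m g x \in unitmx by rewrite uE unitmxE unitfE.
exists b; split; first by move: uu; rewrite unitmx_mul map_unitmx => /andP[].
split=> //; last by rewrite uE dE (dval1 (dv x)).
move=> i j; rewrite uE mxE; apply: (vge_add (dv x)); first by case: (GLint_id (dv x) 2).
by rewrite mxE (vge_opp (dv x)); exact: w0.
Qed.

Lemma adelic_loc_free g x : exists (U : set (place X)) (b : 'M[F]_2),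
  [/\ U x, almost_all U, b \in unitmx & forall y, U y -> adelic_stalk g y = lattice y b].
Proof.
have [b [ub Gb]] := frame_exists g x; exists [set y | GLint (v y) (map_mx (em y) b *m g y)], b; split=> //.
  by apply: almost_allW (almost_allI (rational_GLint Fh ub) (gval_int g)) => y [? ?]; exact: (GLint_mul (dv y)).
by move=> y Gy; exact: frame_lattice.
Qed.

Definition adelic_bundle g : bundle X 2 := Bundle (adelic_loc_free g).

Lemma deg_adelic_bundle g : deg (adelic_bundle g) = dg (gord g).
Proof.
rewrite degE; congr dg; apply/funext => x; have [b [ub Gb]] := frame_exists g x.
rewrite (@ord_det_frame 2 (adelic_bundle g) x b ub); last exact: frame_lattice.
have [_ _] := Gb; rewrite det_mulmx det_map_mx (dvalM (dv x)) ?GL2A_det0 ?fmorph_eq0 -?unitfE -?unitmxE //.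
by rewrite cval_emb /gord => /eqP; rewrite addr_eq0 => /eqP ->; rewrite opprK.
Qed.

Lemma line_subbundle_deg g (L : bundle X 1) phi : line_subbundle L (adelic_bundle g) phi ->
  phi != 0 /\ deg L <= wdeg phi g.
Proof.
move=> [Lphi inj_phi _]; have phi0 : phi != 0.
  apply/negP => /eqP phi0; have /matrixP/(_ 0 0)/eqP := inj_phi 1%:M 0 (etrans (congr1 _ phi0) (etrans (mulmx0 _ _) (esym (mul0mx _ _)))).
  by rewrite !mxE eqxx oner_eq0.
split=> //; rewrite degE; apply: le_dg; [|exact: fsupp_word|].
  by apply: almost_allW (fsupp_ord_det L) => x ->; rewrite oppr0.
move=> x; have [U [a [Ux _ ua Ua]]] := loc_free L x.
have a0 : a 0 0 != 0 by move: ua; rewrite unitmxE det_mx11 unitfE.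
rewrite (ord_det_frame ua (Ua x Ux)) det_mx11.
have /Lphi : stalk L x a.
  rewrite (Ua x Ux); exists 1%:M; rewrite ?mul1mx // => i j; rewrite mxE !ord1; exact: vge_1 (ord_dval x).
move=> ia; have : 0 <= minv (v x) (em x (a 0 0) *: rowg phi g x).
  apply: minv_le; first by rewrite scaler_eq0 negb_or fmorph_eq0 a0 rowg_neq0.
  have -> : em x (a 0 0) *: rowg phi g x = map_mx (em x) (a *m phi) *m g x.
    by rewrite {2}[a]mx11_scalar mul_scalar_mx map_mxZ -scalemxAl.
  exact: ia.
rewrite (minvZ (dv x)) ?rowg_neq0 ?fmorph_eq0 // cval_emb /word.
by rewrite -lerBlDl sub0r.
Qed.

Lemma delta_adelic_bundle (R : realType) g N : dbound N g -> (delta R (adelic_bundle g) <= N%:~R%:E)%E.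
Proof.
move=> gN; apply: ge_ereal_sup => _ [L [phi /line_subbundle_deg[phi0 dL]] <-].
rewrite lee_fin ler_int deg_adelic_bundle.
by have := gN phi phi0; rewrite /instab; lia.
Qed.

(** An isomorphism after twisting is a rational matrix phi, which supplies gam; local generators of
    L supply the scalar idele; and comparing the frames of the two lattices at x supplies the
    integral matrix u. *)
Lemma pclass_gequiv g h : pclass (adelic_bundle g) = pclass (adelic_bundle h) -> gequiv g h.
Proof.
move=> gh; have : pclass (adelic_bundle g) (adelic_bundle h) by rewrite gh; exact: pclass_refl.
move=> [L [phi uphi Lphi]].
have /choice[a aP] : forall x, exists a, a != 0 /\ stalk L x = lattice x (a%:M : 'M[F]_1).
  move=> x; have [U [a [Ux _ ua Ua]]] := loc_free L x; exists (a 0 0); rewrite -mx11_scalar; split; last exact: Ua.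
  by move: ua; rewrite unitmxE det_mx11 unitfE.
have a0 x : a x != 0 by case: (aP x).
have uex x : exists u, GLint (v x) u /\ h x = (em x (a x))^-1 *: (map_mx (em x) (invmx phi) *m g x *m u).
  have [b fb] := frame_exists g x; have [b' fb'] := frame_exists h x.
  have [[ub Gb] [ub' Gb']] := (fb, fb').
  have uab : a x *: (b *m phi) \in unitmx by rewrite unitmxZ ?unitfE ?a0 // unitmx_mul ub.
  have [|c Gc cE] := lattice_eq uab ub' (x := x).
    rewrite -(frame_lattice fb') -[adelic_stalk h x]/(stalk (adelic_bundle h) x) Lphi.
    apply/seteqP; split=> w /=.
      move=> [c ic <-]; exists (a x *: (c *m b)); last by rewrite -scalemxAl -scalemxAr mulmxA.
      exists (a x)%:M, (c *m b); split; last by rewrite mxE eqxx.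
        by rewrite (aP x).2; exists 1%:M; rewrite ?mul1mx // => i j; rewrite mxE !ord1; exact: vge_1 (ord_dval x).
      by rewrite /= (frame_lattice fb); exists c.
    move=> [w1 [l [m [Ll]]]]; rewrite /= (frame_lattice fb) => -[c ic <-] -> <-.
    move: Ll; rewrite (aP x).2 => -[d id <-]; exists (d 0 0 *: c).
      by move=> i j; rewrite mxE; apply: (vge_mul0 (ord_dval x)).
    by rewrite mul_mx_scalar mxE -!scalemxAl -scalemxAr mulmxA scalerA mulrC.
  have [uu _ _] := Gb.
  exists (invmx (map_mx (em x) b *m g x) *m (map_mx (em x) c *m (map_mx (em x) b' *m h x))); split.
    by do !(apply: (GLint_mul (dv x)) => //); [exact: (GLint_inv (dv x)) | exact: GLint_emb].
  have -> : map_mx (em x) c *m (map_mx (em x) b' *m h x) = em x (a x) *: (map_mx (em x) (b *m phi) *m h x).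
    by rewrite mulmxA -map_mxM -cE map_mxZ -scalemxAl.
  rewrite -!scalemxAr scalerA mulVf ?fmorph_eq0 // scale1r map_mxM.
  have ubE : map_mx (em x) b \in unitmx by rewrite map_unitmx.
  have -> : invmx (map_mx (em x) b *m g x) = invmx (g x) *m invmx (map_mx (em x) b).
    by rewrite -[RHS]mulmx1 -(mulmxV uu) !mulmxA mulmxKV // mulVmx ?gval_unit // mul1mx.
  rewrite !mulmxA mulmxK ?gval_unit // mulmxKV // -map_mxM mulVmx //.
  by rewrite map_mx1 mul1mx.
exists (invmx phi), (fun x => (em x (a x))^-1), (fun x => sval (cid (uex x))); split.
- by rewrite unitmx_inv.
- apply: idele_inv; split=> [x|]; first by rewrite fmorph_eq0.
  apply: almost_allW (fsupp_ord_det L) => x; rewrite cval_emb (@ord_det_frame 1 L x (a x)%:M) ?det_scalar1 //.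
    by rewrite unitmxE det_scalar1 unitfE.
  by case: (aP x).
- by move=> x; case: (svalP (cid (uex x))).
- by move=> x; case: (svalP (cid (uex x))).
Qed.
End Bundles.

(** * Counting classes and the dimension bound *)

Lemma card_le_of_inj (T : Type) (S : set T) (f : nat -> T) n :
  (forall i, (i < n)%N -> S (f i)) -> (forall i j, (i < n)%N -> (j < n)%N -> f i = f j -> i = j) ->
  `I_n #<= S.
Proof.
move=> Sf injf; apply: card_le_trans (subset_card_le (_ : f @` `I_n `<=` S)); last first.
  by move=> _ [i i_n <-]; exact: Sf.
have /card_eqPle[] // : f @` `I_n #= `I_n.
by apply: inj_card_eq => i j; rewrite !inE; exact: injf.
Qed.

(** The list r may repeat classes. Its members satisfying D are grouped by their value under q, and
    one is picked from each group; coverage survives because equal values under q imply [rel]. *)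
Lemma finite_class_representatives (A T : Type) (I : finType) (D : A -> Prop) (q : A -> T)
    (rel : A -> A -> Prop) (r : I -> A) (a0 : A) :
  (forall a, D a -> exists2 i, D (r i) & rel a (r i)) ->
  (forall a b, D a -> D b -> q a = q b -> rel a b) ->
  (forall a b c, rel a b -> rel b c -> rel a c) ->
  exists n (s : nat -> A), [/\ forall i, (i < n)%N -> D (s i),
    forall i j, (i < n)%N -> (j < n)%N -> q (s i) = q (s j) -> i = j &
    forall a, D a -> exists2 i, (i < n)%N & rel a (s i)].
Proof.
move=> rD qrel relT.
pose C i := [set j | `[< D (r j) /\ q (r j) = q (r i) >]]%SET.
pose S := [set C i | i in [set i | `[< D (r i) >]]]%SET.
have /choice[t tP] : forall c : {set I}, exists a, c \in S -> exists i, [/\ D (r i), a = r i & c = C i].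
  move=> c; have [cS|_] := boolP (c \in S); last by exists a0.
  case/imsetP: cS => i; rewrite inE => /asboolP Di cE.
  by exists (r i) => _; exists i.
exists #|S|, (fun n => t (nth finset.set0 (enum S) n)).
have nS i : (i < #|S|)%N -> nth finset.set0 (enum S) i \in S.
  by move=> iS; rewrite -mem_enum mem_nth // -cardE.
split=> [i /nS /tP[l [Dl -> _]] //|i j iS jS|a Da].
  have [l [Dl -> Cl]] := tP _ (nS i iS); have [m [Dm -> Cm]] := tP _ (nS j jS) => qlm.
  apply/eqP; rewrite -(nth_uniq finset.set0 _ _ (enum_uniq S)) -?cardE // Cl Cm; apply/eqP/setP => b.
  by rewrite !inE qlm.
have [i Di ai] := rD a Da.
have CS : C i \in S by apply: imset_f; rewrite inE; apply/asboolP.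
exists (index (C i) (enum S)); first by rewrite cardE index_mem mem_enum.
rewrite nth_index ?mem_enum //; have [l [Dl -> Cl]] := tP _ CS.
apply: relT ai _; apply: qrel => //.
have : i \in C i by rewrite inE; apply/asboolP.
by rewrite Cl inE => /asboolP[].
Qed.

Lemma dependent_on_points (K : fieldType) (T : Type) d n (e : 'I_d -> T -> K^o) (p : 'I_n -> T) :
  (n < d)%N -> exists2 u : 'rV[K]_d, u != 0 & forall j, \sum_i u 0 i * e i (p j) = 0.
Proof.
move=> nd; pose A : 'M[K]_(d, n) := \matrix_(i, j) e i (p j).
have : kermx A != 0.
  rewrite kermx_eq0 /row_free neq_ltn; apply/orP; left.
  exact: leq_ltn_trans (rank_leq_col A) nd.
move=> /rowV0Pn[u /sub_kermxP uA u0]; exists u => // j.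
have /matrixP/(_ 0 j) := uA; rewrite !mxE => uAj; rewrite -[RHS]uAj.
by apply: eq_bigr => i _; rewrite mxE.
Qed.

Theorem theorem10p6 (R : realType) (k : finFieldType) (X : curve k)
    (Fh : forall x : place X, completion x)
    (mu : {measure set (borel (GA Fh)) -> \bar R})
    (nu : {measure set (borel (NFA Fh)) -> \bar R})
    (mu_haar : is_haar (@mulG _ _ Fh) mu) (mu_K : mu (GK Fh) = 1%E)
    (nu_haar : is_haar (@addN _ _ Fh) nu) :
  exists2 d : nat,
    is_dim (@id R[i]) (V := GA Fh -> R[i]^o) (V0 mu nu) [set 0] d &
    `I_d #<= [set pclass M | M in
                [set M : bundle X 2 | (delta R M <= (m_X X)%:~R%:E)%E]].
Proof.
have [_ mu_compact mu_pos] := mu_haar; have [_ nu_compact nu_open] := nu_haar.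
have mu_fin (C : set (GA Fh)) : compact C -> open C -> (mu C < +oo)%E.
  by move=> cC oC; apply: mu_compact => //; exact: open_borel_measurable.
have oN : open [set: NFA Fh] by exact: openT.
have nu_fin : (nu [set: NFA Fh] < +oo)%E.
  by apply: nu_compact; [exact: NFA_compact | exact: open_borel_measurable].
have nu_pos : (0 < nu [set: NFA Fh])%E by apply: nu_open => //; exists point.
have [I [r rP]] := classes_finite Fh (m_X X).
(* The representatives are thinned out until their classes in PBun_2 are distinct, so that n is at
   most the number of classes to be counted. *)
have [n [s [Ds qs cs]]] := @finite_class_representatives (GL2A Fh) (set (bundle X 2)) I
  (dbound (m_X X)) (fun g => pclass (adelic_bundle g)) (@gequiv _ _ Fh) r (GL2A1 Fh)
  (fun g Dg => let: ex_intro i gi := rP g Dg in ex_intro2 _ _ i (dbound_gequiv gi Dg) gi)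
  (fun g h _ _ gh => pclass_gequiv gh) (@gequiv_trans _ _ Fh).
have [||d dn dimV] := @is_dim_bounded R[i] R[i] idfun (GA Fh -> R[i]^o) (V0 mu nu) [set 0] n.
- split; first by split=> // a b -> ->; rewrite /= subrr.
  by move=> c a ->; rewrite /= scaler0.
- move=> d e Ve ie; rewrite leqNgt; apply/negP => nd.
  (* More than n members of [V0] have a nontrivial combination vanishing at the n representatives.
     By [V1_determined] it vanishes everywhere, against independence. *)
  have [u u0 up] := dependent_on_points e (fun j : 'I_n => \pi_(GA Fh)%qT (s j)) nd.
  have V1f : V1 mu nu (\sum_i u 0 i *: e i).
    by apply: V1_sum => // i; exact: V0_V1.
  have [af _] := V1f.
  have f0 p : (\sum_i u 0 i *: e i) p = 0.
    apply: (V1_determined mu_fin mu_pos nu_fin nu_pos V1f) => g Dg.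
    have [j jn gj] := cs g Dg.
    rewrite -(automorphic_gequiv af gj) fct_sumE -[RHS](up (Ordinal jn)).
    by apply: eq_bigr.
  have /(ie (fun i => u 0 i)) ui : [set 0] (\sum_i u 0 i *: e i) by apply/funext => p; rewrite f0.
  by move/eqP: u0; apply; apply/rowP => i; rewrite ui mxE.
exists d; first exact: dimV.
apply: (@card_le_of_inj _ _ (fun i => pclass (adelic_bundle (s i)))).
  move=> i i_d; exists (adelic_bundle (s i)) => //=.
  by apply: delta_adelic_bundle; apply: Ds; exact: leq_trans dn.
by move=> i j i_d j_d; apply: qs; apply: (leq_trans _ dn).
Qed.
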